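(* Suppose that $\frac1N\sum_{i=1}^N\delta_{h_i^d}\xrightarrow{w}\nu$, that the effective reference distribution $J\#\nu$ has a finite, positive definite covariance matrix $\Sigma_{\mathrm{ERD}}$, and that $$\limsup_{N\to\infty}\frac1N\sum_{i=1}^N\|J(h_i^d)\|^2\le\int\|J(z)\|^2\,d\nu(z).$$ Let $N=m+n\to\infty$ with $m/N\to\lambda\in(0,1)$. Then, under $H_0:\mu_1=\mu_2$, $$T^{\nu,J}_{m,n}\xrightarrow{w}\chi^2_d .$$
   Context: $\mathcal P_{ac}(\mathbb R^d)$ is the set of Lebesgue absolutely continuous probability measures on $\mathbb R^d$, and $\mu_1,\mu_2,\nu\in\mathcal P_{ac}(\mathbb R^d)$. $X_1,\dots,X_m$ are i.i.d. $\mu_1$ and $Y_1,\dots,Y_n$ are i.i.d. $\mu_2$, the two samples being independent; $N=m+n$ and $Z_1,\dots,Z_N$ enumerates the pooled sample. For each $N$, $\{h_1^d,\dots,h_N^d\}\subset\mathbb R^d$ is a fixed set of $N$ vectors (dependence on $N$ suppressed). Empirical ranks: $\widehat\sigma\in\arg\min_{\sigma\in S_N}\sum_{i=1}^N\|Z_i-h^d_{\sigma_i}\|^2$, where $S_N$ is the set of permutations of $\{1,\dots,N\}$, and $\widehat R_{m,n}(Z_i):=h^d_{\widehat\sigma_i}$. $\nu$ is the reference distribution and $J:\mathbb R^d\to\mathbb R^d$ a score function, i.e. an injective function continuous Lebesgue a.e. The rank Hotelling $T^2$ statistic is $$T^{\nu,J}_{m,n}:=\frac{mn}{m+n}\,\Delta^{\top}\Sigma_{\mathrm{ERD}}^{-1}\Delta,\qquad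 \Delta:=\frac1m\sum_{i=1}^mJ(\widehat R_{m,n}(X_i))-\frac1n\sum_{j=1}^nJ(\widehat R_{m,n}(Y_j)).$$ *)

(* Defs.v *)
From HB Require Import structures.
From mathcomp Require Import all_boot all_order all_algebra all_fingroup.
From mathcomp Require Import all_classical all_reals all_analysis.

Set Implicit Arguments.
Unset Strict Implicit.
Unset Printing Implicit Defensive.

Import Order.TTheory GRing.Theory Num.Theory.
Import numFieldNormedType.Exports.

Local Open Scope classical_set_scope.
Local Open Scope ring_scope.

(* R^d is 'rV[R]_d, with its library topology; the library has no sigma-algebra
   on matrices, so we equip them with the Borel one. *)
Section matrix_borel.
Context (R : realType) (m n : nat).
Let borel_mx : set (set 'M[R]_(m, n)) := <<s open >>.
Let borel_mxC A : borel_mx A -> borel_mx (~` A).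
Proof. exact: sigma_algebraC. Qed.

HB.instance Definition _ := @isMeasurable.Build (sigma_display
  (open : set (set 'M[R]_(m, n)))) 'M[R]_(m, n) borel_mx
  (@sigma_algebra0 _ setT open) borel_mxC (@sigma_algebra_bigcup _ setT open).
End matrix_borel.

(* A topology together with a sigma-algebra, so that weak convergence is stated
   once for both R^d and R. *)
#[short(type="topMeasurableType")]
HB.structure Definition TopMeasurable d :=
  {T of Measurable d T & PointedTopological T}.

HB.instance Definition _ (R : realType) (m n : nat) :=
  PointedTopological.on 'M[R]_(m, n).
HB.instance Definition _ (R : realType) := PointedTopological.on (Real.sort R).

Definition weak_cvg {R : realType} {d} {T : topMeasurableType d}
    (mu_ : nat -> set T -> \bar R) (mu : set T -> \bar R) : Prop :=
  forall f : T -> R, continuous f -> (exists M, forall x, `|f x| <= M) ->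
    (\int[mu_ k]_x (f x)%:E)%E @[k --> \oo] --> (\int[mu]_x (f x)%:E)%E.

(* Lebesgue measure on R^d, as the iterated product of the one on R:
   Leb_(d+1)(A) = \int Leb_d {v | (x, v) \in A} dx. *)
Fixpoint lebesgue_rV {R : realType} {d : nat} : set 'rV[R]_d -> \bar R :=
  match d with
  | 0 => fun A => \d_(0 : 'rV[R]_0) A
  | d'.+1 => fun A =>
      (\int[lebesgue_measure]_(x in [set: R])
         lebesgue_rV [set v : 'rV[R]_d' | A (row_mx x%:M v : 'rV[R]_(1 + d'))])%E
  end.

Definition abs_continuous {R : realType} {d : nat}
    (mu : probability 'rV[R]_d R) : Prop :=
  forall A, measurable A -> lebesgue_rV A = 0%E -> mu A = 0%E.

(* The squared Euclidean norm; `|x| on 'rV[R]_d is the sup norm. *)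
Definition sqnorm {R : realType} {d : nat} (x : 'rV[R]_d) : R :=
  \sum_(i < d) x 0 i ^+ 2.

Definition empirical_measure {R : realType} {d N : nat}
    (h : 'I_N -> 'rV[R]_d) (A : set 'rV[R]_d) : \bar R :=
  ((N%:R^-1)%:E * \sum_(i < N) \d_(h i) A)%E.

(* The image J#nu for a J that is only measurable up to nu-null sets, which is
   what continuity almost everywhere gives: the preimage of a Borel set is a
   Borel set up to a nu-negligible one. *)
Definition is_image_measure {R : realType} {d : nat} (J : 'rV[R]_d -> 'rV[R]_d)
    (nu rho : probability 'rV[R]_d R) : Prop :=
  forall A, measurable A -> exists B, [/\ measurable B,
    nu.-negligible ((J @^-1` A) `+` B) & rho A = nu B].

Definition has_finite_covariance {R : realType} {d : nat}
    (rho : probability 'rV[R]_d R) : Prop :=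
  forall i : 'I_d, (fun z : 'rV[R]_d => z 0 i) \in Lfun rho 2%:E.

Definition covariance_mx {R : realType} {d : nat}
    (rho : probability 'rV[R]_d R) : 'M[R]_d :=
  \matrix_(i, j) fine (covariance rho (fun z : 'rV[R]_d => z 0 i)
                                      (fun z : 'rV[R]_d => z 0 j)).

Definition posdefmx {R : realType} {d : nat} (S : 'M[R]_d) : Prop :=
  forall v : 'rV[R]_d, v != 0 -> 0 < (v *m S *m v^T) 0 0.

Definition mutually_independent {R : realType} {d d'} {T : measurableType d}
    {T' : measurableType d'} (P : probability T R) {n : nat}
    (X : 'I_n -> {RV P >-> T'}) : Prop :=
  forall (K : {set 'I_n}) (A : 'I_n -> set T'), (forall i, measurable (A i)) ->
    P (\bigcap_(i in [set` K]) X i @^-1` A i) =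
    (\prod_(i in K) P (X i @^-1` A i))%E.

Definition iid_sample {R : realType} {d d'} {T : measurableType d}
    {T' : measurableType d'} (P : probability T R) {n : nat}
    (X : 'I_n -> {RV P >-> T'}) (mu : probability T' R) : Prop :=
  mutually_independent X /\
  forall i A, measurable A -> distribution P (X i) A = mu A.

(* g_sigma_preimage X is the sigma-algebra generated by X_1, ..., X_m. *)
Definition independent_samples {R : realType} {d d'} {T : measurableType d}
    {T' : measurableType d'} (P : probability T R) {m n : nat}
    (X : 'I_m -> {RV P >-> T'}) (Y : 'I_n -> {RV P >-> T'}) : Prop :=
  forall A B, g_sigma_preimage X A -> g_sigma_preimage Y B ->
    P (A `&` B) = (P A * P B)%E.

(* The pooled sample lists the first sample, then the second. *)
Definition pooled {T : Type} {m n : nat} (x : 'I_m -> T) (y : 'I_n -> T)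
    (i : 'I_(m + n)) : T :=
  match fintype.split i with inl a => x a | inr b => y b end.

Definition assignment_cost {R : realType} {d N : nat} (z h : 'I_N -> 'rV[R]_d)
    (s : 'S_N) : R :=
  \sum_(i < N) sqnorm (z i - h (s i)).

Definition optimal_assignment {R : realType} {d N : nat}
    (z h : 'I_N -> 'rV[R]_d) (s : 'S_N) : Prop :=
  forall t : 'S_N, assignment_cost z h s <= assignment_cost z h t.

(* With s an optimal assignment of the pooled sample, h (s i) is the empirical
   rank of its i-th point. *)
Definition score_difference {R : realType} {d m n : nat}
    (J : 'rV[R]_d -> 'rV[R]_d) (h : 'I_(m + n) -> 'rV[R]_d) (s : 'S_(m + n)) :
    'rV[R]_d :=
  m%:R^-1 *: \sum_(i < m) J (h (s (lshift n i))) -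
  n%:R^-1 *: \sum_(j < n) J (h (s (rshift m j))).

Definition rank_hotelling {R : realType} {d m n : nat} (S : 'M[R]_d)
    (J : 'rV[R]_d -> 'rV[R]_d) (h : 'I_(m + n) -> 'rV[R]_d) (s : 'S_(m + n)) :
    R :=
  let D := score_difference J h s in
  m%:R * n%:R / (m + n)%:R * (D *m invmx S *m D^T) 0 0.

(* The law of a sum of d squared independent standard normal variables. *)
Fixpoint chi_square {R : realType} (d : nat) : set R -> \bar R :=
  match d with
  | 0 => \d_(0 : R)
  | d'.+1 => pushforward (normal_prob (0 : R) 1 \x chi_square d')%E
               (fun p : R * R => p.1 ^+ 2 + p.2)
  end.

(* Main.v *)
(** Under H0 the pooled sample is exchangeable and has almost surely no ties
    (a tie puts a sample point on a hyperplane fixed by the others), so the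
    ranks are those of a uniform random permutation, and the statistic T is
    that of sampling m points without replacement from the scores J(h_i).
    By a Fatou argument and the limsup hypothesis, the empirical covariance of
    the scores converges to Sigma_ERD and max_i |J(h_i)|^2 = o(N).
    Exchanging a point of the first sample with one of the second gives an
    exchangeable pair. Applying Stein's identity to the vector field
    exp(-c T) W, W being the centered sample sum, yields an approximate
    differential equation for the Laplace transform F(c) = E exp(-c T), namely
    (1 + 2c) F'(c) = - d F(c) + o(1), so that F(c) tends to (1 + 2c)^(-d/2),
    which is the Laplace transform of chi^2_d. As T >= 0, convergence of
    Laplace transforms gives weak convergence: exp(-a t) f(t) is uniformly
    approximated on t >= 0 by polynomials in exp(-a t). *)

Require Import Defs.
From mathcomp Require Import all_boot all_order all_algebra all_fingroup.
From mathcomp Require Import all_classical all_reals all_analysis.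
From mathcomp Require Import measurable_realfun ring lra.

Set Implicit Arguments.
Unset Strict Implicit.
Unset Printing Implicit Defensive.

Import Order.TTheory GRing.Theory Num.Theory.
Import numFieldNormedType.Exports.

Local Open Scope classical_set_scope.
Local Open Scope ring_scope.

(** * Sampling without replacement *)

(** The hypotheses control only second moments of the scores, while the Taylor remainder in Stein's
    method is cubic in the sample sum. The damping in the field [exp (- c T) W] resolves this: every
    power of [T] that the remainder produces is absorbed by [exp (- c T)], and what is left is the
    largest swap length times a second moment. Two features of the data shape the rest. The vectors
    [h] may coincide, so an optimal permutation is determined only up to permutations that give the
    same ranks, and [sigma] itself need not be uniform; the law of the ranks is therefore expressed
    through functions that depend on a permutation [s] only through [h \o s]. Moreover [J] is
    continuous only almost everywhere and may fail to be Borel, so [g \o J] is no test function for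
    weak convergence: it is approached from below by Lipschitz functions, and the limsup hypothesis
    supplies the reverse inequality for functions of quadratic growth. *)

Definition perm_mean {R : realType} {N : nat} (f : 'S_N -> R) : R :=
  N`!%:R^-1 * \sum_(s : 'S_N) f s.

Section perm_mean_theory.
Context {R : realType} {N : nat}.
Implicit Types f g : 'S_N -> R.

Lemma perm_mean_cst (a : R) : perm_mean (fun _ : 'S_N => a) = a.
Proof.
rewrite /perm_mean sumr_const card_Sn -[in X in _ * X]mulr_natl mulrA mulVf ?mul1r//.
Qed.

Lemma eq_perm_mean f g : f =1 g -> perm_mean f = perm_mean g.
Proof. by move=> fg; rewrite /perm_mean (eq_bigr _ (fun s _ => fg s)). Qed.

Lemma perm_meanD f g :
  perm_mean (fun s => f s + g s) = perm_mean f + perm_mean g.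
Proof. by rewrite /perm_mean big_split/= mulrDr. Qed.

Lemma perm_meanZ a f : perm_mean (fun s => a * f s) = a * perm_mean f.
Proof. by rewrite /perm_mean -mulr_sumr mulrCA. Qed.

Lemma perm_meanN f : perm_mean (fun s => - f s) = - perm_mean f.
Proof. by rewrite /perm_mean sumrN mulrN. Qed.

Lemma perm_meanB f g :
  perm_mean (fun s => f s - g s) = perm_mean f - perm_mean g.
Proof. by rewrite perm_meanD perm_meanN. Qed.

Lemma perm_mean_sum (I : Type) (r : seq I) (P : pred I) (f : I -> 'S_N -> R) :
  perm_mean (fun s => \sum_(i <- r | P i) f i s) =
  \sum_(i <- r | P i) perm_mean (f i).
Proof. by rewrite /perm_mean exchange_big/= mulr_sumr. Qed.

Lemma le_perm_mean f g : (forall s, f s <= g s) -> perm_mean f <= perm_mean g.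
Proof. by move=> fg; rewrite ler_wpM2l ?invr_ge0// ler_sum. Qed.

Lemma perm_mean_ge0 f : (forall s, 0 <= f s) -> 0 <= perm_mean f.
Proof. by move=> f0; rewrite mulr_ge0 ?invr_ge0// sumr_ge0. Qed.

Lemma ler_norm_perm_mean f : `|perm_mean f| <= perm_mean (fun s => `|f s|).
Proof.
by rewrite /perm_mean normrM ger0_norm ?invr_ge0// ler_wpM2l ?invr_ge0// ler_norm_sum.
Qed.

(** Since [(t * s)%g i = s (t i)], left multiplication relabels the positions of the sample, and
    right multiplication would relabel the population. *)
Lemma perm_mean_mull (t : 'S_N) f : perm_mean (fun s => f (t * s)%g) = perm_mean f.
Proof. by rewrite /perm_mean [in RHS](reindex_inj (mulgI t)). Qed.

(** Transpositions show that all positions have the same mean, and the sum over the positions does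
    not depend on the permutation. *)
Lemma perm_mean_marginal (y : 'I_N -> R) (i : 'I_N) :
  perm_mean (fun s => y (s i)) = N%:R^-1 * \sum_k y k.
Proof.
have N0 : N%:R != 0 :> R by rewrite pnatr_eq0 -lt0n (leq_trans _ (ltn_ord i)).
apply: (mulfI N0); rewrite [RHS]mulVKf//.
transitivity (\sum_(k < N) perm_mean (fun s => y (s k))).
  rewrite (eq_bigr (fun=> perm_mean (fun s => y (s i)))).
    by rewrite sumr_const card_ord mulr_natl.
  move=> k _; rewrite -(perm_mean_mull (tperm i k)).
  by apply: eq_perm_mean => s; rewrite permM tpermR.
rewrite -perm_mean_sum -[RHS]perm_mean_cst; apply: eq_perm_mean => s.
by rewrite [RHS](reindex_inj (@perm_inj _ s)).
Qed.

End perm_mean_theory.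

Section sampling.
Context {R : realType} {m n : nat}.
Local Notation N := (m + n)%N.
Implicit Types (x y : 'I_N -> R) (s : 'S_N).

Definition sample_sum (x : 'I_N -> R) s : R := \sum_(i < m) x (s (lshift n i)).

Definition swap (i : 'I_m) (j : 'I_n) : 'S_N := tperm (lshift n i) (rshift m j).

Definition swap_diff x (i : 'I_m) (j : 'I_n) s : R :=
  x (s (rshift m j)) - x (s (lshift n i)).

Lemma sum_perm_split x s :
  \sum_k x k = sample_sum x s + \sum_(j < n) x (s (rshift m j)).
Proof. by rewrite (reindex_inj (@perm_inj _ s)) big_split_ord. Qed.

Lemma swap_diff_swap x i j s : swap_diff x i j (swap i j * s)%g = - swap_diff x i j s.
Proof. by rewrite /swap_diff !permM tpermL tpermR opprB. Qed.

Lemma sample_sum_swap x i j s :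
  sample_sum x (swap i j * s)%g = sample_sum x s + swap_diff x i j s.
Proof.
rewrite /sample_sum (bigD1 i)//= [in RHS](bigD1 i)//= permM tpermL.
rewrite (eq_bigr (fun k => x (s (lshift n k)))); last first.
  move=> k ki; rewrite permM tpermD//.
    by rewrite (inj_eq (@lshift_inj _ _)) eq_sym.
  by rewrite eq_sym eq_lrshift.
by rewrite /swap_diff; ring.
Qed.

(** This is the linear regression condition of exchangeable pairs: the average swap moves the sum by
    [- N / (m n)] times itself, because the second sample sums to [- sample_sum x s]. *)
Lemma sum_swap_diff x s : \sum_k x k = 0 ->
  \sum_(i < m) \sum_(j < n) swap_diff x i j s = - (N%:R * sample_sum x s).
Proof.
rewrite (sum_perm_split x s) => /eqP; rewrite addr_eq0 => /eqP xE.
rewrite /swap_diff.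
rewrite (eq_bigr (fun i => \sum_j x (s (rshift m j)) - n%:R * x (s (lshift n i)))).
  rewrite sumrB sumr_const card_ord -mulr_sumr -/(sample_sum x s).
  by rewrite -mulr_natl natrD xE; ring.
by move=> i _; rewrite sumrB sumr_const card_ord mulr_natl.
Qed.

(* The swapped permutation has the same law and the opposite difference, so
   the mean of [swap_diff x i j s * (g s + g (swap i j * s))] vanishes. *)
Lemma exchangeable_pair_identity x (g : 'S_N -> R) : \sum_k x k = 0 ->
  perm_mean (fun s => \sum_(i < m) \sum_(j < n)
    swap_diff x i j s * (g (swap i j * s)%g - g s)) =
  2 * N%:R * perm_mean (fun s => sample_sum x s * g s).
Proof.
move=> x0.
have E i j : perm_mean (fun s => swap_diff x i j s * g (swap i j * s)%g) =
    - perm_mean (fun s => swap_diff x i j s * g s).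
  rewrite -(perm_mean_mull (swap i j)) -perm_meanN; apply: eq_perm_mean => s.
  by rewrite swap_diff_swap mulgA tperm2 mul1g mulNr.
transitivity (\sum_(i < m) \sum_(j < n)
    (-2 * perm_mean (fun s => swap_diff x i j s * g s))).
  rewrite perm_mean_sum; apply: eq_bigr => i _.
  rewrite perm_mean_sum; apply: eq_bigr => j _.
  rewrite (eq_perm_mean (g := fun s => swap_diff x i j s * g (swap i j * s)%g -
    swap_diff x i j s * g s)) => [|s]; last by rewrite mulrBr.
  by rewrite perm_meanB E; ring.
transitivity (-2 * perm_mean (fun s =>
    (\sum_(i < m) \sum_(j < n) swap_diff x i j s) * g s)).
  rewrite (eq_perm_mean (g := fun s =>
    \sum_(i < m) \sum_(j < n) swap_diff x i j s * g s)); last first.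
    by move=> s; rewrite mulr_suml; apply: eq_bigr => i _; rewrite mulr_suml.
  rewrite perm_mean_sum mulr_sumr; apply: eq_bigr => i _.
  by rewrite perm_mean_sum mulr_sumr.
rewrite (eq_perm_mean (g := fun s => - N%:R * (sample_sum x s * g s))).
  by rewrite perm_meanZ; ring.
by move=> s; rewrite sum_swap_diff//; ring.
Qed.

(** The conditional second moment of a swap. The first two terms have joint mean
    [2 m n / N * \sum_k x k * y k], which is why [swap_cov_dev] divides by [2 m n]; the rest is
    fluctuation. *)
Lemma sum_swap_diff_mul x y s : \sum_k x k = 0 -> \sum_k y k = 0 ->
  \sum_(i < m) \sum_(j < n) swap_diff x i j s * swap_diff y i j s =
  m%:R * \sum_k x k * y k + (n%:R - m%:R) * sample_sum (fun k => x k * y k) s +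
  2 * (sample_sum x s * sample_sum y s).
Proof.
rewrite (sum_perm_split x s) (sum_perm_split y s).
rewrite (sum_perm_split (fun k => x k * y k) s) /=.
move=> /eqP; rewrite addr_eq0 => /eqP xE /eqP; rewrite addr_eq0 => /eqP yE.
rewrite (eq_bigr (fun i =>
  \sum_j x (s (rshift m j)) * y (s (rshift m j)) +
  (- x (s (lshift n i)) * \sum_j y (s (rshift m j)) +
  (- y (s (lshift n i)) * \sum_j x (s (rshift m j)) +
  n%:R * (x (s (lshift n i)) * y (s (lshift n i))))))).
  rewrite !big_split/= -!mulr_suml !sumrN sumr_const card_ord -mulr_sumr.
  rewrite -!/(sample_sum _ s) -mulr_natl -/(sample_sum (fun k => x k * y k) s).
  by rewrite xE yE; ring.
move=> i _.
have -> : n%:R * (x (s (lshift n i)) * y (s (lshift n i))) =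
  \sum_(j < n) x (s (lshift n i)) * y (s (lshift n i)).
  by rewrite sumr_const card_ord mulr_natl.
rewrite !mulr_sumr -!big_split/=; apply: eq_bigr => j _.
by rewrite /swap_diff; ring.
Qed.

Lemma perm_mean_sample_sum x :
  perm_mean (sample_sum x) = m%:R / N%:R * \sum_k x k.
Proof.
rewrite perm_mean_sum (eq_bigr (fun=> N%:R^-1 * \sum_k x k)) => [|i _].
    by rewrite sumr_const card_ord -[LHS]mulr_natl mulrA.
exact: perm_mean_marginal.
Qed.

(** The exchangeable pair identity for [g := sample_sum x] contains the variance on both sides, with
    coefficients [2] and [2 N], and is solved for it. *)
Lemma variance_sample_sum x : (0 < m)%N -> (0 < n)%N -> \sum_k x k = 0 ->
  perm_mean (fun s => sample_sum x s ^+ 2) =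
  m%:R * n%:R / (N%:R * (N%:R - 1)) * \sum_k x k ^+ 2.
Proof.
move=> m0 n0 x0.
have N1 : 2 <= N%:R :> R by rewrite (ler_nat _ 2); case: m n m0 n0 => [//|a] [//|b]; rewrite addSn addnS.
have := exchangeable_pair_identity (sample_sum x) x0.
rewrite (eq_perm_mean (g := fun s => m%:R * \sum_k x k * x k +
  ((n%:R - m%:R) * sample_sum (fun k => x k * x k) s +
  2 * (sample_sum x s * sample_sum x s)))); last first.
  move=> s; rewrite addrA -sum_swap_diff_mul//; apply: eq_bigr => i _.
  by apply: eq_bigr => j _; rewrite sample_sum_swap addrAC subrr add0r.
rewrite !perm_meanD !perm_meanZ perm_mean_cst perm_mean_sample_sum.
under [in X in _ -> X]eq_perm_mean do rewrite expr2.
under [in X in _ -> X]eq_bigr do rewrite expr2.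
set V := perm_mean _; set S := \sum_k _ => E.
have NE : N%:R = m%:R + n%:R :> R by rewrite natrD.
have Vn : (N%:R - 1) * V = (m%:R * n%:R / N%:R) * S.
  have : 2 * ((N%:R - 1) * V) = m%:R * S + (n%:R - m%:R) * (m%:R / N%:R * S) by lra.
  move=> E2; have -> : (N%:R - 1) * V = (m%:R * S + (n%:R - m%:R) * (m%:R / N%:R * S)) / 2 by lra.
  by rewrite NE; field; rewrite -NE; lra.
apply: (@mulfI _ (N%:R - 1)); first by lra.
by rewrite Vn; field; apply/andP; split; lra.
Qed.

End sampling.

(** * A Taylor bound for the damped vector field *)

Section taylor.
Context {R : realType}.
Implicit Types (c p r t x : R).

Lemma mul_expRN_le1 x : 0 <= x -> x * expR (- x) <= 1.
Proof.
move=> x0; rewrite expRN ler_pdivrMr ?expR_gt0// mul1r.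
by apply: le_trans (expR_ge1Dx x); rewrite lerDr.
Qed.

Lemma sqr_expRN_le4 x : 0 <= x -> x ^+ 2 * expR (- x) <= 4.
Proof.
move=> x0; have x20 : 0 <= x / 2 by lra.
have -> : x ^+ 2 * expR (- x) = 4 * (x / 2 * expR (- (x / 2))) ^+ 2.
  rewrite exprMn -[expR (- (x / 2)) ^+ 2]expRM_natl.
  by rewrite (_ : _ * - (x / 2) = - x); [field|lra].
rewrite ler_piMr// exprn_ile1// ?mul_expRN_le1//.
by rewrite mulr_ge0// expR_ge0.
Qed.

(* The bracketed sum is the first-order expansion at [t = 0] of
   [<D, g (w + t D)>] for [g w = exp (- c |w|^2) w], where [p = |w|^2],
   [r = <w, D>] and [delta = |D|^2]. *)
Lemma gaussian_field_taylor c p r (delta e : R) :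
  0 <= c -> 0 <= p -> 0 <= delta -> 0 <= e -> r ^+ 2 <= p * delta ->
  delta <= e ^+ 2 ->
  `|(r + delta) * expR (- (c * (p + 2 * r + delta))) - r * expR (- (c * p))
    - (delta - 2 * c * r ^+ 2) * expR (- (c * p))| <= (10 * c + 22) * e * delta.
Proof.
move=> c0 p0 d0 e0 rp de.
(* Along the segment [w + t D]: [q] is the squared norm, [y] the inner product with [D], and [f] the
   component of the field in the direction [D]. Only the three numbers [p], [r] and [delta]
   enter. *)
pose q (t : R) : R := p + 2 * r * t + delta * t ^+ 2.
pose E (t : R) : R := expR (- (c * q t)).
pose y (t : R) : R := r + t * delta.
pose f (t : R) : R := y t * E t.
pose f' (t : R) : R := (delta - 2 * c * y t ^+ 2) * E t.
pose f'' (t : R) : R := (4 * c ^+ 2 * y t ^+ 3 - 6 * c * delta * y t) * E t.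
have dq x : is_derive x 1 q (2 * y x).
  by rewrite /q; apply: is_derive_eq; rewrite /y /GRing.scale/=; ring.
have dE x : is_derive x 1 E (- 2 * c * y x * E x).
  by rewrite /E; apply: is_derive_eq; rewrite /GRing.scale/=; ring.
have dy x : is_derive x 1 y delta.
  by rewrite /y; apply: is_derive_eq; rewrite /GRing.scale/=; ring.
have df x : is_derive x 1 f (f' x).
  by rewrite /f; apply: is_derive_eq; rewrite /f' /GRing.scale/=; ring.
have df' x : is_derive x 1 f' (f'' x).
  by rewrite /f'; apply: is_derive_eq; rewrite /f'' /GRing.scale/=; ring.
have cont g g' : (forall x : R, is_derive x 1 g (g' x : R)) -> continuous (g : R -> R).
  by move=> dg x; apply: differentiable_continuous; apply/derivable1_diffP; case: (dg x).
have [t t01 ft] : exists2 t : R, t \in `]0, 1[ & f 1 - f 0 = f' t * (1 - 0).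
  by apply: (@MVT _ f f') => //; apply: continuous_subspaceT; exact: cont df.
have [t0 t1] : 0 < t /\ t < 1 by move: t01; rewrite in_itv/= => /andP[].
have [u u0t ft'] : exists2 u : R, u \in `]0, t[ & f' t - f' 0 = f'' u * (t - 0).
  by apply: (@MVT _ f' f'') => //; apply: continuous_subspaceT; exact: cont df'.
have -> : (r + delta) * expR (- (c * (p + 2 * r + delta))) - r * expR (- (c * p))
    - (delta - 2 * c * r ^+ 2) * expR (- (c * p)) = f'' u * t.
  have -> : expR (- (c * (p + 2 * r + delta))) = E 1.
    by rewrite /E /q; congr expR; ring.
  have -> : expR (- (c * p)) = E 0 by rewrite /E /q; congr expR; ring.
  rewrite subr0 in ft'; rewrite subr0 mulr1 in ft; rewrite -ft' -ft.
  by rewrite /f /f' /y; ring.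
(* The difference [delta * q u - y u ^+ 2] equals [delta * p - r ^+ 2] for every [u]: Cauchy-Schwarz
   at the base point propagates along the segment. *)
have qy : y u ^+ 2 <= delta * q u by rewrite /y /q; nra.
have q0 : 0 <= q u.
  have [d_gt0|] := ltP 0 delta; first by rewrite -(pmulr_rge0 _ d_gt0) (le_trans _ qy)// sqr_ge0.
  move=> d_le0; have d_eq0 : delta = 0 by lra.
  have r_eq0 : r = 0 by apply/eqP; rewrite -sqrf_eq0 eq_le sqr_ge0 andbT; nra.
  by rewrite /q d_eq0 r_eq0; lra.
(* The second derivative is cubic in [y] and [delta] counts as a square: one factor [y u] is spent
   on the small [e], the remaining quadratic part on [delta], and the powers of [q u] are left to
   the exponential. *)
have yle : `|y u| <= e * (1 + q u).
  have eq0 : 0 <= e * (1 + q u) by rewrite mulr_ge0// addr_ge0.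
  rewrite -(@ler_pXn2r _ 2)//.
  rewrite real_normK ?num_real//.
  apply: le_trans qy _; rewrite exprMn.
  apply: (@le_trans _ _ (e ^+ 2 * q u)); first exact: ler_wpM2r.
  by apply: ler_wpM2l; [exact: sqr_ge0|nra].
have cq0 : 0 <= c * q u by exact: mulr_ge0.
have h1 := mul_expRN_le1 cq0; have h2 := sqr_expRN_le4 cq0.
have E0 : 0 <= E u by exact: expR_ge0.
have E1 : E u <= 1 by rewrite /E -expR0 ler_expR oppr_le0.
rewrite normrM (ger0_norm (ltW t0)); apply: (@le_trans _ _ `|f'' u|).
  by rewrite ler_piMr// ltW.
rewrite normrM (ger0_norm E0).
have -> : 4 * c ^+ 2 * y u ^+ 3 - 6 * c * delta * y u =
   y u * (4 * c ^+ 2 * y u ^+ 2 - 6 * c * delta) by ring.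
rewrite normrM.
have B : `|4 * c ^+ 2 * y u ^+ 2 - 6 * c * delta| <= delta * (4 * c ^+ 2 * q u + 6 * c).
  have h3 : 0 <= 4 * c ^+ 2 * y u ^+ 2 by rewrite mulr_ge0 ?sqr_ge0// mulr_ge0 ?sqr_ge0.
  have h4 : 0 <= 6 * c * delta by rewrite mulr_ge0// mulr_ge0.
  rewrite (le_trans (ler_normB _ _))// ger0_norm// ger0_norm//.
  rewrite mulrDr lerD//; last by rewrite mulrC.
  by rewrite [leRHS]mulrCA ler_wpM2l// mulr_ge0 ?sqr_ge0.
apply: (@le_trans _ _ (e * (1 + q u) * (delta * (4 * c ^+ 2 * q u + 6 * c)) * E u)).
  by rewrite ler_wpM2r// ler_pM.
have -> : e * (1 + q u) * (delta * (4 * c ^+ 2 * q u + 6 * c)) * E u =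
  e * delta * ((1 + q u) * (4 * c ^+ 2 * q u + 6 * c) * E u) by ring.
rewrite (_ : (10 * c + 22) * e * delta = e * delta * (10 * c + 22)); last by ring.
rewrite ler_wpM2l ?mulr_ge0//.
(* The four terms are at most [4 * c], [6 * c], [16] and [6], whence the constant [10 * c + 22]. *)
have -> : (1 + q u) * (4 * c ^+ 2 * q u + 6 * c) * E u =
  4 * c * (c * q u * E u) + 6 * c * E u + 4 * ((c * q u) ^+ 2 * E u)
  + 6 * (c * q u * E u) by ring.
have : 4 * c * (c * q u * E u) <= 4 * c by rewrite ler_piMr// mulr_ge0.
have : 6 * c * E u <= 6 * c by rewrite ler_piMr// mulr_ge0.
move: h1 h2; rewrite -/(E u); lra.
Qed.

End taylor.

(** * The Laplace transform of the permutation statistic *)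

Definition qform {R : realType} {d : nat} (Q : 'M[R]_d) (u v : 'rV[R]_d) : R :=
  (u *m Q *m v^T) 0 0.

Section qform_theory.
Context {R : realType} {d : nat}.
Implicit Types (Q : 'M[R]_d) (u v w : 'rV[R]_d).

Lemma qformE Q u v : qform Q u v = \sum_k (u *m Q) 0 k * v 0 k.
Proof. by rewrite /qform mxE; apply: eq_bigr => k _; rewrite [v^T _ _]mxE. Qed.

Lemma qformEE Q u v : qform Q u v = \sum_k \sum_l Q k l * (u 0 k * v 0 l).
Proof.
rewrite qformE exchange_big/=; apply: eq_bigr => l _.
by rewrite mxE mulr_suml; apply: eq_bigr => k _; rewrite mulrA [_ * u _ _]mulrC.
Qed.

Lemma qformDl Q u v w : qform Q (u + v) w = qform Q u w + qform Q v w.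
Proof. by rewrite /qform !mulmxDl mxE. Qed.

Lemma qformDr Q u v w : qform Q u (v + w) = qform Q u v + qform Q u w.
Proof. by rewrite /qform linearD/= mulmxDr mxE. Qed.

Lemma qformZl Q a u v : qform Q (a *: u) v = a * qform Q u v.
Proof. by rewrite /qform -!scalemxAl mxE. Qed.

Lemma qformZr Q a u v : qform Q u (a *: v) = a * qform Q u v.
Proof. by rewrite /qform linearZ/= -scalemxAr mxE. Qed.

Lemma qformC Q u v : Q^T = Q -> qform Q u v = qform Q v u.
Proof.
move=> QT; rewrite /qform -[in LHS](trmxK (u *m Q *m v^T)) mxE.
by rewrite trmx_mul trmx_mul QT trmxK mulmxA.
Qed.

Lemma qform_cauchy_schwarz Q u v : Q^T = Q -> (forall w, 0 <= qform Q w w) ->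
  qform Q u v ^+ 2 <= qform Q u u * qform Q v v.
Proof.
move=> QT Q0.
have H t : 0 <= qform Q u u + 2 * t * qform Q u v + t ^+ 2 * qform Q v v.
  have := Q0 (u + t *: v).
  rewrite !qformDl !qformDr !qformZl !qformZr (qformC v u QT).
  by congr (_ <= _); ring.
have [v0|v0] := eqVneq (qform Q v v) 0.
  have [->|uv] := eqVneq (qform Q u v) 0; first by rewrite expr0n/= mulr_ge0.
  (* For degenerate [v] the quadratic polynomial in [t] is affine, and this [t] gives it the value
     [-1]. *)
  have := H (- (qform Q u u + 1) / (2 * qform Q u v)).
  rewrite v0 mulr0 addr0 (_ : 2 * _ * _ = - (qform Q u u + 1)); last by field.
  by lra.
have vp : 0 < qform Q v v by rewrite lt_def v0 Q0.
have := mulr_ge0 (ltW vp) (H (- qform Q u v / qform Q v v)).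
rewrite [X in 0 <= X -> _](_ : _ = qform Q u u * qform Q v v - qform Q u v ^+ 2).
  by rewrite subr_ge0.
by field.
Qed.

Lemma qform_row_le Q u k : Q^T = Q -> (forall w, 0 <= qform Q w w) ->
  (u *m Q) 0 k ^+ 2 <= Q k k * qform Q u u.
Proof.
move=> QT Q0; have := qform_cauchy_schwarz u (delta_mx 0 k) QT Q0.
have -> : qform Q u (delta_mx 0 k) = (u *m Q) 0 k.
  rewrite qformE (bigD1 k)//= [delta_mx _ _ _ k]mxE !eqxx mulr1 big1 ?addr0// => l lk.
  by rewrite [delta_mx _ _ _ l]mxE (negbTE lk) andbF mulr0.
have -> : qform Q (delta_mx 0 k) (delta_mx 0 k) = Q k k.
  rewrite qformE (bigD1 k)//= [delta_mx _ _ _ k]mxE !eqxx mulr1 big1 ?addr0 => [|l lk].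
    by rewrite -rowE mxE.
  by rewrite [delta_mx _ _ _ l]mxE (negbTE lk) andbF mulr0.
by rewrite mulrC.
Qed.

End qform_theory.

(** * The Stein inequality *)

Section stein.
Context {R : realType} {d m n : nat}.
Local Notation N := (m + n)%N.
Variable b : 'I_N -> 'rV[R]_d.
Hypothesis b0 : \sum_a b a = 0.

Definition vec_sample_sum (s : 'S_N) : 'rV[R]_d := \sum_(i < m) b (s (lshift n i)).
Definition coord_fun (k : 'I_d) : 'I_N -> R := fun a => b a 0 k.
Definition vec_swap_diff i j (s : 'S_N) : 'rV[R]_d := b (s (rshift m j)) - b (s (lshift n i)).

(* The conditional covariance of a swap, compared with its limit. *)
Definition swap_cov_dev (Sigma : 'M[R]_d) k l (s : 'S_N) : R :=
  (\sum_(i < m) \sum_(j < n)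
     swap_diff (coord_fun k) i j s * swap_diff (coord_fun l) i j s) /
  (2 * (m%:R * n%:R)) - Sigma k l.

Lemma coord_fun0 k : \sum_a coord_fun k a = 0.
Proof. by have /matrixP/(_ 0 k) := b0; rewrite summxE mxE. Qed.

Lemma vec_sample_sumE s k : vec_sample_sum s 0 k = sample_sum (coord_fun k) s.
Proof. by rewrite /vec_sample_sum summxE. Qed.

Lemma vec_swap_diffE i j s k :
  vec_swap_diff i j s 0 k = swap_diff (coord_fun k) i j s.
Proof. by rewrite !mxE. Qed.

Lemma vec_sample_sum_swap i j s :
  vec_sample_sum (swap i j * s)%g = vec_sample_sum s + vec_swap_diff i j s.
Proof.
by apply/rowP => k; rewrite [RHS]mxE !vec_sample_sumE sample_sum_swap vec_swap_diffE.
Qed.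

Section bound.
Variables (Q Sigma : 'M[R]_d) (c K e : R).
(** With this factor [kappa * qform Q S S] is the rank Hotelling statistic, by [rank_hotellingE]. *)
Let kappa : R := N%:R / (m%:R * n%:R).
Hypotheses (m0 : (0 < m)%N) (n0 : (0 < n)%N) (c0 : 0 <= c) (e0 : 0 <= e).
Hypotheses (QT : Q^T = Q) (Q0 : forall w, 0 <= qform Q w w).
Hypotheses (K0 : 0 <= K) (QK : forall k l, `|Q k l| <= K).
(** These identities hold for [Q := invmx Sigma]. The trace [QS] is the origin of [d] in the
    differential equation, and [QSQ] turns the sum of the squares [r ^+ 2] back into [p]. *)
Hypotheses (QS : \sum_k \sum_l Q k l * Sigma k l = d%:R) (QSQ : Q *m Sigma *m Q = Q).
Hypothesis swap_small : forall i j s,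
  kappa * qform Q (vec_swap_diff i j s) (vec_swap_diff i j s) <= e ^+ 2.

Let S := vec_sample_sum.
Let D := vec_swap_diff.
Let p s : R := kappa * qform Q (S s) (S s).
Let F := perm_mean (fun s => expR (- (c * p s))).
Let A := perm_mean (fun s => p s * expR (- (c * p s))).
Let dev s : R := \sum_k \sum_l `|swap_cov_dev Sigma k l s|.
Let v : R := perm_mean dev.

Let mR0 : 0 < m%:R :> R. Proof. by rewrite ltr0n. Qed.
Let nR0 : 0 < n%:R :> R. Proof. by rewrite ltr0n. Qed.
Let NR0 : 0 < N%:R :> R. Proof. by rewrite ltr0n addn_gt0 m0. Qed.
Let kappa0 : 0 <= kappa. Proof. by rewrite divr_ge0// mulr_ge0. Qed.
Let p0 s : 0 <= p s. Proof. exact: mulr_ge0. Qed.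

(** The scalar exchangeable pair identity is applied to each coordinate [k], with [g] the [k]-th
    coordinate of the field [kappa * exp (- c p) * (S *m Q)], and summed over [k]. *)
Let stein_identity :
  2 * N%:R * A = perm_mean (fun s => \sum_(i < m) \sum_(j < n)
    (kappa * qform Q (S s + D i j s) (D i j s) * expR (- (c * p (swap i j * s)%g)) -
     kappa * qform Q (S s) (D i j s) * expR (- (c * p s)))).
Proof.
pose g k s : R := kappa * (S s *m Q) 0 k * expR (- (c * p s)).
transitivity (\sum_k 2 * N%:R * perm_mean (fun s => sample_sum (coord_fun k) s * g k s)).
  rewrite -mulr_sumr -perm_mean_sum; congr (_ * _); apply: eq_perm_mean => s.
  rewrite {}/g; set E := expR _; rewrite /p qformE mulr_sumr mulr_suml.
  by apply: eq_bigr => k _; rewrite vec_sample_sumE; ring.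
under eq_bigr do rewrite -exchangeable_pair_identity ?coord_fun0//.
rewrite -perm_mean_sum; apply: eq_perm_mean => s.
rewrite exchange_big/=; apply: eq_bigr => i _.
rewrite exchange_big/=; apply: eq_bigr => j _.
rewrite !qformE !mulr_sumr !mulr_suml -sumrB; apply: eq_bigr => k _.
by rewrite /g /S vec_sample_sum_swap -vec_swap_diffE /D; ring.
Qed.

Let sum_swap k l s : \sum_(i < m) \sum_(j < n) D i j s 0 k * D i j s 0 l =
  2 * (m%:R * n%:R) * (Sigma k l + swap_cov_dev Sigma k l s).
Proof.
rewrite /swap_cov_dev addrC subrK mulrC divfK ?gt_eqF ?mulr_gt0//.
by apply: eq_bigr => i _; apply: eq_bigr => j _; rewrite !vec_swap_diffE.
Qed.

Let sum_quad (B : 'M[R]_d) s :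
  \sum_(i < m) \sum_(j < n) \sum_k \sum_l B k l * (D i j s 0 k * D i j s 0 l) =
  2 * (m%:R * n%:R) * (\sum_k \sum_l B k l * Sigma k l +
    \sum_k \sum_l B k l * swap_cov_dev Sigma k l s).
Proof.
transitivity (\sum_k \sum_l B k l *
    (\sum_(i < m) \sum_(j < n) D i j s 0 k * D i j s 0 l)).
  under eq_bigr do rewrite exchange_big/=.
  rewrite exchange_big/=; apply: eq_bigr => k _.
  under eq_bigr do rewrite exchange_big/=.
  rewrite exchange_big/=; apply: eq_bigr => l _.
  by rewrite mulr_sumr; apply: eq_bigr => i _; rewrite mulr_sumr.
rewrite -big_split/= mulr_sumr; apply: eq_bigr => k _.
rewrite -big_split/= mulr_sumr; apply: eq_bigr => l _.
by rewrite sum_swap; ring.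
Qed.

Let delta i j s : R := kappa * qform Q (D i j s) (D i j s).
Let r i j s : R := kappa * qform Q (S s) (D i j s).
Let devQ s : R := \sum_k \sum_l Q k l * swap_cov_dev Sigma k l s.
Let devS s : R := kappa *
  \sum_k \sum_l ((S s *m Q) 0 k * (S s *m Q) 0 l) * swap_cov_dev Sigma k l s.

Let kappaE : kappa * (m%:R * n%:R) = N%:R.
Proof. by rewrite divfK// gt_eqF// mulr_gt0. Qed.

Let sum_delta s : \sum_(i < m) \sum_(j < n) delta i j s = 2 * N%:R * (d%:R + devQ s).
Proof.
under eq_bigr do rewrite -mulr_sumr.
rewrite -mulr_sumr -kappaE.
under eq_bigr do under eq_bigr do rewrite qformEE.
by rewrite sum_quad QS /devQ; ring.
Qed.

Let sum_r s : \sum_(i < m) \sum_(j < n) r i j s ^+ 2 = 2 * N%:R * (p s + devS s).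
Proof.
(* The rank-one matrix whose quadratic form at a swap [D] is the square of [qform Q (S s) D]. *)
pose B : 'M[R]_d := \matrix_(k, l) ((S s *m Q) 0 k * (S s *m Q) 0 l).
transitivity (kappa ^+ 2 * \sum_(i < m) \sum_(j < n) \sum_k \sum_l
    B k l * (D i j s 0 k * D i j s 0 l)).
  rewrite mulr_sumr; apply: eq_bigr => i _; rewrite mulr_sumr; apply: eq_bigr => j _.
  rewrite exprMn; congr (_ * _); rewrite qformE expr2 mulr_suml.
  apply: eq_bigr => k _; rewrite mulr_sumr; apply: eq_bigr => l _.
  by rewrite [B _ _]mxE; ring.
rewrite sum_quad.
have -> : \sum_k \sum_l B k l * Sigma k l = qform Q (S s) (S s).
  transitivity (qform Sigma (S s *m Q) (S s *m Q)).
    rewrite qformEE; apply: eq_bigr => k _; apply: eq_bigr => l _.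
    by rewrite [B _ _]mxE mulrC.
  by rewrite /qform trmx_mul QT -[in RHS]QSQ !mulmxA.
rewrite (_ : \sum_k \sum_l B k l * _ = \sum_k \sum_l
    ((S s *m Q) 0 k * (S s *m Q) 0 l) * swap_cov_dev Sigma k l s); last first.
  by apply: eq_bigr => k _; apply: eq_bigr => l _; rewrite mxE.
by rewrite /p /devS -kappaE; ring.
Qed.

Let devQ_le s : `|devQ s| <= K * dev s.
Proof.
rewrite (le_trans (ler_norm_sum _ _ _))// mulr_sumr ler_sum// => k _.
rewrite (le_trans (ler_norm_sum _ _ _))// mulr_sumr ler_sum// => l _.
by rewrite normrM ler_wpM2r.
Qed.

(** The error is relative to [p s], which has no uniform bound; multiplied by [c * exp (- c p)] it
    becomes bounded. *)
Let devS_le s : `|devS s| <= p s * (K * dev s).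
Proof.
rewrite /devS normrM ger0_norm// /p -mulrA ler_wpM2l// mulrA.
rewrite (le_trans (ler_norm_sum _ _ _))// mulr_sumr ler_sum// => k _.
rewrite (le_trans (ler_norm_sum _ _ _))// mulr_sumr ler_sum// => l _.
rewrite normrM ler_wpM2r//.
have h k' : (S s *m Q) 0 k' ^+ 2 <= qform Q (S s) (S s) * K.
  apply: (le_trans (qform_row_le _ _ QT Q0)).
  by rewrite mulrC ler_wpM2l// (le_trans (ler_norm _)).
have hk := h k; have hl := h l; rewrite ler_norml; apply/andP; split; nra.
Qed.

(** Summing [gaussian_field_taylor] over all swaps gives the main term [2 N (d F - 2 c A)], to be
    compared with [2 N A] from [stein_identity]. The Taylor remainders cost [(10 c + 22) e] times
    the total of the [delta i j s]. Replacing the swap covariance by [Sigma] costs [K v] in the sum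
    of [delta] and [2 K v] in that of [r ^+ 2], hence [3 K v]. *)
Lemma stein_bound : `|(1 + 2 * c) * A - d%:R * F| <=
  3 * K * v + (10 * c + 22) * e * (d%:R + K * v).
Proof.
have dev0 s : 0 <= dev s by rewrite sumr_ge0// => k _; rewrite sumr_ge0.
pose T s := \sum_(i < m) \sum_(j < n)
    (kappa * qform Q (S s + D i j s) (D i j s) * expR (- (c * p (swap i j * s)%g)) -
     kappa * qform Q (S s) (D i j s) * expR (- (c * p s))).
have pT s : p s * expR (- (c * p s)) * c <= 1.
  by rewrite mulrC mulrA mul_expRN_le1// mulr_ge0.
have Ee1 s : expR (- (c * p s)) <= 1.
  by rewrite -expR0 ler_expR oppr_le0 mulr_ge0.
have Tb s : `|T s - 2 * N%:R * ((d%:R + devQ s) - 2 * c * (p s + devS s)) * expR (- (c * p s))| <=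
    2 * N%:R * ((10 * c + 22) * e * (d%:R + K * dev s)).
  rewrite (_ : 2 * N%:R * (_ - _) = \sum_(i < m) \sum_(j < n)
      (delta i j s - 2 * c * r i j s ^+ 2)); last first.
    transitivity (\sum_(i < m) \sum_(j < n) delta i j s -
        2 * c * \sum_(i < m) \sum_(j < n) r i j s ^+ 2).
      by rewrite sum_delta sum_r; ring.
    by rewrite mulr_sumr -sumrB; apply: eq_bigr => i _; rewrite mulr_sumr -sumrB.
  apply: (@le_trans _ _ (\sum_(i < m) \sum_(j < n) (10 * c + 22) * e * delta i j s)).
    rewrite mulr_suml -sumrB (le_trans (ler_norm_sum _ _ _))// ler_sum// => i _.
    rewrite mulr_suml -sumrB (le_trans (ler_norm_sum _ _ _))// ler_sum// => j _.
    have -> : p (swap i j * s)%g = p s + 2 * r i j s + delta i j s.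
      rewrite /p /r /delta /S /D vec_sample_sum_swap.
      move: (vec_swap_diff i j s) (vec_sample_sum s) => Dv Sv.
      by rewrite qformDl !qformDr (qformC Dv Sv QT); ring.
    have -> : kappa * qform Q (S s + D i j s) (D i j s) = r i j s + delta i j s.
      by rewrite qformDl mulrDr.
    apply: gaussian_field_taylor => //; first exact: mulr_ge0.
      rewrite /r /p /delta exprMn [leRHS]mulrACA -expr2 ler_wpM2l ?sqr_ge0//.
      exact: qform_cauchy_schwarz.
    exact: swap_small.
  rewrite (_ : \sum_(i < m) \sum_(j < n) (10 * c + 22) * e * delta i j s =
      (10 * c + 22) * e * \sum_(i < m) \sum_(j < n) delta i j s).
    2: by rewrite mulr_sumr; apply: eq_bigr => i _; rewrite mulr_sumr.
  have C0 : 0 <= (10 * c + 22) * e by rewrite mulr_ge0// addr_ge0// mulr_ge0.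
  rewrite sum_delta [leLHS]mulrCA ler_wpM2l ?mulr_ge0// ler_wpM2l//.
  by rewrite lerD2l (le_trans _ (devQ_le s))// ler_norm.
have Tb2 s : `|T s - 2 * N%:R * (d%:R * expR (- (c * p s)) - 2 * c * (p s * expR (- (c * p s))))| <=
    2 * N%:R * ((3 * K + (10 * c + 22) * e * K) * dev s + (10 * c + 22) * e * d%:R).
  have h : `|(devQ s - 2 * c * devS s) * expR (- (c * p s))| <= 3 * K * dev s.
    rewrite mulrBl (le_trans (ler_normB _ _))//.
    rewrite (_ : 3 * K * dev s = K * dev s + 2 * (K * dev s)); last by ring.
    apply: lerD; rewrite normrM (ger0_norm (expR_ge0 _)).
      by rewrite -[leRHS]mulr1 ler_pM ?expR_ge0.
    rewrite normrM (@ger0_norm _ (2 * c)) ?mulr_ge0//.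
    apply: (@le_trans _ _ (2 * c * (p s * (K * dev s)) * expR (- (c * p s)))).
      by rewrite ler_wpM2r ?expR_ge0// ler_wpM2l ?mulr_ge0.
    rewrite (_ : _ * _ * _ = 2 * (K * dev s) * (p s * expR (- (c * p s)) * c)); last by ring.
    by rewrite ler_piMr// !mulr_ge0.
  rewrite (_ : T s - _ = (T s - 2 * N%:R * ((d%:R + devQ s) - 2 * c * (p s + devS s)) * expR (- (c * p s)))
    + 2 * N%:R * ((devQ s - 2 * c * devS s) * expR (- (c * p s)))); last by ring.
  rewrite (le_trans (ler_normD _ _))// (le_trans (lerD (Tb s) (lexx _)))//.
  rewrite normrM (@ger0_norm _ (2 * _)) ?mulr_ge0// -mulrDr ler_wpM2l ?mulr_ge0//.
  by rewrite (le_trans (lerD (lexx _) h))// le_eqVlt; apply/orP; left; apply/eqP; ring.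
have : `|2 * N%:R * ((1 + 2 * c) * A - d%:R * F)| <=
    2 * N%:R * (3 * K * v + (10 * c + 22) * e * (d%:R + K * v)).
  rewrite (_ : 2 * N%:R * (_ - _) = perm_mean (fun s => T s - 2 * N%:R *
     (d%:R * expR (- (c * p s)) - 2 * c * (p s * expR (- (c * p s)))))); last first.
    rewrite perm_meanB perm_meanZ perm_meanB !perm_meanZ -stein_identity -/A -/F.
    by ring.
  apply: (le_trans (ler_norm_perm_mean _)); apply: (le_trans (le_perm_mean Tb2)).
  rewrite perm_meanZ perm_meanD perm_meanZ perm_mean_cst -/v.
  by rewrite le_eqVlt; apply/orP; left; apply/eqP; ring.
by rewrite normrM ger0_norm ?mulr_ge0// ler_pM2l ?mulr_gt0.
Qed.

End bound.
End stein.

Lemma sqr_coord_le_sqnorm {R : realType} {d : nat} (x : 'rV[R]_d) k :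
  x 0 k ^+ 2 <= sqnorm x.
Proof.
by rewrite /sqnorm (bigD1 k)//= lerDl sumr_ge0// => i _; rewrite sqr_ge0.
Qed.

Lemma sqnorm_ge0 {R : realType} {d : nat} (x : 'rV[R]_d) : 0 <= sqnorm x.
Proof. by rewrite sumr_ge0// => i _; rewrite sqr_ge0. Qed.

Lemma coord_mul_le_sqnorm {R : realType} {d : nat} (x : 'rV[R]_d) k l :
  `|x 0 k * x 0 l| <= sqnorm x.
Proof.
have := sqr_coord_le_sqnorm x k; have := sqr_coord_le_sqnorm x l.
by rewrite ler_norml => hl hk; apply/andP; split; nra.
Qed.

Lemma sqnormB_le {R : realType} {d : nat} (x y : 'rV[R]_d) :
  sqnorm (x - y) <= 2 * (sqnorm x + sqnorm y).
Proof.
rewrite /sqnorm -big_split/= mulr_sumr ler_sum// => i _.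
by rewrite !mxE; have := sqr_ge0 (x 0 i + y 0 i); nra.
Qed.

Lemma qform_le_sqnorm {R : realType} {d : nat} (Q : 'M[R]_d) (K : R) (x : 'rV[R]_d) :
  0 <= K -> (forall k l, `|Q k l| <= K) -> qform Q x x <= d%:R ^+ 2 * K * sqnorm x.
Proof.
move=> K0 QK; rewrite qformEE.
apply: (@le_trans _ _ (\sum_(k < d) \sum_(l < d) K * sqnorm x)).
  apply: ler_sum => k _; apply: ler_sum => l _.
  by rewrite (le_trans (ler_norm _))// normrM ler_pM// coord_mul_le_sqnorm.
by rewrite !sumr_const !card_ord -mulrnA -[leLHS]mulr_natl natrM le_eqVlt; apply/orP; left; apply/eqP; ring.
Qed.

(** * Concentration of the swap covariance *)

Section swap_covariance.
Context {R : realType} {d m n : nat}.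
Local Notation N := (m + n)%N.
Variable b : 'I_N -> 'rV[R]_d.
Hypothesis b0 : \sum_a b a = 0.
Hypotheses (m0 : (0 < m)%N) (n0 : (0 < n)%N).
Variables (t s2 C : R).
Hypotheses (t0 : 0 < t) (C0 : 0 <= C) (NC : N%:R ^+ 2 <= C * (m%:R * n%:R)).
Hypothesis b_max : forall a, sqnorm (b a) <= t ^+ 2 * N%:R.
Hypothesis b_sum : N%:R^-1 * \sum_a sqnorm (b a) <= s2.

Let mR0 : 0 < m%:R :> R. Proof. by rewrite ltr0n. Qed.
Let nR0 : 0 < n%:R :> R. Proof. by rewrite ltr0n. Qed.
Let N2 : 2 <= N%:R :> R.
Proof.
rewrite (ler_nat _ 2); move: m0 n0.
by case: (m) => [//|a]; case: (n) => [//|c] _ _; rewrite addSn addnS.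
Qed.
Let s2E : \sum_a sqnorm (b a) <= s2 * N%:R.
Proof. by rewrite -ler_pdivrMr 1?mulrC//; have := N2; lra. Qed.
Let s20 : 0 <= s2.
Proof.
apply: le_trans b_sum; rewrite mulr_ge0 ?invr_ge0// sumr_ge0// => a _.
exact: sqnorm_ge0.
Qed.

(** The three terms come from the population covariance, from the fluctuation of the sample sum of
    the centered products [y'], and from the product of two sample sums. The second has small
    variance because the sum of [y' a ^+ 2] is at most the largest squared norm times the sum of the
    squared norms, so that no fourth moment is required. *)
Lemma mean_abs_swap_cov_dev (Sigma : 'M[R]_d) k l :
  perm_mean (fun s => `|swap_cov_dev b Sigma k l s|) <=
  `|N%:R^-1 * \sum_a b a 0 k * b a 0 l - Sigma k l| + (1 + C * s2) * t
  + s2 / (N%:R - 1).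
Proof.
pose y (a : 'I_N) : R := b a 0 k * b a 0 l.
pose Y : R := \sum_a y a.
pose y' a : R := y a - N%:R^-1 * Y.
have NE : N%:R = m%:R + n%:R :> R by rewrite natrD.
have y'0 : \sum_a y' a = 0.
  rewrite sumrB sumr_const card_ord -[X in _ - X]mulr_natl mulrA divff ?mul1r ?subrr//.
  by have := N2; lra.
pose gamma : R := (n%:R - m%:R) / (2 * (m%:R * n%:R)).
have devE s : swap_cov_dev b Sigma k l s = (N%:R^-1 * Y - Sigma k l) +
    gamma * sample_sum y' s +
    (sample_sum (coord_fun b k) s * sample_sum (coord_fun b l) s) / (m%:R * n%:R).
  rewrite /swap_cov_dev sum_swap_diff_mul ?coord_fun0//.
  have -> : sample_sum y' s = sample_sum y s - m%:R * (N%:R^-1 * Y).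
    by rewrite /sample_sum sumrB sumr_const card_ord -[X in _ - X = _]mulr_natl.
  rewrite -/y -/Y /gamma NE; field.
  by rewrite ?gt_eqF ?mulr_gt0 ?addr_gt0.
have VU := variance_sample_sum m0 n0 y'0.
have y'2 : \sum_a y' a ^+ 2 <= t ^+ 2 * s2 * N%:R ^+ 2.
  apply: (@le_trans _ _ (\sum_a y a ^+ 2)).
    have -> : \sum_a y' a ^+ 2 = \sum_a y a ^+ 2 - N%:R^-1 * Y ^+ 2.
      transitivity (\sum_a (y a ^+ 2 - 2 * (N%:R^-1 * Y) * y a + (N%:R^-1 * Y) ^+ 2)).
        by apply: eq_bigr => a _; rewrite /y'; ring.
      rewrite big_split/= sumrB -mulr_sumr -/Y sumr_const card_ord -mulr_natl.
      by field; have := N2; lra.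
    by rewrite gerBl mulr_ge0 ?sqr_ge0// invr_ge0.
  apply: (@le_trans _ _ (\sum_a t ^+ 2 * N%:R * sqnorm (b a))).
    apply: ler_sum => a _; rewrite -real_normK ?num_real// expr2.
    have h := coord_mul_le_sqnorm (b a) k l.
    by apply: ler_pM => //; exact: le_trans h (b_max a).
  rewrite -mulr_sumr (_ : t ^+ 2 * s2 * _ = t ^+ 2 * N%:R * (s2 * N%:R)); last by ring.
  by rewrite ler_wpM2l// mulr_ge0// sqr_ge0.
have gU : perm_mean (fun s => `|gamma * sample_sum y' s|) <= (1 + C * s2) * t.
  (* The inequality [|z| <= t + z ^ 2 / t] reduces the first absolute moment to the variance. As the
     variance is at most [C * s2 * t ^ 2], the weight [t] makes both terms of order [t]. *)
  apply: (@le_trans _ _ (perm_mean (fun s => t + t^-1 * gamma ^+ 2 * sample_sum y' s ^+ 2))).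
    apply: le_perm_mean => s.
    rewrite -mulrA -exprMn; set z := gamma * _.
    have : 0 <= t^-1 * ((`|z| - t) ^+ 2 + `|z| * t).
      by rewrite mulr_ge0 ?invr_ge0 ?addr_ge0 ?sqr_ge0 ?mulr_ge0// ltW.
    rewrite -[z ^+ 2]real_normK ?num_real//.
    rewrite (_ : t^-1 * _ = t + t^-1 * `|z| ^+ 2 - `|z|) ?subr_ge0//.
    by field; rewrite gt_eqF.
  rewrite perm_meanD perm_mean_cst perm_meanZ VU mulrDl mul1r lerD2l.
  have g2 : gamma ^+ 2 <= N%:R ^+ 2 / (4 * (m%:R * n%:R) ^+ 2).
    have -> : gamma ^+ 2 = (n%:R - m%:R) ^+ 2 / (4 * (m%:R * n%:R) ^+ 2).
      by rewrite /gamma; field; rewrite !gt_eqF.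
    rewrite ler_wpM2r ?invr_ge0 ?mulr_ge0 ?sqr_ge0// NE.
    by rewrite -subr_ge0 (_ : _ - _ = 4 * (m%:R * n%:R)) ?mulr_ge0//; ring.
  have N10 : 0 < N%:R - 1 :> R by have := N2; lra.
  have mn0 : 0 < m%:R * n%:R :> R by exact: mulr_gt0.
  apply: (@le_trans _ _ (t^-1 * (N%:R ^+ 2 / (4 * (m%:R * n%:R) ^+ 2)) *
     (m%:R * n%:R / (N%:R * (N%:R - 1)) * (t ^+ 2 * s2 * N%:R ^+ 2)))).
    apply: ler_pM.
    - by rewrite mulr_ge0 ?sqr_ge0// invr_ge0 ltW.
    - rewrite mulr_ge0 ?sumr_ge0// => [|a _]; last exact: sqr_ge0.
      by rewrite divr_ge0 ?(ltW mn0)// mulr_ge0// ltW.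
    - by rewrite ler_wpM2l// invr_ge0 ltW.
    - by rewrite ler_wpM2l// divr_ge0 ?(ltW mn0)// mulr_ge0// ltW.
  rewrite (_ : _ * _ = (N%:R ^+ 2 / (m%:R * n%:R)) * ((N%:R / (4 * (N%:R - 1))) * (s2 * t))).
    2: by field; rewrite !gt_eqF//; have := N2; lra.
  have h1 : 0 <= N%:R ^+ 2 / (m%:R * n%:R) :> R by rewrite divr_ge0 ?sqr_ge0// ltW.
  have h2 : 0 <= N%:R / (4 * (N%:R - 1)) :> R by rewrite divr_ge0// mulr_ge0// ltW.
  have h3 : 0 <= s2 * t by rewrite mulr_ge0// ltW.
  have h4 : N%:R / (4 * (N%:R - 1)) <= 1 :> R.
    by rewrite ler_pdivrMr ?mulr_gt0//; have := N2; lra.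
  have h5 : N%:R ^+ 2 / (m%:R * n%:R) <= C :> R by rewrite ler_pdivrMr.
  rewrite -[leRHS]mulrA; apply: ler_pM => //; first exact: mulr_ge0.
  by rewrite ler_piMl.
have SS : perm_mean (fun s => `|(sample_sum (coord_fun b k) s *
    sample_sum (coord_fun b l) s) / (m%:R * n%:R)|) <= s2 / (N%:R - 1).
  have V k' : perm_mean (fun s => sample_sum (coord_fun b k') s ^+ 2) <=
      m%:R * n%:R * (s2 / (N%:R - 1)).
    rewrite variance_sample_sum ?coord_fun0//.
    rewrite [leRHS](_ : _ = m%:R * n%:R / (N%:R * (N%:R - 1)) * (s2 * N%:R)).
      apply: ler_wpM2l.
        rewrite divr_ge0 ?mulr_ge0//; have := N2; lra.
      by apply: le_trans s2E; apply: ler_sum => a _; exact: sqr_coord_le_sqnorm.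
    by field; have := N2; lra.
  apply: (@le_trans _ _ (perm_mean (fun s => (2 * (m%:R * n%:R))^-1 *
      (sample_sum (coord_fun b k) s ^+ 2 + sample_sum (coord_fun b l) s ^+ 2)))).
    apply: le_perm_mean => s.
    set u := sample_sum _ _; set w := sample_sum _ _.
    have -> : (2 * (m%:R * n%:R))^-1 * (u ^+ 2 + w ^+ 2) =
        (m%:R * n%:R)^-1 * ((u ^+ 2 + w ^+ 2) / 2).
      by field; rewrite !gt_eqF.
    rewrite normrM mulrC (@ger0_norm _ (_^-1)) ?invr_ge0 ?mulr_ge0//.
    rewrite ler_wpM2l ?invr_ge0 ?mulr_ge0//.
    by rewrite ler_norml; apply/andP; split; have := sqr_ge0 (u + w); have := sqr_ge0 (u - w); nra.
  rewrite perm_meanZ perm_meanD.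
  apply: (@le_trans _ _ ((2 * (m%:R * n%:R))^-1 *
     (m%:R * n%:R * (s2 / (N%:R - 1)) + m%:R * n%:R * (s2 / (N%:R - 1))))).
    by rewrite ler_wpM2l ?invr_ge0 ?mulr_ge0// lerD.
  rewrite le_eqVlt; apply/orP; left; apply/eqP; field.
  by rewrite !gt_eqF//; have := N2; lra.
apply: (@le_trans _ _ (perm_mean (fun s => `|N%:R^-1 * Y - Sigma k l| +
   `|gamma * sample_sum y' s| + `|(sample_sum (coord_fun b k) s *
    sample_sum (coord_fun b l) s) / (m%:R * n%:R)|))).
  apply: le_perm_mean => s; rewrite devE.
  by rewrite (le_trans (ler_normD _ _))// lerD2r (le_trans (ler_normD _ _)).
by rewrite !perm_meanD perm_mean_cst !lerD.
Qed.

End swap_covariance.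

Lemma is_derive_bigsum {R : realType} (I : Type) (r : seq I) (h dh : I -> R -> R) (x : R) :
  (forall i, is_derive x 1 (h i) (dh i x)) ->
  is_derive x 1 (fun y => \sum_(i <- r) h i y) (\sum_(i <- r) dh i x).
Proof.
move=> dhi; rewrite (_ : (fun y => _) = \sum_(i <- r) h i); last first.
  by apply/funext => y; rewrite fct_sumE.
elim/big_ind2 : _ => // [|f df g dg]; [exact: is_derive_cst|exact: is_deriveD].
Qed.

Lemma cvg_sumr {R : realType} (I : Type) (r : seq I) (f : I -> nat -> R) (l : I -> R) :
  (forall i, f i k @[k --> \oo] --> l i) ->
  \sum_(i <- r) f i k @[k --> \oo] --> \sum_(i <- r) l i.
Proof. by move=> fl; apply: cvg_big => //; exact: add_continuous. Qed.

Lemma posdefmx_unitmx {R : realType} {d : nat} (S : 'M[R]_d) : posdefmx S -> S \in unitmx.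
Proof.
move=> S_pos; rewrite -row_free_unit -kermx_eq0; apply/negPn/negP => K0.
have /rowV0Pn[i /sub_kermxP iS i0] := K0.
by have := S_pos i i0; rewrite iS mul0mx mxE ltxx.
Qed.

(* The Stein inequality is an approximate differential equation for the
   Laplace transform [F], solved exactly by [(1 + 2 c) ^ (- d / 2)]. *)
Lemma laplace_ode {R : realType} (d : nat) (F A : R -> R) (c0 eps : R) :
  0 <= c0 -> F 0 = 1 -> (forall c : R, is_derive c 1 F (- A c)) ->
  (forall c, 0 <= c <= c0 -> 0 <= F c <= 1) ->
  (forall c, 0 <= c <= c0 -> `|(1 + 2 * c) * A c - d.+1%:R * F c| <= eps) ->
  `|F c0 ^+ 2 - ((1 + 2 * c0) ^+ d.+1)^-1| <= 2 * c0 * (1 + 2 * c0) ^+ d * eps.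
Proof.
move=> c00 F0 dF F01 Aeps.
(* Squaring [F] turns the integrating factor [(1 + 2 c) ^ (d.+1 / 2)] into an integer power. The
   derivative of [G] then contains the left-hand side of the Stein inequality as a factor. *)
pose G (c : R) : R := (1 + 2 * c) ^+ d.+1 * F c ^+ 2.
pose G' (c : R) : R :=
  - 2 * (1 + 2 * c) ^+ d * F c * ((1 + 2 * c) * A c - d.+1%:R * F c).
have dG (c : R) : is_derive c 1 G (G' c).
  have dp : is_derive c 1 (fun c : R => 1 + 2 * c : R) 2.
    by apply: is_derive_eq; rewrite /GRing.scale/=; ring.
  have dFc := dF c.
  have dX : is_derive c 1 (fun c : R => (1 + 2 * c) ^+ d.+1 : R) (d.+1%:R * (1 + 2 * c) ^+ d * 2).
    have := @is_deriveX _ _ (fun c : R => 1 + 2 * c : R) d.+1 c 1 2 dp.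
    set g := (X in is_derive _ _ X _).
    have -> : g = fun c : R => (1 + 2 * c) ^+ d.+1 :> R.
      by apply/funext => y; rewrite /g exprfctE.
    by move=> /is_derive_eq; apply; rewrite /GRing.scale/=.
  have dF2 : is_derive c 1 (fun c : R => F c ^+ 2 : R) (2 * F c * - A c).
    have := @is_deriveX _ _ F 2 c 1 _ dFc.
    set g := (X in is_derive _ _ X _).
    have -> : g = fun c : R => F c ^+ 2 :> R by apply/funext => y; rewrite /g exprfctE.
    by move=> /is_derive_eq; apply; rewrite /GRing.scale/= expr1.
  have := @is_deriveM _ _ _ _ _ _ _ _ dX dF2.
  rewrite (_ : G' c = (1 + 2 * c) ^+ d.+1 *: (2 * F c * - A c) +
    F c ^+ 2 *: (d.+1%:R * (1 + 2 * c) ^+ d * 2)) => [//|].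
  by rewrite /G' /GRing.scale/= exprS; ring.
have cG : continuous (G : R -> R).
  by move=> x; apply: differentiable_continuous; apply/derivable1_diffP; case: (dG x).
have [c c_in GE] : exists2 c : R, c \in `[0, c0] & G c0 - G 0 = G' c * (c0 - 0).
  by apply: (@MVT_segment _ G G') => //; exact: continuous_subspaceT.
move: c_in; rewrite in_itv/= => c_in; have /andP[c_ge0 c_le] := c_in.
have q1 : 1 <= (1 + 2 * c0) ^+ d.+1 by rewrite exprn_ege1// lerDl mulr_ge0.
have q0 : 0 < (1 + 2 * c0) ^+ d.+1 by exact: lt_le_trans q1.
have G0 : G 0 = 1 by rewrite /G mulr0 addr0 expr1n F0 expr1n mulr1.
have -> : F c0 ^+ 2 - ((1 + 2 * c0) ^+ d.+1)^-1 = (G' c * c0) / (1 + 2 * c0) ^+ d.+1.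
  rewrite subr0 in GE; rewrite -GE G0 /G mulrBl mul1r mulrAC.
  by rewrite divff ?mul1r// gt_eqF.
rewrite normrM (@ger0_norm _ (_^-1)) ?invr_ge0 ?(ltW q0)//.
rewrite ler_pdivrMr//.
have /andP[Fc0 Fc1] := F01 c c_in.
have eps0 : 0 <= eps by rewrite (le_trans _ (Aeps c c_in)).
have qc : 0 <= (1 + 2 * c) ^+ d by rewrite exprn_ge0// addr_ge0// mulr_ge0.
have h : `|G' c * c0| <= 2 * c0 * (1 + 2 * c0) ^+ d * eps.
  rewrite normrM (ger0_norm c00) /G' normrM.
  rewrite (_ : 2 * c0 * _ * _ = 2 * (1 + 2 * c0) ^+ d * eps * c0); last by ring.
  rewrite ler_wpM2r//; apply: ler_pM => //; last exact: Aeps.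
  rewrite normrM (ger0_norm Fc0) normrM (ger0_norm qc) normrN ger0_norm//.
  rewrite -[leRHS]mulr1 ler_pM// ?mulr_ge0// ler_wpM2l// lerXn2r ?nnegrE ?addr_ge0 ?mulr_ge0//.
  by rewrite lerD2l ler_wpM2l.
apply: (le_trans h); rewrite ler_peMr// !mulr_ge0//.
by rewrite exprn_ge0// addr_ge0// mulr_ge0.
Qed.

(** * The rank statistic as a quadratic form in the centered scores *)

Definition centered {R : realType} {d N : nat} (a : 'I_N -> 'rV[R]_d) (i : 'I_N) :=
  a i - N%:R^-1 *: \sum_j a j.

Lemma sum_centered {R : realType} {d N : nat} (a : 'I_N -> 'rV[R]_d) :
  \sum_i centered a i = 0.
Proof.
rewrite sumrB sumr_const card_ord -scaler_nat scalerA.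
case: N a => [|N] a; first by rewrite !big_ord0 scaler0 subr0.
by rewrite divff ?pnatr_eq0// scale1r subrr.
Qed.

(** Centering does not change a difference of means, and the centered scores of the two samples have
    opposite sums. The difference is therefore [1 / m + 1 / n = N / (m n)] times the first sum, and
    [m n / N] times the square of this factor is again [N / (m n)]. *)
Lemma rank_hotellingE {R : realType} {d m n : nat} (S : 'M[R]_d)
    (J : 'rV[R]_d -> 'rV[R]_d) (h : 'I_(m + n) -> 'rV[R]_d) (s : 'S_(m + n)) :
  (0 < m)%N -> (0 < n)%N ->
  let b := centered (J \o h) in
  rank_hotelling S J h s = (m + n)%:R / (m%:R * n%:R) *
    qform (invmx S) (vec_sample_sum b s) (vec_sample_sum b s).
Proof.
move=> m0 n0 b.
have mR0 : m%:R != 0 :> R by rewrite pnatr_eq0 -lt0n.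
have nR0 : n%:R != 0 :> R by rewrite pnatr_eq0 -lt0n.
have NR0 : m%:R + n%:R != 0 :> R by rewrite -natrD pnatr_eq0 -lt0n addn_gt0 m0.
have DE : score_difference J h s =
    ((m + n)%:R / (m%:R * n%:R)) *: vec_sample_sum b s.
  have bE : vec_sample_sum b s + \sum_(j < n) b (s (rshift m j)) = 0.
    transitivity (\sum_x b x); last exact: sum_centered.
    by rewrite [RHS](reindex_inj (@perm_inj _ s)) big_split_ord.
  rewrite /score_difference.
  set mu := (m + n)%:R^-1 *: \sum_j (J \o h) j.
  have -> : \sum_(i < m) J (h (s (lshift n i))) = vec_sample_sum b s + m%:R *: mu.
    rewrite scaler_nat (_ : mu *+ m = \sum_(i < m) mu); last by rewrite sumr_const card_ord.
    rewrite -big_split/=.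
    by apply: eq_bigr => i _; rewrite /b /centered subrK.
  have -> : \sum_(j < n) J (h (s (rshift m j))) = - vec_sample_sum b s + n%:R *: mu.
    move/eqP: bE; rewrite addrC addr_eq0 => /eqP <-; rewrite scaler_nat.
    rewrite (_ : mu *+ n = \sum_(i < n) mu); last by rewrite sumr_const card_ord.
    rewrite -big_split/=.
    by apply: eq_bigr => i _; rewrite /b /centered subrK.
  clearbody mu; rewrite !scalerDr !scalerA !mulVf// !scale1r scalerN opprD opprK addrACA subrr addr0.
  by rewrite -scalerDl; congr (_ *: _); rewrite natrD; field; rewrite mR0 nR0.
rewrite /rank_hotelling DE -/(qform _ _ _) qformZl qformZr natrD.
by field; rewrite mR0 nR0.
Qed.

Lemma qform_invmx_ge0 {R : realType} {d : nat} (S : 'M[R]_d) (u : 'rV[R]_d) :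
  S^T = S -> posdefmx S -> 0 <= qform (invmx S) u u.
Proof.
move=> ST S_pos; have Su := posdefmx_unitmx S_pos.
have -> : qform (invmx S) u u = qform S (u *m invmx S) (u *m invmx S).
  by rewrite /qform trmx_mul trmx_inv ST !mulmxA mulmxKV.
have [->|uQ] := eqVneq (u *m invmx S) 0; first by rewrite /qform !mul0mx mxE.
exact/ltW/S_pos.
Qed.

Lemma rank_hotelling_ge0 {R : realType} {d m n : nat} (S : 'M[R]_d)
    (J : 'rV[R]_d -> 'rV[R]_d) (h : 'I_(m + n) -> 'rV[R]_d) (s : 'S_(m + n)) :
  S^T = S -> posdefmx S -> 0 <= rank_hotelling S J h s.
Proof.
move=> ST S_pos; rewrite /rank_hotelling mulr_ge0 ?divr_ge0 ?mulr_ge0//.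
exact: qform_invmx_ge0.
Qed.

(** The error in [stein_bound] grows with its parameter, so its value at [c] serves on the whole of
    [[0, c]], as [laplace_ode] demands. *)
Lemma rank_hotelling_mean_laplace {R : realType} {d m n : nat} (Sigma : 'M[R]_d.+1)
    (J : 'rV[R]_d.+1 -> 'rV[R]_d.+1) (h : 'I_(m + n) -> 'rV[R]_d.+1) (c K C t s2 : R) :
  let b := centered (J \o h) in
  let w := \sum_k \sum_l (`|(m + n)%:R^-1 * \sum_x b x 0 k * b x 0 l - Sigma k l|
    + (1 + C * s2) * t + s2 / ((m + n)%:R - 1)) in
  (0 < m)%N -> (0 < n)%N -> 0 <= c -> Sigma^T = Sigma -> posdefmx Sigma ->
  (forall k l, `|invmx Sigma k l| <= K) ->
  0 <= C -> (m + n)%:R ^+ 2 <= C * (m%:R * n%:R) -> 0 < t ->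
  (forall x, sqnorm (b x) <= t ^+ 2 * (m + n)%:R) ->
  (m + n)%:R^-1 * \sum_x sqnorm (b x) = s2 ->
  `|perm_mean (fun s => expR (- (c * rank_hotelling Sigma J h s))) ^+ 2 -
    ((1 + 2 * c) ^+ d.+1)^-1| <=
  2 * c * (1 + 2 * c) ^+ d * (3 * K * w + (10 * c + 22) *
    ((1 + 4 * d.+1%:R ^+ 2 * K * C) * t) * (d.+1%:R + K * w)).
Proof.
move=> b w m0 n0 c0 ST S_pos QK C0 NC t0 b_max b_sum.
have mR0 : 0 < m%:R :> R by rewrite ltr0n.
have nR0 : 0 < n%:R :> R by rewrite ltr0n.
have NR0 : 0 < (m + n)%:R :> R by rewrite ltr0n addn_gt0 m0.
have K0 : 0 <= K by exact: le_trans (QK 0 0).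
set Q := invmx Sigma in QK *.
have Su := posdefmx_unitmx S_pos.
have QT : Q^T = Q by rewrite /Q trmx_inv ST.
have QSQ : Q *m Sigma *m Q = Q by rewrite /Q mulVmx// mul1mx.
have Q0 u : 0 <= qform Q u u by exact: qform_invmx_ge0.
have QS : \sum_k \sum_l Q k l * Sigma k l = d.+1%:R.
  rewrite -(mxtrace1 R d.+1) -(mulVmx Su) /mxtrace; apply: eq_bigr => k _.
  by rewrite mxE; apply: eq_bigr => l _; rewrite -{1}ST [Sigma^T _ _]mxE.
have b0 : \sum_x b x = 0 by exact: sum_centered.
pose kappa : R := (m + n)%:R / (m%:R * n%:R).
have kappa0 : 0 <= kappa by rewrite divr_ge0// ltW// mulr_gt0.
pose p (s : 'S_(m + n)) : R := kappa * qform Q (vec_sample_sum b s) (vec_sample_sum b s).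
have p0 s : 0 <= p s by exact: mulr_ge0.
under eq_perm_mean do rewrite (rank_hotellingE _ _ _ _ m0 n0) -/(p _).
pose F (c : R) := perm_mean (fun s => expR (- (c * p s))).
pose A (c : R) := perm_mean (fun s => p s * expR (- (c * p s))).
rewrite -/(F c).
have w0 : 0 <= w.
  have s20 : 0 <= s2.
    by rewrite -b_sum mulr_ge0 ?invr_ge0 ?(ltW NR0)// sumr_ge0// => x _; exact: sqnorm_ge0.
  rewrite sumr_ge0// => k _; rewrite sumr_ge0// => l _.
  rewrite !addr_ge0// ?mulr_ge0// ?addr_ge0 ?mulr_ge0 ?(ltW t0)//.
  by rewrite invr_ge0 subr_ge0 ler1n addn_gt0 m0.
(* A swap satisfies [kappa * qform Q D D <= 4 * d.+1 ^ 2 * K * C * t ^ 2]. Since [x <= (1 + x) ^ 2]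
   for [x >= 0], this choice of [e] avoids a square root. *)
set e : R := _ * t; have e0 : 0 <= e.
  by rewrite mulr_ge0 ?(ltW t0)// addr_ge0// !mulr_ge0.
apply: (@laplace_ode _ _ F A) => //.
- rewrite /F -[RHS](perm_mean_cst (N := m + n)); apply: eq_perm_mean => s.
  by rewrite mul0r oppr0 expR0.
- move=> x; rewrite /F /A /perm_mean -mulrN -sumrN.
  have H : is_derive x 1 (fun c : R => \sum_(s : 'S_(m + n)) expR (- (c * p s)))
      (\sum_(s : 'S_(m + n)) - (p s * expR (- (x * p s)))).
    apply: (@is_derive_bigsum _ _ _ (fun s c => expR (- (c * p s)))
      (fun s c => - (p s * expR (- (c * p s))))) => s.
    by apply: is_derive_eq; rewrite /GRing.scale/=; ring.
  by apply: is_derive_eq; rewrite /GRing.scale/=; ring.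
- move=> x /andP[x0 _]; rewrite perm_mean_ge0 => [/=|s]; last exact: expR_ge0.
  rewrite -[leRHS](perm_mean_cst (N := m + n)); apply: le_perm_mean => s.
  by rewrite -expR0 ler_expR oppr_le0 mulr_ge0.
move=> x /andP[x0 xc].
pose v := perm_mean (fun s => \sum_k \sum_l `|swap_cov_dev b Sigma k l s|).
have vw : v <= w.
  rewrite /v /w perm_mean_sum ler_sum// => k _; rewrite perm_mean_sum ler_sum// => l _.
  by apply: mean_abs_swap_cov_dev; rewrite ?b_sum.
have v0 : 0 <= v.
  by apply: perm_mean_ge0 => s; rewrite sumr_ge0// => k _; rewrite sumr_ge0.
have swap_small (i : 'I_m) (j : 'I_n) s :
    kappa * qform Q (vec_swap_diff b i j s) (vec_swap_diff b i j s) <= e ^+ 2.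
  apply: (@le_trans _ _ (kappa * (d.+1%:R ^+ 2 * K * (2 * (t ^+ 2 * (m + n)%:R + t ^+ 2 * (m + n)%:R))))).
    rewrite ler_wpM2l// (le_trans (qform_le_sqnorm _ K0 QK))// ler_wpM2l ?mulr_ge0//.
    by rewrite (le_trans (sqnormB_le _ _))// ler_wpM2l// lerD.
  rewrite (_ : kappa * _ = 4 * d.+1%:R ^+ 2 * K * ((m + n)%:R ^+ 2 / (m%:R * n%:R)) * t ^+ 2).
    rewrite /e exprMn ler_wpM2r ?sqr_ge0//.
    apply: (@le_trans _ _ (4 * d.+1%:R ^+ 2 * K * C)).
      by rewrite ler_wpM2l ?mulr_ge0// ler_pdivrMr ?mulr_gt0.
    by have : 0 <= 4 * d.+1%:R ^+ 2 * K * C; [rewrite !mulr_ge0|nra].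
  by rewrite /kappa; field; rewrite !gt_eqF.
have := stein_bound b0 m0 n0 x0 e0 QT Q0 K0 QK QS QSQ swap_small.
move=> /le_trans; apply.
rewrite -/v; apply: lerD; first by rewrite ler_wpM2l ?mulr_ge0.
have x10 : 0 <= 10 * x + 22 by rewrite addr_ge0// mulr_ge0.
have Kv : 0 <= d.+1%:R + K * v by rewrite addr_ge0// mulr_ge0.
apply: ler_pM => //; first exact: mulr_ge0.
- by rewrite ler_wpM2r// lerD2r ler_wpM2l.
- by rewrite lerD2l ler_wpM2l.
Qed.

Lemma rank_hotelling_laplace_cvg {R : realType} (d : nat) (m n : nat -> nat)
    (lambda : R) (Sigma : 'M[R]_d.+1) (J : 'rV[R]_d.+1 -> 'rV[R]_d.+1)
    (h : forall N, 'I_N -> 'rV[R]_d.+1) (t : nat -> R) (c : R) :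
  (m k + n k)%N @[k --> \oo] --> \oo -> 0 < lambda < 1 ->
  (m k)%:R / (m k + n k)%:R @[k --> \oo] --> lambda ->
  Sigma^T = Sigma -> posdefmx Sigma ->
  (forall p q, N%:R^-1 * (\sum_x centered (J \o h N) x 0 p * centered (J \o h N) x 0 q)
     @[N --> \oo] --> Sigma p q) ->
  (forall N, 0 < t N) -> t @ \oo --> 0 ->
  (forall N x, sqnorm (centered (J \o h N) x) <= t N ^+ 2 * N%:R) -> 0 <= c ->
  (perm_mean (fun s =>
     expR (- (c * rank_hotelling Sigma J (h (m k + n k)%N) s))) ^+ 2)
    @[k --> \oo] --> ((1 + 2 * c) ^+ d.+1)^-1.
Proof.
move=> Noo /andP[l0 l1] mN ST S_pos cov t0 tcvg b_max c0.
pose cv p q N := N%:R^-1 * (\sum_x centered (J \o h N) x 0 p * centered (J \o h N) x 0 q).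
pose s2 N := N%:R^-1 * \sum_x sqnorm (centered (J \o h N) x).
have s2cvg : s2 N @[N --> \oo] --> \sum_p Sigma p p.
  rewrite (_ : s2 = fun N => \sum_p cv p p N).
    by apply: (@cvg_sumr _ _ _ (fun p => cv p p) (fun p => Sigma p p)) => p; exact: cov.
  apply/funext => N; rewrite /s2 /cv /sqnorm exchange_big/= mulr_sumr.
  by apply: eq_bigr => p _; congr (_ * _); apply: eq_bigr => x _; rewrite expr2.
(* [L] is the limit of [m n / N ^ 2]. The ratio eventually exceeds [L / 2], so [C := 2 / L] bounds
   [N ^ 2 / (m n)]. *)
pose L := lambda * (1 - lambda); have L0 : 0 < L by rewrite mulr_gt0// subr_gt0.
pose C := 2 / L; have C0 : 0 <= C by rewrite divr_ge0// ltW.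
pose K : R := \sum_p \sum_q `|invmx Sigma p q|.
have QK p q : `|invmx Sigma p q| <= K.
  rewrite /K (bigD1 p)//= (bigD1 q)//= -addrA lerDl addr_ge0//.
    by rewrite sumr_ge0.
  by rewrite sumr_ge0// => i _; rewrite sumr_ge0.
pose w N : R := \sum_p \sum_q (`|cv p q N - Sigma p q| + (1 + C * s2 N) * t N + s2 N / (N%:R - 1)).
pose err N := 2 * c * (1 + 2 * c) ^+ d * (3 * K * w N + (10 * c + 22) *
    ((1 + 4 * d.+1%:R ^+ 2 * K * C) * t N) * (d.+1%:R + K * w N)).
have invN : (N%:R - 1)^-1 @[N --> \oo] --> (0 : R).
  rewrite -(@cvg_shiftn 2).
  apply: (@squeeze_cvgr _ _ _ _ (fun=> 0) (@harmonic R)); last 2 first.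
  - exact: cvg_cst.
  - exact: cvg_harmonic.
  apply: nearW => k; rewrite /harmonic/=.
  rewrite (_ : (k + 2)%:R - 1 = k.+1%:R :> R); last by rewrite natrD -natr1; lra.
  by rewrite invr_ge0 ler0n lexx.
have wcvg : w N @[N --> \oo] --> (0 : R).
  have -> : 0 = \sum_(p < d.+1) \sum_(q < d.+1)
      (`|Sigma p q - Sigma p q| + (1 + C * \sum_p Sigma p p) * 0 + (\sum_p Sigma p p) * 0) :> R.
    rewrite big1// => p _; rewrite big1// => q _.
    by rewrite subrr normr0 !mulr0 !addr0.
  apply: (@cvg_sumr _ _ _ (fun p N => \sum_q (`|cv p q N - Sigma p q| +
    (1 + C * s2 N) * t N + s2 N / (N%:R - 1)))) => p.
  apply: (@cvg_sumr _ _ _ (fun q N => `|cv p q N - Sigma p q| +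
    (1 + C * s2 N) * t N + s2 N / (N%:R - 1))) => q.
  apply: cvgD; last exact: cvgM.
  apply: cvgD; first by apply: cvg_norm; apply: cvgB; [exact: cov|exact: cvg_cst].
  apply: cvgM => //; apply: cvgD; first exact: cvg_cst.
  by apply: cvgM => //; exact: cvg_cst.
have errcvg : err N @[N --> \oo] --> (0 : R).
  have -> : 0 = 2 * c * (1 + 2 * c) ^+ d * (3 * K * 0 + (10 * c + 22) *
    ((1 + 4 * d.+1%:R ^+ 2 * K * C) * 0) * (d.+1%:R + K * 0)) by ring.
  rewrite /err; apply: cvgM; first exact: cvg_cst.
  apply: cvgD; first by apply: cvgM => //; exact: cvg_cst.
  apply: cvgM; last by apply: cvgD; [exact: cvg_cst|apply: cvgM => //; exact: cvg_cst].
  by apply: cvgM; [exact: cvg_cst|apply: cvgM => //; exact: cvg_cst].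
have errcvg' : err (m k + n k)%N @[k --> \oo] --> (0 : R) by exact: cvg_comp Noo errcvg.
have ratio : (m k)%:R / (m k + n k)%:R * (1 - (m k)%:R / (m k + n k)%:R)
    @[k --> \oo] --> L.
  by apply: cvgM => //; apply: cvgB => //; exact: cvg_cst.
apply/cvgrPdist_le => eps eps0; near=> k.
have Nk : (1 < m k + n k)%N.
  near: k; apply: (Noo [set N | (1 < N)%N]); exact: nbhs_infty_gt.
have NR0 : 0 < (m k + n k)%:R :> R by rewrite ltr0n (ltn_trans _ Nk).
have rk : L / 2 <= (m k)%:R / (m k + n k)%:R * (1 - (m k)%:R / (m k + n k)%:R).
  near: k; apply: (cvgr_ge L ratio); lra.
have rkE : (m k)%:R / (m k + n k)%:R * (1 - (m k)%:R / (m k + n k)%:R) =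
    (m k)%:R * (n k)%:R / (m k + n k)%:R ^+ 2 :> R.
  by rewrite natrD; field; rewrite -natrD gt_eqF.
have NC : (m k + n k)%:R ^+ 2 <= C * ((m k)%:R * (n k)%:R) :> R.
  move: rk; rewrite rkE ler_pdivlMr ?exprn_gt0// => rk.
  rewrite /C -mulrA [_^-1 * _]mulrC mulrA ler_pdivlMr//.
  by rewrite mulrC; lra.
(* Both samples are eventually nonempty, since otherwise [NC] would give [N ^ 2 <= 0]. *)
have mn0 : 0 < (m k)%:R * (n k)%:R :> R.
  have : 0 < C * ((m k)%:R * (n k)%:R) by rewrite (lt_le_trans _ NC)// exprn_gt0.
  by rewrite pmulr_rgt0// divr_gt0.
have [mk nk] : (0 < m k)%N /\ (0 < n k)%N.
  by move: mn0; rewrite -natrM ltr0n muln_gt0 => /andP.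
rewrite distrC.
have := @rank_hotelling_mean_laplace R d (m k) (n k) Sigma J (h (m k + n k)%N) c K C
  (t (m k + n k)%N) (s2 (m k + n k)%N) mk nk c0 ST S_pos QK C0 NC (t0 _) (b_max _) erefl.
move=> /le_trans; apply.
rewrite -/(w (m k + n k)%N) -/(err (m k + n k)%N).
rewrite (le_trans (ler_norm _))//.
by near: k; move/cvgr0Pnorm_le : errcvg'; exact.
Unshelve. all: by end_near. Qed.

(** * The law of the ranks *)

Section borel_mx.
Context {R : realType} {m n : nat}.

Lemma open_measurable_mx (U : set 'M[R]_(m, n)) : open U -> measurable U.
Proof. by move=> oU; exact: sub_sigma_algebra. Qed.

Lemma continuous_measurable_mx (f : 'M[R]_(m, n) -> R) :
  continuous f -> measurable_fun setT f.
Proof.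
move=> /continuousP cf; apply: (measurability _ (RGenOpens.measurableE R)).
move=> _ [_ [x [y ->]] <-]; rewrite setTI.
by apply: open_measurable_mx; apply: cf; exact: (@interval_open R (BRight x) (BLeft y)). 
Qed.

Lemma measurable_coord i j : measurable_fun setT (fun x : 'M[R]_(m, n) => x i j).
Proof. apply: continuous_measurable_mx. apply: coord_continuous. Qed.

End borel_mx.

Section tuple_law.
Context {R : realType} {d} {U : measurableType d} {N : nat}.
Implicit Types A : 'I_N -> set U.

Definition rectangle A : set (N.-tuple U) := [set t | forall i, A i (tnth t i)].

Lemma measurable_rectangle A : (forall i, measurable (A i)) -> measurable (rectangle A).
Proof.
move=> mA; rewrite (_ : rectangle A = \bigcap_(i in [set: 'I_N]) ((@tnth N U ^~ i) @^-1` A i)).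
  apply: fin_bigcap_measurable => // i _.
  by rewrite -[X in measurable X]setTI; exact: measurable_tnth.
by apply/seteqP; split=> t /= tA i; [move=> _|]; exact: tA.
Qed.

(** Rectangles are stable under intersection and generate the product sigma-algebra: a preimage
    under one coordinate map is a rectangle with a single nontrivial side. *)
Lemma tuple_measure_unique (m1 m2 : {measure set (N.-tuple U) -> \bar R}) :
  (m1 setT < +oo)%E ->
  (forall A, (forall i, measurable (A i)) -> m1 (rectangle A) = m2 (rectangle A)) ->
  forall B, measurable B -> m1 B = m2 B.
Proof.
move=> m1oo m12 B mB.
pose G := [set rectangle A | A in [set A | forall i, measurable (A i)]].
have rT : rectangle (fun=> setT) = setT by apply/seteqP; split.
apply: (g_sigma_algebra_measure_unique G _ (fun=> setT)).
- by move=> _ [A mA <-]; exact: measurable_rectangle.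
- by move=> _; exists (fun=> setT).
- by rewrite bigcup_const.
- move=> _ _ [A mA <-] [A' mA' <-]; exists (fun i => A i `&` A' i).
    by move=> i; exact: measurableI.
  apply/seteqP; split=> t /= h; first by split=> i; have [] := h i.
  by move=> i; split; [exact: h.1|exact: h.2].
- by move=> _ [A mA <-]; exact: m12.
- by [].
move: B mB; apply: smallest_sub; first exact: smallest_sigma_algebra.
move=> S; rewrite -bigcup_seq => -[i _ [C mC <-]]; rewrite setTI.
apply: sub_sigma_algebra; exists (fun j => if j == i then C else setT).
  by move=> j; case: ifP.
apply/seteqP; split=> t /=; first by move=> /(_ i); rewrite eqxx.
by move=> tC j; case: eqP => [->|].
Qed.

End tuple_law.

(** * Hyperplanes are null sets *)

Lemma lebesgue_rV0 {R : realType} {d : nat} : lebesgue_rV (set0 : set 'rV[R]_d) = 0%E.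
Proof.
elim: d => [|d IH] /=; first by rewrite diracE in_set0.
under eq_integral do rewrite (_ : [set v | _] = set0) ?IH//.
by rewrite integral0.
Qed.

Definition dotp {R : realType} {d : nat} (z v : 'rV[R]_d) : R := \sum_k z 0 k * v 0 k.

(** Induction on the dimension through slices at a fixed first coordinate. If the normal [v'] of the
    slices is nonzero, each slice is null by induction; if [v' = 0], only one slice is nonempty. *)
Lemma lebesgue_rV_hyperplane {R : realType} {d : nat} (v : 'rV[R]_d) (c : R) :
  v != 0 -> lebesgue_rV [set z | dotp z v = c] = 0%E.
Proof.
elim: d v c => [|d IH] v c; first by rewrite (thinmx0 v) eqxx.
move=> v0 /=; change 'rV[R]_(1 + d) in v.
pose a := v 0 (lshift d 0); pose v' := rsubmx v.
have secE (x : R) : [set w : 'rV[R]_d | [set z | dotp z v = c] (row_mx x%:M w : 'rV[R]_(1 + d))] =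
    [set w | dotp w v' = c - x * a].
  have E (w : 'rV[R]_d) : dotp (row_mx x%:M w : 'rV[R]_(1 + d)) v = x * a + dotp w v'.
    rewrite /dotp big_split_ord/= big_ord1 row_mxEl mxE eqxx mulr1n.
    by congr (_ + _); apply: eq_bigr => j _; rewrite row_mxEr mxE.
  apply/seteqP; split => w /=; rewrite E; first by move=> <-; rewrite addrAC subrr add0r.
  by move=> ->; rewrite addrC subrK.
under eq_integral do rewrite secE.
have [v'0|v'0] := eqVneq v' 0; last first.
  by under eq_integral do rewrite IH//; rewrite integral0.
have a0 : a != 0.
  apply: contraNneq v0 => a0; rewrite -[v]hsubmxK -/v' v'0.
  rewrite (_ : lsubmx v = 0) ?row_mx0//.
  by apply/rowP => k; rewrite !mxE ord1.
(* The slice at [c / a] is the whole space and may have infinite measure; the integral vanishes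
   because a point is null and [+oo * 0 = 0]. *)
have -> : (fun x : R => lebesgue_rV [set w : 'rV[R]_d | dotp w v' = c - x * a]) =
    (cst (lebesgue_rV (setT : set 'rV[R]_d))) \_ [set c / a].
  apply/funext => x; rewrite patchE; case: ifPn => [|].
    rewrite inE/= => ->; congr lebesgue_rV; apply/seteqP; split => //= w _.
    rewrite /= v'0 /dotp big1 => [|k _]; last by rewrite mxE mulr0.
    by rewrite divfK// subrr.
  rewrite notin_setE/= => xca; transitivity (0%E : \bar R) => //.
  rewrite -(@lebesgue_rV0 R d); congr lebesgue_rV.
  apply/seteqP; split => //= w.
  rewrite /= v'0 /dotp big1 => [|k _]; last by rewrite mxE mulr0.
  by move=> /esym/subr0_eq cxa; apply: xca; rewrite cxa mulfK.
by rewrite -integral_mkcond integral_cst//= lebesgue_measure_set1 mule0.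
Qed.

Lemma measurable_dotp {R : realType} {d : nat} (v : 'rV[R]_d) :
  measurable_fun setT (fun z => dotp z v).
Proof.
apply: measurable_sum => k; apply: measurable_funM; last exact: measurable_cst.
exact: measurable_coord.
Qed.

Lemma abs_continuous_hyperplane {R : realType} {d : nat} (mu : probability 'rV[R]_d R)
    (v : 'rV[R]_d) (c : R) :
  abs_continuous mu -> v != 0 -> mu [set z | dotp z v = c] = 0%E.
Proof.
move=> mu_ac v0; apply: mu_ac; last exact: lebesgue_rV_hyperplane.
rewrite -[X in measurable X]setTI -[X in _ `&` X]/((fun z => dotp z v) @^-1` [set c]).
exact: measurable_dotp.
Qed.

(** * The pooled sample when both samples have the same law *)

Section pooled_law.
Context {R : realType} {d : nat} {disp : measure_display} {T : measurableType disp}.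
Context {P : probability T R} {m n : nat} {mu : probability 'rV[R]_d R}.
Context {X : 'I_m -> {RV P >-> 'rV[R]_d}} {Y : 'I_n -> {RV P >-> 'rV[R]_d}}.
Hypotheses (X_iid : iid_sample X mu) (Y_iid : iid_sample Y mu).
Hypothesis XY_indep : independent_samples X Y.

Definition pooled_rv (i : 'I_(m + n)) (w : T) : 'rV[R]_d :=
  pooled (fun a => X a w) (fun b => Y b w) i.

Lemma measurable_pooled_rv i : measurable_fun setT (pooled_rv i).
Proof.
rewrite /pooled_rv /pooled; case: (fintype.split i) => j; exact: measurable_funPT.
Qed.

Lemma g_sigma_preimage_bigcap N (V : 'I_N -> T -> 'rV[R]_d) (A : 'I_N -> set 'rV[R]_d) :
  (forall i, measurable (A i)) ->
  g_sigma_preimage V (\bigcap_(i in [set: 'I_N]) V i @^-1` A i).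
Proof.
move=> mA; rewrite /g_sigma_preimage; set G := (X in <<s X >>).
apply: (@fin_bigcap_measurable _ (g_sigma_algebraType G) _ _ (fun i => V i @^-1` A i)) => //.
move=> i _; apply: sub_sigma_algebra; rewrite /G -bigcup_seq.
by exists i => /=; [rewrite mem_index_enum|exists (A i) => //; rewrite setTI].
Qed.

Lemma pooled_rectangle (A : 'I_(m + n) -> set 'rV[R]_d) :
  (forall i, measurable (A i)) ->
  P [set w | forall i, A i (pooled_rv i w)] = (\prod_i mu (A i))%E.
Proof.
move=> mA.
have part N (V : 'I_N -> {RV P >-> 'rV[R]_d}) (B : 'I_N -> set 'rV[R]_d) :
    iid_sample V mu -> (forall i, measurable (B i)) ->
    P (\bigcap_(i in [set: 'I_N]) V i @^-1` B i) = (\prod_i mu (B i))%E.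
  move=> [ind id] mB; have := ind [set: 'I_N]%SET B mB.
  rewrite (_ : [set` [set: 'I_N]%SET] = [set: 'I_N]); last first.
    by apply/seteqP; split=> i //= _; rewrite finset.in_setT.
  move=> ->; apply: eq_big => [i|i _]; first by rewrite finset.in_setT.
  exact: (id i (B i) (mB i)).
rewrite (_ : [set w | _] =
  (\bigcap_(i in [set: 'I_m]) X i @^-1` A (lshift n i)) `&`
  (\bigcap_(j in [set: 'I_n]) Y j @^-1` A (rshift m j))).
  rewrite XY_indep; last 2 first.
  - exact: (@g_sigma_preimage_bigcap _ (fun i => X i) (fun i => A (lshift n i))).
  - exact: (@g_sigma_preimage_bigcap _ (fun i => Y i) (fun i => A (rshift m i))).
  by rewrite (part _ _ (fun i => A (lshift n i)))// (part _ _ (fun i => A (rshift m i)))// big_split_ord.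
apply/seteqP; split => w /=.
  move=> wA; split => i _ /=.
    by have := wA (lshift n i); rewrite /pooled_rv /pooled (unsplitK (inl i)).
  by have := wA (rshift m i); rewrite /pooled_rv /pooled (unsplitK (inr i)).
move=> [wX wY] i; rewrite /pooled_rv /pooled; case: (fintype.split_ordP i) => j ->.
  exact: wX.
exact: wY.
Qed.

Local Notation N := (m + n)%N.

Definition pooled_tuple (w : T) : N.-tuple 'rV[R]_d := [tuple pooled_rv i w | i < N].

Definition perm_tuple (s : 'S_N) (t : N.-tuple 'rV[R]_d) : N.-tuple 'rV[R]_d :=
  [tuple tnth t (s i) | i < N].

Lemma measurable_pooled_tuple : measurable_fun setT pooled_tuple.
Proof.
apply/measurable_fun_tnthP => i.
rewrite (_ : _ \o _ = pooled_rv i); first exact: measurable_pooled_rv.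
by apply/funext => w /=; rewrite tnth_mktuple.
Qed.

Lemma measurable_perm_tuple s : measurable_fun setT (perm_tuple s).
Proof.
apply/measurable_fun_tnthP => i.
rewrite (_ : _ \o _ = (@tnth N _ ^~ (s i))); first exact: measurable_tnth.
by apply/funext => w /=; rewrite tnth_mktuple.
Qed.

(** It suffices to compare rectangles, on which a permutation of the coordinates only reorders the
    factors of a product. *)
Lemma pooled_tuple_exchangeable (s : 'S_N) (B : set (N.-tuple 'rV[R]_d)) :
  measurable B ->
  P (pooled_tuple @^-1` (perm_tuple s @^-1` B)) = P (pooled_tuple @^-1` B).
Proof.
have mZ := measurable_pooled_tuple.
have mZs : measurable_fun setT (perm_tuple s \o pooled_tuple).
  by apply: measurableT_comp => //; exact: measurable_perm_tuple.
pose f1 : {mfun T >-> N.-tuple 'rV[R]_d} := mfun_Sub (mem_set mZs).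
pose f2 : {mfun T >-> N.-tuple 'rV[R]_d} := mfun_Sub (mem_set mZ).
move: B; apply: (@tuple_measure_unique _ _ _ _ (distribution P f1) (distribution P f2)).
  by rewrite (le_lt_trans (probability_le1 _ _))// ltry.
move=> A mA; rewrite /distribution/= /pushforward.
rewrite [X in P X = _](_ : _ = [set w | forall i, A (s^-1 i)%g (pooled_rv i w)]).
  rewrite (pooled_rectangle (A := fun i => A (s^-1 i)%g))//; rewrite [X in _ = P X](_ : _ = [set w | forall i, A i (pooled_rv i w)]).
    rewrite pooled_rectangle// [RHS](reindex_inj (@perm_inj _ s^-1%g)).
    by [].
  by apply/seteqP; split => w /= h i; have := h i; rewrite tnth_mktuple.
apply/seteqP; split => w /= h i.
  by have := h (s^-1 i)%g; rewrite !tnth_mktuple permKV.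
by have := h (s i); rewrite !tnth_mktuple permK.
Qed.

End pooled_law.

(** Attaches the measure structure to [pushforward] from an explicit proof of measurability. *)
Definition image_measure {R : realFieldType} {d d'} {T : measurableType d}
    {T' : measurableType d'} (mu : {measure set T -> \bar R}) (f : T -> T')
    (mf : measurable_fun setT f) : {measure set T' -> \bar R} :=
  measure_function_pushforward__canonical__measure_function_Measure mu mf.

Lemma image_measureE {R : realFieldType} {d d'} {T : measurableType d}
    {T' : measurableType d'} (mu : {measure set T -> \bar R}) (f : T -> T')
    (mf : measurable_fun setT f) A : image_measure mu mf A = mu (f @^-1` A).
Proof. by []. Qed.

Section no_ties.
Context {R : realType} {d : nat} {disp : measure_display} {T : measurableType disp}.
Context {P : probability T R} {m n : nat} {mu : probability 'rV[R]_d R}.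
Context {X : 'I_m -> {RV P >-> 'rV[R]_d}} {Y : 'I_n -> {RV P >-> 'rV[R]_d}}.
Hypotheses (X_iid : iid_sample X mu) (Y_iid : iid_sample Y mu).
Hypothesis XY_indep : independent_samples X Y.
Local Notation N := (m + n)%N.
Local Notation Z := (pooled_rv (X := X) (Y := Y)).

(** The pooled sample without its point [i0]. The dummy value [0] in that slot keeps the type of
    [N]-tuples, so that [tuple_measure_unique] applies. *)
Let masked (i0 : 'I_N) (w : T) : N.-tuple 'rV[R]_d :=
  [tuple if i == i0 then 0 else Z i w | i < N].

Let measurable_masked i0 : measurable_fun setT (masked i0).
Proof.
apply/measurable_fun_tnthP => i.
rewrite (_ : _ \o _ = if i == i0 then cst 0 else Z i).
  by case: ifP => _; [exact: measurable_cst|exact: measurable_pooled_rv].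
by apply/funext => w /=; rewrite tnth_mktuple; case: ifP.
Qed.

Let mZ i (A : set 'rV[R]_d) : measurable A -> measurable (Z i @^-1` A).
Proof. by move=> mA; rewrite -[X in measurable X]setTI; exact: measurable_pooled_rv. Qed.

(** For fixed [A] both sides are finite measures in [B], so rectangles suffice; there the dummy slot
    contributes a Dirac mass at [0]. *)
Let masked_indep i0 (B : set (N.-tuple 'rV[R]_d)) (A : set 'rV[R]_d) :
  measurable B -> measurable A ->
  P ((masked i0 @^-1` B) `&` (Z i0 @^-1` A)) = (P (masked i0 @^-1` B) * mu A)%E.
Proof.
move=> mB mA; have mm := measurable_masked i0.
have muA : mu A \is a fin_num by exact: fin_num_measure.
have muA0 : 0 <= fine (mu A) by exact: fine_ge0.
pose m1 := image_measure (mrestr P (mZ i0 mA)) mm.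
pose m2 := mscale (NngNum muA0) (image_measure P mm).
suff -> : P ((masked i0 @^-1` B) `&` (Z i0 @^-1` A)) = m2 B.
  by rewrite /m2 /mscale/= fineK// muleC.
move: B mB; apply: (@tuple_measure_unique _ _ _ _ m1 m2).
  rewrite /m1 image_measureE/= /mrestr.
  rewrite (le_lt_trans (probability_le1 _ _))// ?ltry// preimage_setT setTI.
  exact: mZ.
move=> B mB; change (P ((masked i0 @^-1` rectangle B) `&` (Z i0 @^-1` A)) =
  ((fine (mu A))%:E * P (masked i0 @^-1` rectangle B))%E); rewrite fineK//.
have E (C : set 'rV[R]_d) : measurable C -> P ((masked i0 @^-1` rectangle B) `&` (Z i0 @^-1` C)) =
    ((\d_(0%R : 'rV[R]_d) (B i0)) * (mu C * \prod_(i | i != i0) mu (B i)))%E.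
  move=> mC; rewrite diracE; have [B0|B0] := boolP (0 \in B i0); last first.
    rewrite mul0e (_ : _ `&` _ = set0) ?measure0//.
    apply/seteqP; split => // w /= [/(_ i0)]; rewrite tnth_mktuple eqxx => h _.
    by move: B0; rewrite notin_setE; exact.
  rewrite mul1e; pose B' i := if i == i0 then C else B i.
  rewrite [X in P X = _](_ : _ = [set w | forall i, B' i (Z i w)]).
    rewrite (pooled_rectangle X_iid Y_iid XY_indep)//; last by move=> i; rewrite /B'; case: ifP.
    rewrite (bigD1 i0)//= {1}/B' eqxx; congr (_ * _)%E.
    by apply: eq_bigr => i /negbTE ii0; rewrite /B' ii0.
  apply/seteqP; split => w /=.
    move=> [h Cw] i; rewrite /B'; case: eqP => [->//|/eqP/negbTE ii0].
    by have := h i; rewrite tnth_mktuple ii0.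
  move=> h; split; last by have := h i0; rewrite /B' eqxx.
  move=> i; rewrite tnth_mktuple; have := h i; rewrite /B'.
  by case: eqP => [->|] //; rewrite inE in B0.
have ET : P (masked i0 @^-1` rectangle B) = P ((masked i0 @^-1` rectangle B) `&` (Z i0 @^-1` setT)).
  by rewrite preimage_setT setIT.
rewrite ET !E// probability_setT mul1e.
by rewrite muleCA.
Qed.

(** By [masked_indep] the law of the pair formed by the other points and [Z i0] is a product. Its
    sections at fixed other points are hyperplanes with normal [v i0], hence [mu]-null, and Tonelli
    concludes. *)
Lemma pooled_hyperplane (v : 'I_N -> 'rV[R]_d) (i0 : 'I_N) :
  abs_continuous mu -> v i0 != 0 ->
  P [set w | \sum_i dotp (Z i w) (v i) = 0] = 0%E.
Proof.
move=> mu_ac v0; have mm := measurable_masked i0.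
have mjoint : measurable_fun setT (fun w => (masked i0 w, Z i0 w)).
  by apply/measurable_fun_pairP; split => //; exact: measurable_pooled_rv.
pose f (p : N.-tuple 'rV[R]_d * 'rV[R]_d) :=
  dotp p.2 (v i0) + \sum_(i | i != i0) dotp (tnth p.1 i) (v i).
have mf : measurable_fun setT f.
  apply: measurable_funD.
    by apply: (measurableT_comp (measurable_dotp (v i0))); exact: measurable_snd.
  rewrite [X in measurable_fun _ X](_ : _ = fun p : N.-tuple 'rV[R]_d * 'rV[R]_d =>
      \sum_i (if i != i0 then dotp (tnth p.1 i) (v i) else 0)).
    apply: measurable_sum => i; case: (i != i0); last exact: measurable_cst.
    apply: (measurableT_comp (measurable_dotp (v i))).
    by apply: (measurableT_comp (measurable_tnth i)); exact: measurable_fst.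
  by apply/funext => p; rewrite big_mkcond.
have mS : measurable (f @^-1` [set 0]) by rewrite -[X in measurable X]setTI; exact: mf.
pose pnu : {mfun T >-> N.-tuple 'rV[R]_d} := mfun_Sub (mem_set mm).
have <- : (distribution P pnu \x mu)%E (f @^-1` [set 0]) = P [set w | \sum_i dotp (Z i w) (v i) = 0].
  rewrite (@product_measure_unique _ _ _ _ _ _ _ (image_measure P mjoint))//.
    rewrite image_measureE; congr (P _).
    have fE w : f (masked i0 w, Z i0 w) = \sum_i dotp (Z i w) (v i).
      rewrite /f /= [RHS](bigD1 i0)//=; congr (_ + _).
      by apply: eq_bigr => i /negbTE ii0; rewrite tnth_mktuple ii0.
    by apply/seteqP; split => w /=; rewrite fE.
  move=> B A mB mA; rewrite image_measureE.
  by rewrite -masked_indep.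
rewrite /product_measure1; apply: integral0_eq => t _ /=.
rewrite (_ : xsection _ _ = [set z | dotp z (v i0) = - \sum_(i | i != i0) dotp (tnth t i) (v i)]).
  exact: abs_continuous_hyperplane.
apply/seteqP; split => z; rewrite /xsection/= inE /f/=.
  by move/eqP; rewrite addr_eq0 => /eqP.
by move=> ->; rewrite addNr.
Qed.

End no_ties.

(** * Optimal assignments *)

Section assignment.
Context {R : realType} {d N : nat}.
Implicit Types (z h : 'I_N -> 'rV[R]_d) (s t : 'S_N).

Lemma eq_assignment_cost z z' h s : z =1 z' ->
  assignment_cost z h s = assignment_cost z' h s.
Proof. by move=> zz'; apply: eq_bigr => i _; rewrite zz'. Qed.

Lemma assignment_cost_perm z h (p s : 'S_N) :
  assignment_cost (fun i => z (p i)) h s = assignment_cost z h (p^-1 * s)%g.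
Proof.
rewrite /assignment_cost [RHS](reindex_inj (@perm_inj _ p)).
by apply: eq_bigr => i _; rewrite permM permK.
Qed.

Lemma optimal_assignment_perm z h (p s : 'S_N) :
  optimal_assignment (fun i => z (p i)) h s <-> optimal_assignment z h (p^-1 * s)%g.
Proof.
split=> opt t.
  by have := opt (p * t)%g; rewrite !assignment_cost_perm mulKg.
by rewrite !assignment_cost_perm; exact: opt.
Qed.

(* The squared norms of the [h (s i)] sum to the same value for every [s]. *)
Lemma assignment_costB z h s t :
  assignment_cost z h t - assignment_cost z h s =
  2 * \sum_i dotp (z i) (h (s i) - h (t i)).
Proof.
have E u : assignment_cost z h u = \sum_i sqnorm (z i) + \sum_i sqnorm (h i)
    - 2 * \sum_i dotp (z i) (h (u i)).
  rewrite [\sum_i sqnorm (h i)](reindex_inj (@perm_inj _ u)) mulr_sumr -big_split/= -sumrB.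
  apply: eq_bigr => i _; rewrite /sqnorm /dotp mulr_sumr -big_split/= -sumrB.
  by apply: eq_bigr => k _; rewrite !mxE; ring.
transitivity (2 * (\sum_i dotp (z i) (h (s i)) - \sum_i dotp (z i) (h (t i)))).
  by rewrite !E; ring.
rewrite -sumrB; congr (_ * _); apply: eq_bigr => i _; rewrite /dotp -sumrB.
by apply: eq_bigr => k _; rewrite !mxE mulrBr.
Qed.

Lemma measurable_assignment_cost h s :
  measurable_fun setT (fun t : N.-tuple 'rV[R]_d => assignment_cost (tnth t) h s).
Proof.
apply: measurable_sum => i; apply: measurable_sum => k.
apply: measurable_funX.
rewrite [X in measurable_fun _ X](_ : _ = fun t : N.-tuple 'rV[R]_d => tnth t i 0 k - h (s i) 0 k).
  apply: measurable_funB; last exact: measurable_cst.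
  by apply: (measurableT_comp (measurable_coord 0 k)); exact: measurable_tnth.
by apply/funext => t; rewrite !mxE.
Qed.

Lemma measurable_optimal_assignment h s :
  measurable [set t : N.-tuple 'rV[R]_d | optimal_assignment (tnth t) h s].
Proof.
rewrite (_ : [set t | _] = \bigcap_(u in [set: 'S_N])
    [set t : N.-tuple 'rV[R]_d | assignment_cost (tnth t) h s <= assignment_cost (tnth t) h u]).
  apply: fin_bigcap_measurable => [|u _]; first exact: finite_finset.
  rewrite -[X in measurable X]setTI.
  apply: (measurable_fun_ler (measurable_assignment_cost h s)
    (measurable_assignment_cost h u) measurableT (Y := [set true])) => //.
by apply/seteqP; split => t /= opt u; [move=> _|]; exact: opt.
Qed.

End assignment.

Lemma integral_finite_choice {R : realType} {disp} {T : measurableType disp}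
    (P : probability T R) (S : finType) (sigma : T -> S) (F : S -> R) :
  (forall s, measurable (sigma @^-1` [set s])) ->
  (\int[P]_w (F (sigma w))%:E = (\sum_s F s * fine (P (sigma @^-1` [set s])))%:E)%E.
Proof.
move=> msigma.
have -> : (fun w => (F (sigma w))%:E) =
    (fun w => \sum_s (F s)%:E * (\1_(sigma @^-1` [set s]) w)%:E)%E.
  apply/funext => w; rewrite (bigD1 (sigma w))//= indicE mem_set//= mule1.
  rewrite big1 ?adde0// => s sw; rewrite indicE memNset ?mule0//=.
  by move=> ws; rewrite ws eqxx in sw.
rewrite integral_sum//; last first.
  by move=> s; apply: integrableZl => //; exact: integrable_indic.
rewrite -sumEFin; apply: eq_bigr => s _.
rewrite integralZl//; last exact: integrable_indic.
by rewrite integral_indic// setIT EFinM fineK// fin_num_measure.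
Qed.

(** * Ranks as a uniform random permutation *)

Section rank_law.
Context {R : realType} {d : nat} {disp : measure_display} {T : measurableType disp}.
Context {P : probability T R} {m n : nat} {mu : probability 'rV[R]_d R}.
Context {X : 'I_m -> {RV P >-> 'rV[R]_d}} {Y : 'I_n -> {RV P >-> 'rV[R]_d}}.
Hypotheses (X_iid : iid_sample X mu) (Y_iid : iid_sample Y mu).
Hypothesis XY_indep : independent_samples X Y.
Hypothesis mu_ac : abs_continuous mu.
Local Notation N := (m + n)%N.
Variables (h : 'I_N -> 'rV[R]_d) (sigma : T -> 'S_N).
Hypothesis sigma_meas : forall s, measurable (sigma @^-1` [set s]).
Hypothesis sigma_opt : forall w, optimal_assignment
  (pooled (fun i => X i w) (fun j => Y j w)) h (sigma w).

Let Z := pooled_rv (X := X) (Y := Y).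
Let opt s : set T := [set w | optimal_assignment (fun i => Z i w) h s].
(** The vectors [h] need not be distinct: [sim] relates the assignments that give every point the
    same rank, and an optimal assignment is almost surely unique only up to it. *)
Let sim (s t : 'S_N) := [forall i : 'I_N, h (s i) == h (t i)].

Let simP (s t : 'S_N) : reflect (forall i, h (s i) = h (t i)) (sim s t).
Proof. by apply: (iffP forallP) => H i; [apply/eqP|rewrite H]. Qed.

Let optE s : opt s = pooled_tuple (X := X) (Y := Y) @^-1`
  [set t | optimal_assignment (tnth t) h s].
Proof.
apply/seteqP; split => w /= + t => /(_ t); rewrite /opt/=;
  rewrite -!(@eq_assignment_cost _ _ _ (fun i => Z i w) (tnth (pooled_tuple w)))//;
  by move=> i; rewrite tnth_mktuple.
Qed.

Let measurable_opt s : measurable (opt s).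
Proof.
rewrite optE -[X in measurable X]setTI.
by apply: measurable_pooled_tuple => //; exact: measurable_optimal_assignment.
Qed.

(** Relabelling the sample by [s] turns optimality of [s] into optimality of the identity, and
    exchangeability preserves the probability. *)
Let P_opt s : P (opt s) = P (opt 1%g).
Proof.
rewrite !optE -(pooled_tuple_exchangeable X_iid Y_iid XY_indep s); last first.
  exact: measurable_optimal_assignment.
congr (P _); apply/seteqP.
have E (t : N.-tuple 'rV[R]_d) : optimal_assignment (tnth (perm_tuple s t)) h s <->
    optimal_assignment (tnth t) h 1%g.
  rewrite -(mulVg s) -optimal_assignment_perm /optimal_assignment.
  split=> H u; have := H u; rewrite !(@eq_assignment_cost _ _ _ (tnth (perm_tuple s t))
    (fun i => tnth t (s i)))//; by move=> i; rewrite tnth_mktuple.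
by split => w /=; rewrite E.
Qed.

Let sim_opt (s : 'S_N) w : sim s (sigma w) -> opt s w.
Proof.
move=> /simP sw t; have := @sigma_opt w t.
by rewrite {1}/assignment_cost; under eq_bigr do rewrite -sw.
Qed.

Let F_sim (s : 'S_N) : (\int[P]_w (sim s (sigma w))%:R%:E = P [set w | sim s (sigma w)])%E.
Proof.
have mS : measurable [set w | sim s (sigma w)].
  rewrite (_ : [set w | _] = \bigcup_(t in [set t | sim s t]) (sigma @^-1` [set t])).
    by apply: fin_bigcup_measurable => // ; exact: finite_finset.
  by apply/seteqP; split => w /= => [ws|[t ? ->]//]; exists (sigma w).
have := @integral_indic _ _ _ P setT measurableT _ mS; rewrite setIT => <-.
apply: eq_integral => w _; rewrite indicE; case: (boolP (sim s (sigma w))) => ws.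
  by rewrite mem_set.
by rewrite memNset//=; exact/negP.
Qed.

Let no_tie (s t : 'S_N) : ~~ sim s t ->
  P [set w | \sum_i dotp (Z i w) (h (s i) - h (t i)) = 0] = 0%E.
Proof.
move=> /forallPn[i0 hst]; apply: (pooled_hyperplane X_iid Y_iid XY_indep (i0 := i0)) => //.
by rewrite subr_eq0.
Qed.

(** If [s] is optimal but gives other ranks than [sigma w], the two costs are equal. By
    [assignment_costB] this is one of finitely many linear relations between the sample points, each
    of probability zero. *)
Let P_opt_sim (s : 'S_N) : P (opt s) = P [set w | sim s (sigma w)].
Proof.
have mS : measurable [set w | sim s (sigma w)].
  rewrite (_ : [set w | _] = \bigcup_(t in [set t | sim s t]) (sigma @^-1` [set t])).
    by apply: fin_bigcup_measurable => // ; exact: finite_finset.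
  by apply/seteqP; split => w /= => [ws|[t ? ->]//]; exists (sigma w).
rewrite (@measureDI _ _ _ P _ [set w | sim s (sigma w)])//.
rewrite [X in (_ + P X)%E](_ : _ = [set w | sim s (sigma w)]); last first.
  by apply/seteqP; split => w /= => [[]//|ws]; split => //; exact: sim_opt.
rewrite measure_negligible ?add0e//; first exact: measurableD.
pose tie (t : 'S_N) := [set w | \sum_i dotp (Z i w) (h (s i) - h (t i)) = 0].
apply: (@negligibleS _ _ _ _ (\big[setU/set0]_(t : 'S_N | ~~ sim s t) tie t)).
  move=> w /= [sopt /negP nsim]; rewrite -bigcup_seq_cond.
  exists (sigma w) => /=; first by rewrite mem_index_enum.
  have : assignment_cost (fun i => Z i w) h (sigma w) -
      assignment_cost (fun i => Z i w) h s = 0.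
    by apply/eqP; rewrite subr_eq0 eq_le sopt andbT; exact: sigma_opt.
  rewrite assignment_costB => /eqP; rewrite mulf_eq0 pnatr_eq0 /= => /eqP.
  exact.
elim/big_ind : _ => [|A B nA nB|t st]; first exact: negligible_set0.
  exact: negligibleU.
have mtie : measurable (tie t).
  rewrite /tie -[X in measurable X]setTI.
  have mf : measurable_fun setT (fun w => \sum_i dotp (Z i w) (h (s i) - h (t i))).
    apply: measurable_sum => i; apply: (measurableT_comp (measurable_dotp _)).
    exact: measurable_pooled_rv.
  exact: (mf measurableT [set 0]).
by apply/negligibleP => //; exact: no_tie.
Qed.

(** Ties between the [h] may be broken arbitrarily by [sigma], so only its [sim] class is uniform.
    Double counting the pairs [sim s t] gives [e * \sum_s F s] as [K] times the mean of
    [F (sigma w)], where every class has probability [e] and [K] elements. The case [F = 1] gives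
    [e * N! = K]. *)
Lemma mean_ranks (F : 'S_N -> R) :
  (forall s t : 'S_N, (forall i, h (s i) = h (t i)) -> F s = F t) ->
  (\int[P]_w (F (sigma w))%:E = (perm_mean F)%:E)%E.
Proof.
move=> Fh; rewrite integral_finite_choice//; congr (_%:E).
pose p (t : 'S_N) := fine (P (sigma @^-1` [set t])); pose e := fine (P (opt 1%g)).
pose K := \sum_(s : 'S_N) (sim s 1%g)%:R : R.
have eE (s : 'S_N) : \sum_(t : 'S_N) (sim s t)%:R * p t = e.
  have := F_sim s; rewrite -P_opt_sim P_opt.
  by rewrite (@integral_finite_choice _ _ _ P _ sigma (fun t => (sim s t)%:R))// => /(congr1 fine).
have KE (t : 'S_N) : \sum_(s : 'S_N) (sim s t)%:R = K.
  rewrite (reindex_inj (mulgI t)); apply: eq_bigr => s _.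
  rewrite (_ : sim (t * s)%g t = sim s 1%g)//.
  apply/simP/simP => H i; last by have := H (t i); rewrite permM perm1.
  by have := H (t^-1 i)%g; rewrite permM permKV perm1.
have swapE (G : 'S_N -> R) : (forall s t : 'S_N, (forall i, h (s i) = h (t i)) -> G s = G t) ->
    e * \sum_(s : 'S_N) G s = K * \sum_(t : 'S_N) G t * p t.
  move=> Gh; transitivity (\sum_(s : 'S_N) \sum_(t : 'S_N) G t * p t * (sim s t)%:R).
    rewrite mulr_sumr; apply: eq_bigr => s _; rewrite -(eE s) mulr_suml.
    apply: eq_bigr => t _; case: (boolP (sim s t)) => [/simP st|_].
      by rewrite (Gh _ _ st) mul1r mulr1 mulrC.
    by rewrite !(mul0r, mulr0).
  rewrite exchange_big/= mulr_sumr; apply: eq_bigr => t _.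
  by rewrite -mulr_sumr KE mulrC.
have pS : \sum_(t : 'S_N) p t = 1.
  have := @integral_finite_choice _ _ _ P _ sigma (fun=> 1 : R) sigma_meas.
  rewrite integral_cst//= probability_setT mule1 => -[->].
  by apply: eq_bigr => t _; rewrite mul1r.
have K0 : 0 < K.
  rewrite /K (bigD1 1%g)//= (_ : sim 1%g 1%g); last exact/simP.
  by rewrite ltr_pwDl// sumr_ge0.
have eK : e * N`!%:R = K.
  have := swapE (fun=> 1) (fun _ _ _ => erefl).
  under [in RHS]eq_bigr do rewrite mul1r.
  by rewrite pS mulr1 sumr_const card_Sn.
have N0 : N`!%:R != 0 :> R by rewrite pnatr_eq0 -lt0n fact_gt0.
apply: (mulfI (lt0r_neq0 K0)); rewrite -swapE// /perm_mean -eK.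
by rewrite -mulrA mulVKf.
Qed.

End rank_law.

(** * Moments of the scores *)

Section inf_convolution.
Context {R : realType} {V : normedModType R}.
Variable F : V -> R.
Hypothesis F0 : forall x, 0 <= F x.

(** The Pasch-Hausdorff regularization: the greatest [k]-Lipschitz minorant of [F] truncated at [k].
    It turns a function that is continuous only almost everywhere into admissible test functions for
    [weak_cvg]. *)
Definition inf_conv (k : nat) (x : V) : R :=
  inf [set Num.min (F y) k%:R + k%:R * `|x - y| | y in [set: V]].

Let S k x := [set Num.min (F y) k%:R + k%:R * `|x - y| | y in [set: V]].

Let S0 k x : lbound (S k x) 0.
Proof. by move=> _ [y _ <-]; rewrite addr_ge0 ?mulr_ge0// le_min F0/=. Qed.

Let S_inf k x : has_inf (S k x).
Proof. by split; [exists (Num.min (F x) k%:R + k%:R * `|x - x|); exists x|exists 0; exact: S0]. Qed.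

Let S_ne k x : S k x !=set0. Proof. by have [] := S_inf k x. Qed.

Lemma inf_conv_ge0 k x : 0 <= inf_conv k x.
Proof. by apply: lb_le_inf; [exact: S_ne|exact: S0]. Qed.

Lemma inf_conv_le k x y : inf_conv k x <= Num.min (F y) k%:R + k%:R * `|x - y|.
Proof. by apply: ge_inf; [have [] := S_inf k x|exists y]. Qed.

Lemma inf_conv_le_min k x : inf_conv k x <= Num.min (F x) k%:R.
Proof. by rewrite (le_trans (inf_conv_le _ _ x))// subrr normr0 mulr0 addr0. Qed.

Lemma inf_conv_le_fun k x : inf_conv k x <= F x.
Proof. by rewrite (le_trans (inf_conv_le_min _ _))// ge_min lexx. Qed.

Lemma inf_conv_le_nat k x : inf_conv k x <= k%:R.
Proof. by rewrite (le_trans (inf_conv_le_min _ _))// ge_min lexx orbT. Qed.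

Lemma inf_conv_lipschitz k x y : inf_conv k x <= inf_conv k y + k%:R * `|x - y|.
Proof.
rewrite -lerBlDr; apply: lb_le_inf; first exact: S_ne.
move=> _ [z _ <-]; rewrite lerBlDr (le_trans (inf_conv_le _ _ z))//.
rewrite -addrA lerD2l -mulrDr ler_wpM2l// [leRHS]addrC.
by rewrite (le_trans _ (ler_normD _ _))// addrA subrK.
Qed.

Lemma continuous_inf_conv k : continuous (inf_conv k).
Proof.
move=> x; apply/cvgrPdist_le => e e0.
near=> y.
have xy : k%:R * `|x - y| <= e.
  apply: (@le_trans _ _ (k%:R * (e / k.+1%:R))).
    rewrite ler_wpM2l//; near: y.
    by apply: cvgr_dist_le; rewrite ?divr_gt0//; exact: cvg_id.
  rewrite mulrCA -[leRHS]mulr1 ler_wpM2l ?(ltW e0)//.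
  by rewrite ler_pdivrMr// mul1r ler_nat.
have h1 := inf_conv_lipschitz k x y; have h2 := inf_conv_lipschitz k y x.
rewrite distrC in h2; rewrite ler_norml; apply/andP; split; lra.
Unshelve. all: by end_near. Qed.

Lemma inf_conv_nondecreasing x : nondecreasing_seq (inf_conv ^~ x).
Proof.
apply/nondecreasing_seqP => k; apply: lb_le_inf; first exact: S_ne.
move=> _ [y _ <-]; apply: (le_trans (inf_conv_le _ _ y)).
apply: lerD; last by rewrite ler_wpM2r// ler_nat.
by rewrite le_min ge_min lexx/= ge_min ler_nat leqnSn orbT.
Qed.

Lemma inf_conv_cvg x : {for x, continuous F} -> inf_conv k x @[k --> \oo] --> F x.
Proof.
move=> /cvgrPdist_lt cF; apply/cvgrPdist_le => e e0.
have /nbhs_normP[r /= r0 rF] := cF e e0.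
near=> k.
have Fk : F x <= k%:R by near: k; exact: nbhs_infty_ger.
have Fkr : F x <= k%:R * r.
  by rewrite -ler_pdivrMr//; near: k; exact: nbhs_infty_ger.
have : F x - e <= inf_conv k x.
  apply: lb_le_inf; first exact: S_ne.
  move=> _ [y _ <-].
  (* Within distance [r] of [x] continuity bounds [F y] from below; beyond it the penalty alone is
     at least [k * r >= F x]. *)
  have [xy|xy] := ltP `|x - y| r.
    have := rF y xy; rewrite /= ltr_norml => /andP[_ Fxy].
    apply: ler_wpDr; first exact: mulr_ge0.
    by rewrite le_min; apply/andP; split; lra.
  rewrite ler_wpDl ?le_min ?F0//=.
  by rewrite (le_trans _ (ler_wpM2l _ xy))// lerBlDr (le_trans Fkr)// lerDl ltW.
have := inf_conv_le_fun k x => h1 h2; rewrite ger0_norm; lra.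
Unshelve. all: by end_near. Qed.

End inf_convolution.

Lemma integral_empirical {R : realType} {d N : nat} (h : 'I_N -> 'rV[R]_d)
    (f : 'rV[R]_d -> R) :
  measurable_fun setT f -> (forall x, 0 <= f x) ->
  (\int[empirical_measure h]_x (f x)%:E = (N%:R^-1 * \sum_i f (h i))%:E)%E.
Proof.
move=> mf f0.
have N0 : 0 <= N%:R^-1 :> R by rewrite invr_ge0.
(* [msum] takes a sequence indexed by [nat]; the default value [0] lies beyond the [N] terms that
   are summed. *)
pose hN (i : nat) : 'rV[R]_d := if insub i is Some j then h j else 0.
pose mu := mscale (NngNum N0) (msum (fun i => \d_(hN i)) N).
have muE : empirical_measure h = mu.
  apply/funext => A; rewrite /mu /mscale/= /msum /empirical_measure; congr (_ * _)%E.
  by apply: eq_bigr => i _; rewrite /hN valK.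
have mfE : measurable_fun setT (EFin \o f) by exact/measurable_EFinP.
rewrite muE ge0_integral_mscale//=; last by move=> x _; rewrite lee_fin.
rewrite ge0_integral_measure_sum//; last by move=> x _; rewrite lee_fin.
rewrite EFinM -sumEFin; congr (_ * _)%E; apply: eq_bigr => i _.
by rewrite integral_dirac// diracT mul1e /hN valK.
Qed.

Lemma measure_eq_negligible {R : realType} {d} {T : measurableType d}
    (mu : {measure set T -> \bar R}) (A B N : set T) :
  measurable A -> measurable B -> mu.-negligible N ->
  A `\` B `<=` N -> B `\` A `<=` N -> mu A = mu B.
Proof.
move=> mA mB nN AB BA.
have D0 C D : measurable C -> measurable D -> C `\` D `<=` N -> mu (C `\` D) = 0%E.
  move=> mC mD CD; apply: measure_negligible; first exact: measurableD.
  exact: negligibleS nN.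
have mI C D : measurable C -> measurable D -> C `\` D `<=` N -> mu C = mu (C `&` D).
  move=> mC mD CD; rewrite (@measureDI _ _ _ mu C D)//.
  by have := D0 _ _ mC mD CD => /= ->; rewrite add0e.
by rewrite (mI A B)// (mI B A)// setIC.
Qed.

Section score.
Context {R : realType} {d : nat}.
Local Notation V := 'rV[R]_d.+1.
Variables (nu : probability V R) (J : V -> V) (D0 : set V).
Hypotheses (mD0 : measurable D0) (D0_null : nu D0 = 0%E).
Hypothesis J_cont : forall z, ~ D0 z -> {for z, continuous J}.

(* [J] itself need not be Borel: it is modified on the null set [D0]. *)
Definition regularized (z : V) : V := if z \in D0 then 0 else J z.

Lemma regularizedE z : ~ D0 z -> regularized z = J z.
Proof. by move=> zD; rewrite /regularized memNset. Qed.

(** Off [D0] the preimage of an open set under [J] is a neighbourhood of each of its points, so it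
    may be replaced by its interior. *)
Lemma measurable_regularized : measurable_fun setT regularized.
Proof.
apply: (@measurability _ _ _ V _ _ (open : set (set V))) => //.
move=> _ [U oU <-]; rewrite setTI.
have -> : regularized @^-1` U = (D0 `&` [set z | U 0]) `|` ((J @^-1` U)^° `\` D0).
  apply/seteqP; split => z /=.
    rewrite /regularized; case: ifPn => [|]; rewrite ?inE ?notin_setE => zD Uz; first by left.
    by right; split => //; apply: (J_cont zD); exact: open_nbhs_nbhs.
  move=> [[zD U0]|[zJ zD]]; first by rewrite /regularized mem_set.
  by rewrite regularizedE//; exact: interior_subset zJ.
apply: measurableU.
  apply: measurableI => //; have [U0|U0] := pselect (U 0).
    by rewrite (_ : [set z | _] = setT)//; apply/seteqP; split.
  by rewrite (_ : [set z | _] = set0)//; apply/seteqP; split.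
by apply: measurableD => //; apply: open_measurable_mx; exact: open_interior.
Qed.

Lemma image_measure_regularized (rho : probability V R) :
  is_image_measure J nu rho ->
  forall A, measurable A -> rho A = nu (regularized @^-1` A).
Proof.
move=> rhoE A mA; have [B [mB nB ->]] := rhoE A mA.
have mr : measurable (regularized @^-1` A).
  by rewrite -[X in measurable X]setTI; exact: measurable_regularized.
have nD0 : nu.-negligible D0 by exists D0; split.
apply: (measure_eq_negligible mB mr (negligibleU nB nD0)) => z [/= Bz nz].
  have [zD|zD] := pselect (D0 z); first by right.
  by left; right; split => // Jz; apply: nz; rewrite regularizedE.
have [zD|zD] := pselect (D0 z); first by right.
by left; left; split => //; move: Bz; rewrite regularizedE.
Qed.

Import HBNNSimple.

(* No measurability is assumed of [f]: the integral of a nonnegative function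
   is a supremum over simple minorants. *)
Lemma le_integral_regularized (f g : V -> R) :
  (forall z, 0 <= f z) -> measurable_fun setT g -> (forall z, 0 <= g z) ->
  (forall z, ~ D0 z -> f z <= g z) ->
  (\int[nu]_z (f z)%:E <= \int[nu]_z (g z)%:E)%E.
Proof.
move=> f0 mg g0 fg.
rewrite ge0_integralTE; last by move=> z; rewrite lee_fin.
apply: ge_ereal_sup => _ [k kf <-].
rewrite -integralT_nnsfun.
apply: ae_ge0_le_integral => //.
- by move=> z _; rewrite lee_fin fun_ge0.
- exact/measurable_EFinP.
- by move=> z _; rewrite lee_fin.
- exact/measurable_EFinP.
exists D0; split => // z /= h; apply: contrapT => zD; apply: h => _.
by rewrite (le_trans (kf z))// lee_fin fg.
Qed.

End score.

Section score_limits.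
Context {R : realType} {d : nat}.
Local Notation V := 'rV[R]_d.+1.
Variables (nu rho : probability V R) (J : V -> V) (D0 : set V).
Hypotheses (mD0 : measurable D0) (D0_null : nu D0 = 0%E).
Hypothesis J_cont : forall z, ~ D0 z -> {for z, continuous J}.
Hypothesis rhoE : is_image_measure J nu rho.
Variable h : forall N : nat, 'I_N -> V.

Lemma integral_image_measure (g : V -> R) :
  measurable_fun setT g -> (forall z, 0 <= g z) ->
  (\int[rho]_z (g z)%:E = \int[nu]_z (g (regularized J D0 z))%:E)%E.
Proof.
move=> mg g0; have mJ := measurable_regularized mD0 J_cont.
rewrite (eq_measure_integral (pushforward nu (regularized J D0))); last first.
  by move=> A mA _; exact: (image_measure_regularized mD0 D0_null J_cont rhoE).
rewrite ge0_integral_pushforward//.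
- by exact/measurable_EFinP.
- by move=> z _; rewrite lee_fin.
Qed.

(* A Fatou lemma: [inf_conv (g \o J) k] is bounded, continuous, and increases
   to [g \o J] at the points of continuity of [J]. *)
Lemma mean_score_gt (g : V -> R) (c : R) :
  weak_cvg (fun N => empirical_measure (@h N)) nu ->
  continuous g -> (forall z, 0 <= g z) -> (c%:E < \int[rho]_z (g z)%:E)%E ->
  \forall N \near \oo, c < N%:R^-1 * \sum_(i < N) g (J (h i)).
Proof.
move=> h_cvg cg g0 cint; have mJ := measurable_regularized mD0 J_cont.
have mg : measurable_fun setT g by exact: continuous_measurable_mx.
pose F := g \o J; have F0 z : 0 <= F z by exact: g0.
have mF k : measurable_fun setT (inf_conv F k).
  by apply: continuous_measurable_mx; exact: continuous_inf_conv.
have mFE k : measurable_fun setT (fun z => (inf_conv F k z)%:E) by exact/measurable_EFinP.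
(* Monotonicity makes this limit exist everywhere, possibly infinite, and it is measurable. It is
   identified with [g \o J] only off [D0], which is enough for integrals. *)
pose L z := limn (fun k => (inf_conv F k z)%:E).
have Fnd z : nondecreasing_seq (fun k => (inf_conv F k z)%:E).
  by move=> k l kl; rewrite lee_fin; exact: inf_conv_nondecreasing.
have Fcvg z : (inf_conv F k z)%:E @[k --> \oo] --> L z.
  exact: ereal_nondecreasing_is_cvgn.
have mL : measurable_fun setT L by apply: (emeasurable_fun_cvg (fun k z => (inf_conv F k z)%:E)).
have L0 z : (0 <= L z)%E.
  by apply: lime_ge; [exact: Fcvg|apply: nearW => k; rewrite lee_fin inf_conv_ge0].
have intL : (\int[nu]_z L z = \int[rho]_z (g z)%:E)%E.
  rewrite integral_image_measure//; apply: ge0_ae_eq_integral => //.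
  - by apply/measurable_EFinP; exact: measurableT_comp.
  - by move=> z _; rewrite lee_fin.
  exists D0; split => // z /= nL; apply: contrapT => zD; apply: nL => _.
  rewrite regularizedE//; apply/cvg_lim => //.
  apply: cvg_EFin; first exact: nearW.
  by apply: (inf_conv_cvg F0); apply: continuous_comp; [exact: J_cont|exact: cg].
have intcvg : (\int[nu]_z (inf_conv F k z)%:E @[k --> \oo] --> \int[rho]_z (g z)%:E)%E.
  rewrite -intL; apply: cvg_monotone_convergence => //.
  by move=> k z _; rewrite lee_fin inf_conv_ge0.
have [k ck] : exists k, (c%:E < \int[nu]_z (inf_conv F k z)%:E)%E.
  have [K _ HK] := intcvg _ (open_ereal_gt' cint).
  by exists K; exact: (HK K (leqnn K)).
have bF : exists M, forall z, `|inf_conv F k z| <= M.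
  by exists k%:R => z; rewrite ger0_norm ?inf_conv_ge0// inf_conv_le_nat.
have := h_cvg (inf_conv F k) (@continuous_inf_conv _ _ F F0 k) bF _ (open_ereal_gt' ck).
move=> [K _ HK]; exists K => [//|N /= KN].
have := HK N KN; rewrite /= integral_empirical//; last by move=> z; exact: inf_conv_ge0.
rewrite lte_fin => /lt_le_trans; apply; rewrite ler_wpM2l ?invr_ge0// ler_sum// => i _.
exact: inf_conv_le_fun.
Qed.

Lemma limsup_mean_sqnorm (q : V -> R) :
  measurable_fun setT q -> (forall z, 0 <= q z) ->
  (limn_esup (fun N => (N%:R^-1 * \sum_(i < N) q (J (h i)))%:E) <=
     \int[nu]_z (q (J z))%:E)%E ->
  (limn_esup (fun N => (N%:R^-1 * \sum_(i < N) q (J (h i)))%:E) <=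
     \int[rho]_z (q z)%:E)%E.
Proof.
move=> mq q0 /le_trans; apply; rewrite integral_image_measure//.
apply: (le_integral_regularized mD0 D0_null) => //.
  by apply: measurableT_comp => //; exact: measurable_regularized.
by move=> z zD; rewrite regularizedE.
Qed.

End score_limits.

Lemma limn_esup_near_lt {R : realType} (u : nat -> R) (M e : R) : 0 < e ->
  (limn_esup (fun n => (u n)%:E) <= M%:E)%E -> \forall n \near \oo, u n < M + e.
Proof.
move=> e0 uM; set v := fun n => (u n)%:E.
have vcvg : esups v @ \oo --> limn_esup v.
  by rewrite limn_esup_lim; exact: is_cvg_esups.
have lt : (limn_esup v < (M + e)%:E)%E by rewrite (le_lt_trans uM)// lte_fin ltrDl.
have [K _ HK] := vcvg _ (open_ereal_lt' lt); exists K => [//|n /= Kn].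
rewrite -lte_fin; apply: le_lt_trans (HK n Kn).
by apply: ereal_sup_ubound; exists n => /=.
Qed.

Lemma continuous_sqnorm {R : realType} {d : nat} : continuous (@sqnorm R d).
Proof.
apply: (@continuous_big _ _ +%R 0 xpredT add_continuous _ _
  (fun i (y : 'rV[R]_d) => y 0 i ^+ 2)) => i _ x.
rewrite (_ : (fun y : 'rV[R]_d => y 0 i ^+ 2) = fun y => y 0 i * y 0 i).
  have c := @coord_continuous R 1 d 0 i x. exact: (continuousM c c).
by apply/funext => y; rewrite expr2.
Qed.

(** * Convergence of the means of functions of quadratic growth *)

Section moments.
Context {R : realType} {d : nat}.
Local Notation V := 'rV[R]_d.+1.
Variables (rho : probability V R) (a : forall N : nat, 'I_N -> V).
Let mean (u : V -> R) N : R := N%:R^-1 * \sum_(i < N) u (a i).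

Hypothesis rho_cov : has_finite_covariance rho.
Hypothesis mean_gt : forall (g : V -> R) (c : R), continuous g -> (forall z, 0 <= g z) ->
  (c%:E < \int[rho]_z (g z)%:E)%E -> \forall N \near \oo, c < mean g N.
Hypothesis mean_limsup :
  (limn_esup (fun N => (mean sqnorm N)%:E) <= \int[rho]_z (sqnorm z)%:E)%E.

Lemma integrable_coord_mul p q :
  rho.-integrable setT (EFin \o (fun z : V => z 0 p * z 0 q)).
Proof. by apply/Lfun1_integrable; exact: Lfun2_mul_Lfun1 (rho_cov p) (rho_cov q). Qed.

Lemma integrable_sqnorm : rho.-integrable setT (EFin \o (@sqnorm R d.+1)).
Proof.
rewrite (_ : _ \o _ = fun z : V => \sum_(p < d.+1) (z 0 p * z 0 p)%:E)%E; last first.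
  by apply/funext => z; rewrite sumEFin /= /sqnorm; congr (_%:E); apply: eq_bigr => p _; rewrite expr2.
by apply: integrable_sum => // p _; exact: integrable_coord_mul.
Qed.

Let integrable_1q : rho.-integrable setT (EFin \o (fun z : V => 1 + sqnorm z)).
Proof.
rewrite (_ : _ \o _ = (EFin \o cst 1%R) \+ (EFin \o (@sqnorm R d.+1)))%E//.
by apply: integrableD => //; [exact: finite_measure_integrable_cst|exact: integrable_sqnorm].
Qed.

Lemma integrable_quadratic (u : V -> R) : continuous u ->
  (forall z, `|u z| <= 1 + sqnorm z) -> rho.-integrable setT (EFin \o u).
Proof.
move=> cu uq; apply: (le_integrable _ _ _ integrable_1q) => //.
  by apply/measurable_EFinP; exact: continuous_measurable_mx.
by move=> z _ /=; rewrite lee_fin (le_trans (uq z))// ler_norm.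
Qed.

Let meanD u v N : mean (fun z => u z + v z) N = mean u N + mean v N.
Proof. by rewrite /mean big_split/= mulrDr. Qed.

Let mean_1q N : (0 < N)%N -> mean (fun z => 1 + sqnorm z) N = 1 + mean sqnorm N.
Proof.
move=> N0; rewrite meanD; congr (_ + _).
by rewrite /mean sumr_const card_ord mulVf// pnatr_eq0 -lt0n.
Qed.

(** The domination makes [1 + sqnorm z + u z] nonnegative, so the Fatou bound [mean_gt] applies to
    it; the upper bound on the means of [sqnorm] then isolates [u]. *)
Let mean_liminf (u : V -> R) (e : R) : 0 < e -> continuous u ->
  (forall z, `|u z| <= 1 + sqnorm z) ->
  \forall N \near \oo, \int[rho]_z u z - e < mean u N.
Proof.
move=> e0 cu uq; have iu := integrable_quadratic cu uq.
have e20 : 0 < e / 2 by lra.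
pose g z := 1 + sqnorm z + u z.
have cg : continuous g.
  move=> z; have c1 : {for z, continuous (fun _ : V => 1 : R)} by exact: cst_continuous.
  have cq : {for z, continuous (@sqnorm R d.+1)} by exact: continuous_sqnorm.
  have c2 : {for z, continuous (fun y : V => 1 + sqnorm y)} by exact: (continuousD c1 cq).
  exact: (continuousD c2 (cu z)).
have g0 z : 0 <= g z.
  by have := uq z; rewrite ler_norml => /andP[h _]; rewrite /g; lra.
have ig : rho.-integrable setT (EFin \o g).
  rewrite (_ : _ \o _ = (EFin \o (fun z : V => 1 + sqnorm z)%R) \+ (EFin \o u))%E//.
  exact: integrableD.
have gE : \int[rho]_z g z = 1 + \int[rho]_z sqnorm z + \int[rho]_z u z.
  rewrite RintegralD// RintegralD//.
  - by rewrite Rintegral_cst//= probability_setT/= mulr1.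
  - exact: finite_measure_integrable_cst.
  - exact: integrable_sqnorm.
have ig_lt : ((\int[rho]_z g z - e / 2)%:E < \int[rho]_z (g z)%:E)%E.
  have gfin := integrable_fin_num measurableT ig.
  by rewrite -(fineK gfin) lte_fin ltrBlDr ltrDl.
have qle : (limn_esup (fun N => (mean sqnorm N)%:E) <= (\int[rho]_z sqnorm z)%:E)%E.
  have qfin := integrable_fin_num measurableT integrable_sqnorm.
  by rewrite /Rintegral fineK.
near=> N.
have N0 : (0 < N)%N by near: N; exact: nbhs_infty_gt.
have h1 : mean sqnorm N < \int[rho]_z sqnorm z + e / 2.
  by near: N; exact: (limn_esup_near_lt e20 qle).
have h2 : \int[rho]_z g z - e / 2 < mean g N by near: N; exact: (mean_gt cg g0 ig_lt).
move: h2; rewrite gE meanD mean_1q//; lra.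
Unshelve. all: by end_near. Qed.

(** The lower bound for [- u] is the upper bound for [u]. *)
Lemma mean_cvg (u : V -> R) : continuous u -> (forall z, `|u z| <= 1 + sqnorm z) ->
  mean u N @[N --> \oo] --> \int[rho]_z u z.
Proof.
move=> cu uq; apply/cvgrPdist_lt => e e0; near=> N.
have h1 : \int[rho]_z u z - e < mean u N by near: N; exact: mean_liminf.
have h2 : \int[rho]_z (- u z) - e < mean (fun z => - u z) N.
  near: N; apply: mean_liminf => //; first by move=> z; exact: (continuousN (cu z)).
  by move=> z; rewrite normrN.
have E1 : \int[rho]_z (- u z) = - \int[rho]_z u z.
  under eq_Rintegral do rewrite -mulN1r.
  by rewrite RintegralZl ?mulN1r//; exact: integrable_quadratic.
have E2 : mean (fun z => - u z) N = - mean u N by rewrite /mean sumrN mulrN.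
move: h2; rewrite E1 E2 ltr_norml => h2; apply/andP; split; lra.
Unshelve. all: by end_near. Qed.

End moments.

(** * Empirical covariance and largest score *)

Section population.
Context {R : realType} {d : nat}.
Local Notation V := 'rV[R]_d.+1.
Variables (rho : probability V R) (a : forall N : nat, 'I_N -> V).
Let mean (u : V -> R) N : R := N%:R^-1 * \sum_(i < N) u (a i).

Hypothesis rho_cov : has_finite_covariance rho.
Hypothesis mean_cvg : forall u : V -> R, continuous u ->
  (forall z, `|u z| <= 1 + sqnorm z) -> mean u N @[N --> \oo] --> \int[rho]_z u z.

Let cvg_coord p : mean (fun z => z 0 p) N @[N --> \oo] --> \int[rho]_z z 0 p.
Proof.
apply: mean_cvg => [z|z]; first by apply: coord_continuous.
have := sqr_coord_le_sqnorm z p; have := sqr_ge0 (z 0 p - 1); have := sqr_ge0 (z 0 p + 1).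
by rewrite ler_norml => *; apply/andP; split; nra.
Qed.

Let cvg_coord_mul p q :
  mean (fun z => z 0 p * z 0 q) N @[N --> \oo] --> \int[rho]_z (z 0 p * z 0 q).
Proof.
apply: mean_cvg => [z|z].
  exact: (continuousM (@coord_continuous _ _ _ 0 p z) (@coord_continuous _ _ _ 0 q z)).
by rewrite (le_trans (coord_mul_le_sqnorm z p q))// lerDr.
Qed.

Lemma covariance_mxE p q : covariance_mx rho p q =
  \int[rho]_z (z 0 p * z 0 q) - (\int[rho]_z z 0 p) * (\int[rho]_z z 0 q).
Proof.
have rT : rho setT \is a fin_num by rewrite probability_setT.
have L1 i : (fun z : V => z 0 i) \in Lfun rho 1 by exact: (Lfun_subset12 rT (rho_cov i)).
rewrite mxE covarianceE//; last exact: Lfun2_mul_Lfun1 (rho_cov p) (rho_cov q).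
have pq1 : (fun z : V => z 0 p * z 0 q) \in Lfun rho 1.
  exact: Lfun2_mul_Lfun1 (rho_cov p) (rho_cov q).
rewrite fineB ?fin_numM ?expectation_fin_num//.
by rewrite fineM ?expectation_fin_num// unlock.
Qed.

Lemma covariance_mxT : (covariance_mx rho)^T = covariance_mx rho.
Proof. by apply/matrixP => p q; rewrite mxE !mxE covarianceC. Qed.

Lemma mean_centeredE p q N :
  N%:R^-1 * (\sum_(i < N) centered (@a N) i 0 p * centered (@a N) i 0 q) =
  mean (fun z => z 0 p * z 0 q) N - mean (fun z => z 0 p) N * mean (fun z => z 0 q) N.
Proof.
case: (posnP N) => [->|N0].
  by rewrite /mean !big_ord0 !mulr0 subr0.
have NR : N%:R != 0 :> R by rewrite pnatr_eq0 -lt0n.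
pose mp := mean (fun z => z 0 p) N; pose mq := mean (fun z => z 0 q) N.
have cE r i : centered (@a N) i 0 r = a i 0 r - mean (fun z => z 0 r) N.
  by rewrite /centered !mxE summxE.
have mE r : \sum_(i < N) a i 0 r = N%:R * mean (fun z => z 0 r) N.
  by rewrite /mean mulVKf.
have gen (x y : 'I_N -> R) (al be : R) : \sum_i (x i - al) * (y i - be) =
    \sum_i x i * y i - be * \sum_i x i - al * \sum_i y i + N%:R * (al * be).
  transitivity (\sum_i (x i * y i - be * x i - al * y i + al * be)).
    by apply: eq_bigr => i _; ring.
  by rewrite big_split/= sumr_const card_ord !sumrB !mulr_sumr mulr_natl.
under eq_bigr do rewrite !cE.
by rewrite gen !mE -/mp -/mq [mean (fun z => z 0 p * z 0 q) N]/mean; field.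
Qed.

Lemma mean_centered_cvg p q :
  N%:R^-1 * (\sum_(i < N) centered (@a N) i 0 p * centered (@a N) i 0 q)
    @[N --> \oo] --> covariance_mx rho p q.
Proof.
rewrite covariance_mxE.
have H := cvgB (@cvg_coord_mul p q) (cvgM (@cvg_coord p) (@cvg_coord q)).
under eq_cvg do rewrite mean_centeredE.
exact: H.
Qed.

Let excess (K : nat) (z : V) : R := Num.max (sqnorm z - K%:R) 0.

Let continuous_excess K : continuous (excess K).
Proof.
move=> z; have cq : {for z, continuous (fun y : V => sqnorm y - K%:R)}.
  by apply: (@continuousB _ _ _ (@sqnorm R d.+1) (fun=> K%:R)); [exact: continuous_sqnorm|exact: cst_continuous].
exact: (continuous_max cq (@cst_continuous _ _ (0 : R) z)).
Qed.

Let excess_ge0 K z : 0 <= excess K z.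
Proof. by rewrite le_max lexx orbT. Qed.

Let excess_le K z : `|excess K z| <= 1 + sqnorm z.
Proof.
rewrite ger0_norm// ge_max; have := sqnorm_ge0 z; have : 0 <= K%:R :> R by [].
by move=> *; apply/andP; split; lra.
Qed.

Let excess_cvg0 : \int[rho]_z excess K z @[K --> \oo] --> (0 : R).
Proof.
have iq := integrable_sqnorm rho_cov.
have : (\int[rho]_z (excess K z)%:E @[K --> \oo] --> \int[rho]_z (0%R : R)%:E)%E.
  apply: (@dominated_cvg _ _ _ rho setT measurableT (fun K z => (excess K z)%:E) _
    (EFin \o (@sqnorm R d.+1))) => //.
  - by move=> K; apply/measurable_EFinP; apply: continuous_measurable_mx; exact: continuous_excess.
  - move=> z _; apply: cvg_near_cst; near=> K; congr (_%:E); apply/max_idPr.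
    rewrite subr_le0; near: K; exact: nbhs_infty_ger.
  - move=> K z _; rewrite /= lee_fin ger0_norm// ge_max sqnorm_ge0 andbT.
    by rewrite gerBl.
rewrite integral0 => /fine_cvgP[_]; exact.
Unshelve. all: by end_near. Qed.

Let max_sqnorm N : R := \big[Num.max/0]_(i < N) sqnorm (a i).

(** The maximum is at most [K] plus the sum of all excesses over [K]. First [K] is fixed so that the
    [rho]-mean of the excess is below [e / 3], then [N] is taken large. *)
Lemma max_sqnorm_cvg : max_sqnorm N / N%:R @[N --> \oo] --> (0 : R).
Proof.
have M0 N : 0 <= max_sqnorm N.
  by rewrite /max_sqnorm; elim/big_ind : _ => // [x y x0 y0|i _]; [rewrite le_max x0|exact: sqnorm_ge0].
apply/cvgrPdist_lt => e e0.
have e30 : 0 < e / 3 by lra.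
have /cvgrPdist_lt H := excess_cvg0; have [K _ HK] := H _ e30.
have := HK K (leqnn K); rewrite /= sub0r normrN ger0_norm; last exact: Rintegral_ge0.
move=> eK.
have mK : mean (excess K) N @[N --> \oo] --> \int[rho]_z excess K z by exact: mean_cvg.
have hlt : \int[rho]_z excess K z < \int[rho]_z excess K z + e / 3 by rewrite ltrDl.
near=> N.
have NR : 0 < N%:R :> R by rewrite ltr0n; near: N; exact: nbhs_infty_gt.
have h1 : mean (excess K) N < \int[rho]_z excess K z + e / 3.
  near: N; exact: (cvgr_lt (\int[rho]_z excess K z) mK).
have h2 : K%:R / N%:R <= e / 3 :> R.
  rewrite ler_pdivrMr// mulrC -ler_pdivrMr//.
  near: N; exact: nbhs_infty_ger.
rewrite sub0r normrN ger0_norm ?divr_ge0//.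
have h3 : max_sqnorm N / N%:R <= K%:R / N%:R + mean (excess K) N.
  rewrite /mean [_^-1 * _]mulrC -mulrDl ler_wpM2r ?invr_ge0//.
  apply: bigmax_le => [|i _].
    by rewrite addr_ge0// sumr_ge0// => i _; exact: excess_ge0.
  rewrite (bigD1 i)//= (@le_trans _ _ (K%:R + excess K (a i)))//.
    by rewrite /excess -lerBlDl le_max lexx.
  by rewrite lerD2l lerDl sumr_ge0.
lra.
Unshelve. all: by end_near. Qed.

Let spread N : R := 2 * (max_sqnorm N / N%:R + (\sum_p mean (fun z => z 0 p) N ^+ 2) / N%:R).

Lemma centered_small : exists t : nat -> R, [/\ forall N, 0 < t N,
  t @ \oo --> 0 & forall N i, sqnorm (centered (@a N) i) <= t N ^+ 2 * N%:R].
Proof.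
have spread0 N : 0 <= spread N.
  rewrite mulr_ge0// addr_ge0// divr_ge0//.
    by rewrite /max_sqnorm; elim/big_ind : _ => // [x y x0 y0|i _]; [rewrite le_max x0|exact: sqnorm_ge0].
  by rewrite sumr_ge0// => p _; rewrite sqr_ge0.
have invN : N%:R^-1 @[N --> \oo] --> (0 : R).
  by rewrite -cvg_shiftS; exact: cvg_harmonic.
have spread_cvg : spread N @[N --> \oo] --> (0 : R).
  rewrite [X in _ --> X](_ : 0 = 2 * (0 + (\sum_p (\int[rho]_z z 0 p) ^+ 2) * 0)); last by rewrite mulr0 addr0 mulr0.
  apply: cvgM; first exact: cvg_cst.
  apply: cvgD; first exact: max_sqnorm_cvg.
  apply: cvgM => //.
  apply: (@cvg_sumr _ _ _ (fun p N => mean (fun z => z 0 p) N ^+ 2)) => p.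
  under eq_cvg do rewrite expr2.
  by rewrite expr2; apply: cvgM; exact: cvg_coord.
(* The added [N.+1%:R^-1] keeps [t N] positive even where [spread N] vanishes; the variance estimate
   divides by it. *)
exists (fun N => Num.sqrt (spread N) + N.+1%:R^-1); split.
- by move=> N; rewrite ltr_wpDl ?sqrtr_ge0// invr_gt0.
- rewrite -[X in _ --> X]addr0; apply: cvgD; last exact: cvg_harmonic.
  rewrite -[X in _ --> X](sqrtr0 R); apply: continuous_cvg => //.
  exact: sqrt_continuous.
move=> N i; have N0 : (0 < N)%N by exact: leq_trans (ltn_ord i).
have NR : 0 < N%:R :> R by rewrite ltr0n.
apply: (@le_trans _ _ (spread N * N%:R)); last first.
  rewrite ler_wpM2r// -[leLHS]sqr_sqrtr//.
  by rewrite ler_sqr ?nnegrE ?addr_ge0 ?sqrtr_ge0// lerDl.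
rewrite (le_trans (sqnormB_le _ _))// /spread -mulrA ler_wpM2l// mulrDl !divfK ?gt_eqF//.
apply: lerD; first exact: (le_bigmax _ (fun i => sqnorm (a i)) i).
rewrite /sqnorm le_eqVlt; apply/orP; left; apply/eqP; apply: eq_bigr => p _.
by rewrite mxE summxE.
Unshelve. all: by end_near. Qed.

End population.

(** * From Laplace transforms to weak convergence *)

Section bernstein.
Context {R : realType}.
Implicit Types (f g : nat -> R) (u : R).

(* [binomial_mean n u f] is the mean of [f] under the binomial law of
   parameters [n] and [u], computed by conditioning on the first trial. *)
Fixpoint binomial_mean n u f : R :=
  if n is n'.+1 then
    u * binomial_mean n' u (fun k => f k.+1) + (1 - u) * binomial_mean n' u f
  else f 0%N.

(** The recursion is that of [binomial_mean], so that evaluation is immediate and no binomial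
    coefficient appears. *)
Fixpoint bernstein_poly n f : {poly R} :=
  if n is n'.+1 then
    'X * bernstein_poly n' (fun k => f k.+1) + (1 - 'X) * bernstein_poly n' f
  else (f 0%N)%:P.

Lemma horner_bernstein_poly n f u : (bernstein_poly n f).[u] = binomial_mean n u f.
Proof. by elim: n f => [|n IH] f /=; rewrite !hornerE ?IH. Qed.

Lemma binomial_mean_cst n u c : binomial_mean n u (fun=> c) = c.
Proof. by elim: n => //= n ->; ring. Qed.

Lemma binomial_meanD n u f g :
  binomial_mean n u (fun k => f k + g k) = binomial_mean n u f + binomial_mean n u g.
Proof. by elim: n f g => //= n IH f g; rewrite !IH; ring. Qed.

Lemma binomial_meanZ n u c f :
  binomial_mean n u (fun k => c * f k) = c * binomial_mean n u f.
Proof. by elim: n f => //= n IH f; rewrite !IH; ring. Qed.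

Lemma le_binomial_mean n u f g : 0 <= u <= 1 -> (forall k, f k <= g k) ->
  binomial_mean n u f <= binomial_mean n u g.
Proof.
move=> /andP[u0 u1]; elim: n f g => [|n IH] f g fg //=.
by apply: lerD; apply: ler_wpM2l; rewrite ?subr_ge0//; apply: IH.
Qed.

(** The centre [c] is arbitrary because conditioning on a success in the first trial shifts it to
    [c - 1]. *)
Lemma binomial_mean_sqr n u (c : R) :
  binomial_mean n u (fun k => (k%:R - c) ^+ 2) = n%:R * u * (1 - u) + (n%:R * u - c) ^+ 2.
Proof.
elim: n c => [|n IH] c /=; first by ring.
rewrite (_ : (fun k => (k.+1%:R - c) ^+ 2) = fun k => (k%:R - (c - 1)) ^+ 2).
  by rewrite !IH -natr1; ring.
by apply/funext => k; rewrite -natr1; congr (_ ^+ 2); ring.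
Qed.

Lemma ler_norm_binomial_mean n u f : 0 <= u <= 1 ->
  `|binomial_mean n u f| <= binomial_mean n u (fun k => `|f k|).
Proof.
move=> u01; rewrite ler_norml -[X in - X]mul1r -mulNr -binomial_meanZ.
by apply/andP; split; apply: le_binomial_mean => // k; [rewrite mulN1r lerNl -normrN|]; exact: ler_norm.
Qed.

End bernstein.

(** Compactness in its covering form, with radii [k.+1%:R^-1] so that being close becomes an
    eventual property along [\oo]. *)
Lemma unif_continuous_itv {R : realType} (G : R -> R) (a b e : R) :
  continuous G -> 0 < e -> exists2 r, 0 < r &
  forall x y, a <= x <= b -> `|x - y| < r -> `|G x - G y| < e.
Proof.
move=> cG e0.
have /compact_near_coveringP cov := @segment_compact R a b.
have [|K _ HK] := cov nat \oo (fun k x => forall y, `|x - y| < k.+1%:R^-1 -> `|G x - G y| < e) _.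
  move=> x _.
  have e20 : 0 < e / 2 by lra.
  have /cvgrPdist_lt cGx := cG x.
  have /nbhs_normP[r /= r0 rG] := cGx _ e20.
  have r20 : 0 < r / 2 by lra.
  near=> x' k => y xy.
  have h1 : `|x - x'| < r / 2.
    by near: x'; apply/nbhs_normP; exists (r / 2).
  have h2 : k.+1%:R^-1 < r / 2.
    by near: k; exact: (near_infty_natSinv_lt (PosNum r20)).
  have rr : r / 2 < r by rewrite ltr_pdivrMr// ltr_pMr// ltr1n.
  have g1 : `|G x - G x'| < e / 2 by apply: rG; rewrite /= (lt_trans h1).
  have g2 : `|G x - G y| < e / 2.
    apply: rG; rewrite /= (le_lt_trans (ler_distD x' _ _))// [ltRHS]splitr.
    by rewrite ltrD// (lt_trans xy).
  by rewrite (le_lt_trans (ler_distD (G x) _ _))// [`|G x' - _|]distrC; lra.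
exists K.+1%:R^-1; first by rewrite invr_gt0.
by move=> x y xab xy; apply: (HK K (leqnn K) x) => //=; rewrite in_itv.
Unshelve. all: by end_near. Qed.

Lemma weierstrass_itv01 {R : realType} (G : R -> R) (M e : R) :
  continuous G -> (forall u, `|G u| <= M) -> 0 < e ->
  exists p : {poly R}, forall u, 0 <= u <= 1 -> `|G u - p.[u]| <= e.
Proof.
move=> cG GM e0; have e20 : 0 < e / 2 by lra.
have M0 : 0 <= M by exact: le_trans (GM 0).
have [r r0 Gr] := unif_continuous_itv 0 1 cG e20.
(* Chebyshev's argument: where [k / n] is at least [r] away from [u], the error [2 * M] is at most
   [C * (k / n - u) ^ 2], and the variance [u (1 - u) / n] makes the mean of this at most
   [C / n]. *)
pose C := 2 * M / r ^+ 2.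
have C0 : 0 <= C by rewrite divr_ge0 ?sqr_ge0// mulr_ge0.
pose n := (Num.truncn (C / (e / 2))).+1.
have n0 : 0 < n%:R :> R by rewrite ltr0n.
have nC : C / n%:R <= e / 2.
  rewrite ler_pdivrMr// mulrC -ler_pdivrMr//; apply/ltW.
  by rewrite /n truncnS_gt.
pose f k := G (Num.min (k%:R / n%:R) 1).
exists (bernstein_poly n f) => u u01; have /andP[u0 u1] := u01.
rewrite horner_bernstein_poly -[G u](binomial_mean_cst n u).
rewrite -mulN1r -binomial_meanZ -binomial_meanD.
rewrite (le_trans (ler_norm_binomial_mean _ _ u01))//.
apply: (@le_trans _ _ (binomial_mean n u
    (fun k => e / 2 + C / n%:R ^+ 2 * (k%:R - n%:R * u) ^+ 2))).
  apply: le_binomial_mean => // k; rewrite mulN1r /f.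
  set v := Num.min _ _.
  have [uv|uv] := ltP `|u - v| r.
    by rewrite (le_trans (ltW (Gr _ _ u01 uv)))// lerDl mulr_ge0 ?sqr_ge0// divr_ge0 ?sqr_ge0.
  rewrite (@le_trans _ _ (2 * M))//.
    by rewrite (le_trans (ler_normB _ _))// mulr_natl mulr2n lerD.
  rewrite ler_wpDl ?(ltW e20)//.
  have kn : (k%:R - n%:R * u) ^+ 2 = n%:R ^+ 2 * (k%:R / n%:R - u) ^+ 2.
    by rewrite -exprMn mulrBr [_ * (_ / _)]mulrC divfK// gt_eqF.
  rewrite kn mulrA divfK ?gt_eqF ?exprn_gt0// /C.
  rewrite -mulrA ler_peMr ?mulr_ge0// mulrC ler_pdivlMr ?exprn_gt0// mul1r.
  rewrite -[leRHS]real_normK ?num_real// ler_sqr ?nnegrE ?(ltW r0)// (le_trans uv)//.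
  (* As [u <= 1], truncating [k / n] at [1] can only bring it closer to [u]. *)
  rewrite /v minElt; case: ifPn => [_|]; first by rewrite distrC.
  rewrite -leNgt => kn1; rewrite (@ger0_norm _ (k%:R / n%:R - u)).
    by rewrite distrC ger0_norm; lra.
  by rewrite subr_ge0 (le_trans u1).
rewrite binomial_meanD binomial_mean_cst binomial_meanZ binomial_mean_sqr.
rewrite subrr expr0n/= addr0.
have -> : C / n%:R ^+ 2 * (n%:R * u * (1 - u)) = C / n%:R * (u * (1 - u)).
  by field; rewrite gt_eqF.
have : C / n%:R * (u * (1 - u)) <= C / n%:R.
  have u1u : u * (1 - u) <= 1 by nra.
  by rewrite ler_piMr// divr_ge0// ltW.
lra.
Qed.

(* With [u = exp (- a t)], a function of [t >= 0] damped by [exp (- a t)]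
   extends continuously to [u = 0]. *)
Lemma exp_poly_approx {R : realType} (f : R -> R) (M a e : R) :
  continuous f -> (forall t, `|f t| <= M) -> 0 < a -> 0 < e ->
  exists p : {poly R}, forall t, 0 <= t ->
    `|f t * expR (- (a * t)) - p.[expR (- (a * t))]| <= e.
Proof.
move=> cf fM a0 e0; have M0 : 0 <= M by exact: le_trans (fM 0).
(* On [[0, 1]] the first factor is [u]. Clamping it keeps [G] bounded by [M] everywhere, and it
   vanishes for [u <= 0], where [ln u] carries no information. *)
pose G u := Num.min (Num.max u 0) 1 * f (- ln u / a).
have GM u : `|G u| <= M.
  rewrite normrM -[leRHS]mul1r ler_pM// ger0_norm ?ge_min ?lexx ?orbT//.
  by rewrite le_min le_max lexx orbT/=.
have cG : continuous G.
  move=> u; have [u0|u0] := ltP 0 u.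
    have c1 : {for u, continuous (fun u : R => Num.min (Num.max u 0) 1)}.
      have c0 : {for u, continuous (fun u : R => Num.max u 0)}.
        exact: (continuous_max (@cvg_id _ (nbhs u)) (@cst_continuous _ _ (0 : R) u)).
      exact: (continuous_min c0 (@cst_continuous _ _ (1 : R) u)).
    have c3 : {for u, continuous (fun u : R => - ln u / a)}.
      exact: (continuousM (continuousN (continuous_ln u0)) (@cst_continuous _ _ a^-1 u)).
    have c2 : {for u, continuous (fun u : R => f (- ln u / a))}.
      exact: (continuous_comp c3 (cf _)).
    exact: (continuousM c1 c2).
  apply/cvgrPdist_lt => eta eta0.
  have Gu : G u = 0 by rewrite /G (max_idPr u0) minElt ltr01 mul0r.
  have M1 : 0 < M + 1 by lra.
  near=> v; rewrite Gu sub0r normrN.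
  have uv : `|u - v| < eta / (M + 1).
    near: v; apply/nbhs_normP; exists (eta / (M + 1)) => //.
    exact: divr_gt0.
  rewrite /G normrM ger0_norm; last by rewrite le_min le_max lexx orbT/=.
  have vu : Num.min (Num.max v 0) 1 <= `|u - v|.
    have vu : v <= `|u - v|.
      by rewrite distrC (le_trans _ (ler_norm _))// lerDl oppr_ge0.
    by rewrite ge_min ge_max normr_ge0 vu.
  apply: (@le_lt_trans _ _ (`|u - v| * M)).
    by rewrite ler_pM// le_min le_max lexx orbT/=.
  move: uv; rewrite ltr_pdivlMr//; have := normr_ge0 (u - v); nra.
have [p Hp] := weierstrass_itv01 cG GM e0.
exists p => t t0; have u01 : 0 <= expR (- (a * t)) <= 1.
  by rewrite expR_ge0/= -expR0 ler_expR oppr_le0 mulr_ge0// ltW.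
have /andP[u0 u1] := u01.
have := Hp _ u01; rewrite /G expRK (max_idPl u0) (min_idPl u1).
by rewrite opprK mulrC [a * t]mulrC mulfK ?gt_eqF.
Unshelve. all: by end_near. Qed.

(** * Laplace transforms of the squared normal and chi-square laws *)

Section normal_laplace.
Context {R : realType}.
Local Notation mu := (@lebesgue_measure R).

(** The change of variables is stated with the Radon-Nikodym derivative, which equals the density
    almost everywhere because both have the same integral on every measurable set. *)
Lemma ge0_integral_normal_prob (m s : R) (f : R -> R) :
  measurable_fun setT f -> (forall x, 0 <= f x) ->
  (\int[normal_prob m s]_x (f x)%:E = \int[mu]_x (f x * normal_pdf m s x)%:E)%E.
Proof.
move=> mf f0; have dom := normal_prob_dominates m s.
have mfE : measurable_fun setT (fun x => (f x)%:E) by exact/measurable_EFinP.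
have fE0 x : (0 <= (f x)%:E)%E by rewrite lee_fin.
rewrite -(Radon_Nikodym_SigmaFinite.change_of_variables dom fE0)//.
have RNi := Radon_Nikodym_SigmaFinite.f_integrable dom.
have mpdf : measurable_fun setT (fun x => (normal_pdf m s x)%:E).
  by apply/measurable_EFinP; exact: measurable_normal_pdf.
apply: ae_eq_integral => //.
- by apply: emeasurable_funM => //; exact: (measurable_int _ RNi).
- by apply/measurable_EFinP; apply: measurable_funM => //; exact: measurable_normal_pdf.
have : ae_eq mu setT (Radon_Nikodym_SigmaFinite.f (normal_prob m s) mu)
    (fun x => (normal_pdf m s x)%:E).
  by apply: integral_ae_eq => // E _ mE; rewrite -Radon_Nikodym_SigmaFinite.f_integral.
by apply: filterS => x h _; rewrite h.
Qed.

Lemma normal_laplace (c : R) : 0 <= c ->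
  (\int[normal_prob 0 1]_x (expR (- (c * x ^+ 2)))%:E = ((Num.sqrt (1 + 2 * c))^-1)%:E)%E.
Proof.
move=> c0; have q0 : 0 < 1 + 2 * c by lra.
pose s := (Num.sqrt (1 + 2 * c))^-1; have s0 : 0 < s by rewrite invr_gt0 sqrtr_gt0.
have s2 : s ^+ 2 = (1 + 2 * c)^-1 by rewrite exprVn sqr_sqrtr// ltW.
have mexp : measurable_fun setT (fun x : R => expR (- (c * x ^+ 2))).
  apply: measurableT_comp => //; apply: measurableT_comp => //.
  by apply: measurable_funM => //; exact: exprn_measurable.
rewrite (ge0_integral_normal_prob _ _ mexp); last by move=> x; exact: expR_ge0.
(* Completing the Gaussian: the damped standard density is [s] times the centered density of
   variance [s ^ 2 = 1 / (1 + 2 c)], which integrates to one. *)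
have E x : expR (- (c * x ^+ 2)) * normal_pdf 0 1 x = s * normal_pdf 0 s x.
  rewrite !normal_pdfE ?oner_neq0 ?gt_eqF// /normal_peak /normal_fun !subr0.
  have -> : Num.sqrt (s ^+ 2 * pi *+ 2) = s * Num.sqrt (1 ^+ 2 * pi *+ 2).
    by rewrite -mulrnAr sqrtrM ?sqr_ge0// sqrtr_sqr gtr0_norm// expr1n mul1r.
  set k := Num.sqrt (1 ^+ 2 * pi *+ 2).
  rewrite invfM -[_^-1 * _ * expR _]mulrA mulVKf ?gt_eqF//.
  rewrite mulrCA; congr (_ * _).
  rewrite -expRD; congr expR; rewrite s2 expr1n.
  by field; rewrite gt_eqF.
under eq_integral do rewrite E EFinM.
rewrite integralZl//; last exact: integrable_normal_pdf.
by rewrite integral_normal_pdf mule1.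
Qed.

End normal_laplace.

Section chi_square_theory.
Context {R : realType}.

Let addsqr (p : measurableTypeR R * R) : R := p.1 ^+ 2 + p.2.

Let measurable_addsqr : measurable_fun setT addsqr.
Proof.
apply: measurable_funD => //.
by apply: measurable_funX; exact: measurable_fst.
Qed.

(** [chi_square] is a bare set function; this supplies the probability structure on which the
    integration lemmas rely. *)
Lemma chi_square_probability (d : nat) :
  exists mu : probability R R, chi_square d = mu :> (set R -> \bar R).
Proof.
elim: d => [|d [mu IH]]; first by exists (\d_(0 : R)).
pose X : {mfun (measurableTypeR R * R)%type >-> R} := mfun_Sub (mem_set measurable_addsqr).
by exists (distribution (normal_prob (0 : R) 1 \x mu)%E X); rewrite /= IH.
Qed.

Lemma ge0_integral_chi_squareS (d : nat) (f : R -> \bar R) :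
  measurable_fun setT f -> (forall x, 0 <= f x)%E ->
  (\int[chi_square d.+1]_t f t =
   \int[normal_prob (0 : R) 1]_x \int[chi_square d]_y f (x ^+ 2 + y)%R)%E.
Proof.
move=> mf f0; have [mu E] := chi_square_probability d.
rewrite /= E ge0_integral_pushforward//.
rewrite preimage_setT fubini_tonelli1//.
  by apply: measurableT_comp.
by move=> x; exact: f0.
Qed.

Lemma chi_square_laplace (d : nat) (c : R) : 0 <= c ->
  (\int[chi_square d]_t (expR (- (c * t)))%:E = ((Num.sqrt (1 + 2 * c))^-1 ^+ d)%:E)%E.
Proof.
move=> c0; elim: d => [|d IH].
  rewrite /= integral_dirac//; last by apply/measurable_EFinP; apply: measurableT_comp => //; apply: measurableT_comp.
  by rewrite diracT mul1e mulr0 oppr0 expR0 expr0.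
have mexp : measurable_fun setT (fun t : R => expR (- (c * t))).
  by apply: measurableT_comp => //; apply: measurableT_comp.
have mexpE : measurable_fun setT (fun t : R => (expR (- (c * t)))%:E).
  exact/measurable_EFinP.
have exp0 (t : R) : (0 <= (expR (- (c * t)))%:E)%E by rewrite lee_fin expR_ge0.
rewrite (ge0_integral_chi_squareS d mexpE exp0).
transitivity (\int[normal_prob (0 : R) 1]_x
    ((expR (- (c * x ^+ 2)))%:E * \int[chi_square d]_y (expR (- (c * y)))%:E))%E.
  apply: eq_integral => x _; have [mu E] := chi_square_probability d.
  rewrite E -ge0_integralZl ?lee_fin ?expR_ge0//.
  by apply: eq_integral => y _; rewrite -EFinM -expRD; congr ((expR _)%:E); ring.
rewrite IH ge0_integralZr//.
- by rewrite normal_laplace// -EFinM exprS.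
- apply/measurable_EFinP; apply: measurableT_comp => //; apply: measurableT_comp => //.
  by apply: measurable_funM => //; exact: exprn_measurable.
Qed.

Lemma chi_square_lt0 (d : nat) : chi_square d [set t : R | t < 0] = 0%E.
Proof.
have mneg : measurable [set t : R | t < 0].
  by rewrite (_ : [set t | _] = `]-oo, 0[%classic)//; apply/seteqP; split => t /=; rewrite in_itv.
elim: d => [|d IH]; first by rewrite /= diracE memNset//= ltxx.
have [mu E] := chi_square_probability d.
rewrite /= /pushforward /product_measure1; apply: integral0_eq => x _ /=.
rewrite E in IH *; apply: (@subset_measure0 _ _ _ mu _ [set t : R | t < 0]) => //.
  apply: measurable_xsection; rewrite -[X in measurable X]setTI.
  exact: measurable_addsqr.
move=> y; rewrite /xsection /= inE /= => h; have := sqr_ge0 x; lra.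
Qed.

End chi_square_theory.

(** * A continuity theorem for Laplace transforms *)

Section laplace_perm_mean.
Context {R : realType}.
Variables (mu : probability R R) (L : R -> R).
Variables (N : nat -> nat) (T : forall k, 'S_(N k) -> R).
Hypothesis T_ge0 : forall k s, 0 <= @T k s.
Hypothesis mu_lt0 : mu [set t | t < 0] = 0%E.
Hypothesis mu_laplace : forall c, 0 <= c ->
  (\int[mu]_t (expR (- (c * t)))%:E = (L c)%:E)%E.
Hypothesis L_cont : {for 0, continuous L}.
Hypothesis T_laplace : forall c, 0 <= c ->
  perm_mean (fun s => expR (- (c * @T k s))) @[k --> \oo] --> L c.

(** The nonnegative half-line, in the form left by [negligible_integral]. The exponentials are
    bounded there, but not on the whole line. *)
Let D : set R := setT `\` [set t | t < 0].

Let D_ge0 t : D t -> 0 <= t.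
Proof. by case=> _ /negP; rewrite -leNgt. Qed.

Let mneg : measurable [set t : R | t < 0].
Proof.
by rewrite (_ : [set t | _] = `]-oo, 0[%classic)//; apply/seteqP; split => t /=; rewrite in_itv.
Qed.

Let mD : measurable D. Proof. exact: measurableD. Qed.

Let ae_mean (f : R -> R) := \int[mu]_(t in D) f t.

Let mu_D : mu D = 1%E.
Proof.
by rewrite /D setTD probability_setC// mu_lt0 sube0.
Qed.

Let bounded_integrable (f : R -> R) (M : R) : measurable_fun setT f ->
  (forall t, 0 <= t -> `|f t| <= M) -> mu.-integrable D (EFin \o f).
Proof.
move=> mf fM; apply: measurable_bounded_integrable => //.
- by rewrite [X in (X < _)%E]mu_D ltry.
- exact: measurable_funTS.
- by exists M; split; rewrite ?num_real// => K MK t /D_ge0 t0; exact: le_trans (fM _ t0) (ltW MK).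
Qed.

Let mexp c : measurable_fun setT (fun t : R => expR (- (c * t))).
Proof. by apply: measurableT_comp => //; apply: measurableT_comp. Qed.

Let exp_le1 c t : 0 <= c -> 0 <= t -> `|expR (- (c * t))| <= 1 :> R.
Proof.
by move=> c0 t0; rewrite ger0_norm ?expR_ge0// -expR0 ler_expR oppr_le0 mulr_ge0.
Qed.

Let exp1_ge0 c t : 0 <= c -> 0 <= t -> 0 <= 1 - expR (- (c * t)) :> R.
Proof. by move=> c0 t0; rewrite subr_ge0 (le_trans (ler_norm _))// exp_le1. Qed.

Let exp1_le1 c t : 0 <= c -> 0 <= t -> `|1 - expR (- (c * t))| <= 1 :> R.
Proof. by move=> c0 t0; rewrite ger0_norm ?exp1_ge0// gerBl expR_ge0. Qed.

Let iexp c : 0 <= c -> mu.-integrable D (EFin \o (fun t : R => expR (- (c * t)))).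
Proof. by move=> c0; apply: (@bounded_integrable _ 1) => // t t0; exact: exp_le1. Qed.

Let ae_mean_exp c : 0 <= c -> ae_mean (fun t => expR (- (c * t))) = L c.
Proof.
move=> c0; rewrite -[RHS]/(fine (L c)%:E) -(mu_laplace c0) (@ge0_negligible_integral _ _ _ mu _ _ _ mneg)//.
  exact/measurable_EFinP.
Qed.

Let L0 : L 0 = 1.
Proof.
rewrite -ae_mean_exp// /ae_mean.
under eq_Rintegral do rewrite mul0r oppr0 expR0.
by rewrite Rintegral_cst// [X in fine X]mu_D mulr1.
Qed.

Let iZexp (a : R) c : 0 <= c ->
  mu.-integrable D (EFin \o (fun t : R => a * expR (- (c * t)))).
Proof.
move=> c0; apply: (@bounded_integrable _ `|a|) => [|t t0].
  exact: measurable_funM.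
by rewrite normrM ler_piMr// exp_le1.
Qed.

Let poly_exp (p : {poly R}) a t :
  p.[expR (- (a * t))] = \sum_(j < size p) p`_j * expR (- (j%:R * a * t)).
Proof.
by rewrite horner_coef; apply: eq_bigr => j _; rewrite -expRM_natl mulrN mulrA.
Qed.

Let ipoly (p : {poly R}) a : 0 <= a ->
  mu.-integrable D (EFin \o (fun t : R => p.[expR (- (a * t))])).
Proof.
move=> a0; under [X in EFin \o X]eq_fun do rewrite poly_exp.
rewrite (_ : _ \o _ = fun t => (\sum_(j < size p) (p`_j * expR (- (j%:R * a * t)))%:E)%E).
  by apply: integrable_sum => // j _; apply: iZexp; rewrite mulr_ge0.
by apply/funext => t /=; rewrite sumEFin.
Qed.

Let ae_mean_poly (p : {poly R}) a : 0 <= a ->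
  ae_mean (fun t => p.[expR (- (a * t))]) = \sum_(j < size p) p`_j * L (j%:R * a).
Proof.
move=> a0; rewrite /ae_mean /Rintegral.
under eq_integral do rewrite poly_exp -sumEFin.
rewrite integral_sum//=; last by move=> j; apply: iZexp; rewrite mulr_ge0.
rewrite -[RHS]/(fine (_)%:E) -sumEFin; congr fine; apply: eq_bigr => j _.
have ja0 : 0 <= j%:R * a by rewrite mulr_ge0.
rewrite -(fineK (integrable_fin_num mD (iZexp _ ja0))) -/(Rintegral _ _ _).
by rewrite RintegralZl// ?iexp// -/(ae_mean _) ae_mean_exp.
Qed.

Let perm_mean_poly (p : {poly R}) a : 0 <= a ->
  perm_mean (fun s => p.[expR (- (a * @T k s))]) @[k --> \oo] -->
  \sum_(j < size p) p`_j * L (j%:R * a).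
Proof.
move=> a0.
rewrite (_ : (fun k => _) = fun k => \sum_(j < size p)
    p`_j * perm_mean (fun s => expR (- (j%:R * a * @T k s)))); last first.
  apply/funext => k; under eq_perm_mean do rewrite poly_exp.
  by rewrite perm_mean_sum; apply: eq_bigr => j _; rewrite perm_meanZ.
apply: (@cvg_sumr _ _ (index_enum 'I_(size p)) (fun j k => p`_j * perm_mean (fun s => expR (- (j%:R * a * @T k s))))
  (fun j => p`_j * L (j%:R * a))) => j.
by apply: cvgM; [exact: cvg_cst|apply: T_laplace; rewrite mulr_ge0].
Qed.

(** Replacing [f] by its damped version costs at most [M * (1 - exp (- a t))], whose [mu]-mean
    [M * (1 - L a)] is small for small [a], as [L] is continuous at [0] with [L 0 = 1]. Convergence
    of the transforms at this [a] controls the same cost under the permutation laws and so plays the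
    part of tightness. *)
Lemma laplace_perm_mean_cvg (f : R -> R) (M : R) : continuous f ->
  (forall t, `|f t| <= M) ->
  (perm_mean (fun s => f (@T k s)))%:E @[k --> \oo] --> (\int[mu]_t (f t)%:E)%E.
Proof.
move=> cf fM; have M0 : 0 <= M by exact: le_trans (fM 0).
have mf : measurable_fun setT f by exact: continuous_measurable_fun.
have if_ : mu.-integrable D (EFin \o f) by exact: (@bounded_integrable _ M).
have ifT : mu.-integrable setT (EFin \o f).
  apply: measurable_bounded_integrable => //; first by rewrite [X in (X < _)%E]probability_setT ltry.
  by exists M; split; rewrite ?num_real// => K MK t _; exact: le_trans (fM _) (ltW MK).
rewrite (negligible_integral mneg measurableT ifT mu_lt0) -/D.
rewrite -(fineK (integrable_fin_num mD if_)) -/(Rintegral _ _ _) -/(ae_mean f).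
apply/cvg_EFin; first by near=> k.
rewrite [X in X @ _](_ : _ = fun k => perm_mean (fun s => f (@T k s)))//.
apply/cvgrPdist_le => e e0.
(* Error budget: [2 * e8] under [mu], [e8] for the means of the polynomial, [3 * e8] under the
   permutation law, where the damping cost is only known in the limit. *)
pose e8 := e / 8; have e80 : 0 < e8 by rewrite /e8; lra.
have [a a0 La] : exists2 a, 0 < a & M * (1 - L a) <= e8.
  have cML : {for 0, continuous (fun a => M * (1 - L a))}.
    apply: continuousM; first exact: cst_continuous.
    by apply: continuousB => //; exact: cst_continuous.
  move/cvgrPdist_le : cML => /(_ _ e80) [r /= r0 H].
  have r20 : 0 < r / 2 by lra.
  exists (r / 2) => //.
  have := H (r / 2); rewrite /ball_/= sub0r normrN gtr0_norm// L0 subrr mulr0 sub0r normrN.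
  by move=> /(_ ltac:(lra)); exact: le_trans (ler_norm _).
have [p pf] := exp_poly_approx cf fM a0 e80.
have a0' := ltW a0.
have bound t : 0 <= t ->
    `|f t - p.[expR (- (a * t))]| <= M * (1 - expR (- (a * t))) + e8.
  move=> t0; have -> : f t - p.[expR (- (a * t))] =
    f t * (1 - expR (- (a * t))) + (f t * expR (- (a * t)) - p.[expR (- (a * t))]) by ring.
  rewrite (le_trans (ler_normD _ _))// lerD//; last exact: pf.
  by rewrite normrM (ger0_norm (exp1_ge0 a0' t0)) ler_wpM2r// exp1_ge0.
pose Lp := \sum_(j < size p) p`_j * L (j%:R * a).
have mu_bound : `|ae_mean f - Lp| <= e8 + e8.
  rewrite /Lp -ae_mean_poly// /ae_mean -RintegralB//; last exact: ipoly.
  have i1 : mu.-integrable D (EFin \o (fun t => M * (1 - expR (- (a * t))) + e8)).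
    apply: (@bounded_integrable _ (M * 1 + e8)) => [|t t0].
      apply: measurable_funD => //; apply: measurable_funM => //.
      exact: measurable_funB.
    rewrite (le_trans (ler_normD _ _))// (gtr0_norm e80) lerD2r normrM (ger0_norm M0).
    by rewrite ler_wpM2l// exp1_le1.
  have ifp : mu.-integrable D (EFin \o (fun t => f t - p.[expR (- (a * t))])).
    rewrite (_ : _ \o _ = (EFin \o f) \- (EFin \o (fun t => p.[expR (- (a * t))])))%E//.
    by apply: integrableB => //; exact: ipoly.
  apply: (@le_trans _ _ (ae_mean (fun t => M * (1 - expR (- (a * t))) + e8))).
    apply: (@le_trans _ _ (ae_mean (fun t => `|f t - p.[expR (- (a * t))]|))).
      by apply: le_normr_Rintegral => //; exact: ifp.
    apply: le_Rintegral => //; first by have := integrable_abse ifp.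
    by move=> t /D_ge0; exact: bound.
  rewrite /ae_mean RintegralD//; last 2 first.
  - apply: (@bounded_integrable _ (M * 1)) => [|t t0].
      by apply: measurable_funM => //; exact: measurable_funB.
    by rewrite normrM (ger0_norm M0) ler_wpM2l// exp1_le1.
  - by apply: (@bounded_integrable _ e8) => // t _; rewrite gtr0_norm.
  rewrite Rintegral_cst// [X in fine X]mu_D mulr1 lerD2r RintegralZl//; last first.
    apply: (@bounded_integrable _ 1) => [|t t0]; [exact: measurable_funB|exact: exp1_le1].
  rewrite RintegralB//; last 2 first.
  - by apply: (@bounded_integrable _ 1) => // t _; rewrite normr1.
  - exact: iexp.
  by rewrite Rintegral_cst// [X in fine X]mu_D mulr1 -/(ae_mean _) ae_mean_exp.
have := @perm_mean_poly p a a0'; rewrite -/Lp => pcvg.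
have Tcvg : M * (1 - perm_mean (fun s => expR (- (a * @T k s)))) @[k --> \oo] --> M * (1 - L a).
  apply: cvgM; first exact: cvg_cst.
  by apply: cvgB; [exact: cvg_cst|exact: T_laplace].
near=> k.
have h1 : `|Lp - perm_mean (fun s => p.[expR (- (a * @T k s))])| <= e8.
  by near: k; move/cvgrPdist_le : pcvg; exact.
have h2 : perm_mean (fun s => M * (1 - expR (- (a * @T k s)))) <= e8 + e8.
  rewrite perm_meanZ perm_meanB perm_mean_cst.
  have : `|M * (1 - L a) - M * (1 - perm_mean (fun s => expR (- (a * @T k s))))| <= e8.
    by near: k; move/cvgrPdist_le : Tcvg; exact.
  by rewrite ler_norml => /andP[+ _]; lra.
have h3 : `|perm_mean (fun s => f (@T k s)) - perm_mean (fun s => p.[expR (- (a * @T k s))])| <=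
    e8 + e8 + e8.
  rewrite -perm_meanB (le_trans (ler_norm_perm_mean _))//.
  apply: (@le_trans _ _ (perm_mean (fun s => M * (1 - expR (- (a * @T k s))) + e8))).
    by apply: le_perm_mean => s; exact: bound.
  by rewrite perm_meanD perm_mean_cst lerD2r.
move: mu_bound h1 h3; rewrite !ler_norml => /andP[b1 b2] /andP[b3 b4] /andP[b5 b6].
rewrite /e8 in b1 b2 b3 b4 b5 b6; apply/andP; split; lra.
Unshelve. all: by end_near. Qed.

End laplace_perm_mean.

(** The differential equation yields the limit of the squared transforms; both transforms are
    nonnegative, so continuity of the square root recovers them. *)
Lemma perm_mean_chi_square_cvg {R : realType} (d : nat) (N : nat -> nat)
    (T : forall k, 'S_(N k) -> R) (f : R -> R) (M : R) :
  (forall k s, 0 <= T k s) ->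
  (forall c, 0 <= c -> perm_mean (fun s => expR (- (c * T k s))) ^+ 2
     @[k --> \oo] --> ((1 + 2 * c) ^+ d)^-1) ->
  continuous f -> (forall t, `|f t| <= M) ->
  (perm_mean (fun s => f (T k s)))%:E @[k --> \oo] --> (\int[chi_square d]_t (f t)%:E)%E.
Proof.
move=> T0 Tcvg cf fM; have [mu E] := @chi_square_probability R d.
pose L c : R := (Num.sqrt (1 + 2 * c))^-1 ^+ d.
rewrite E; apply: (@laplace_perm_mean_cvg _ mu L _ T T0 _ _ _ _ f M) => //.
- by rewrite -E chi_square_lt0.
- by move=> c c0; rewrite -E chi_square_laplace.
- have c1 : {for 0, continuous (fun c : R => 1 + 2 * c)}.
    apply: continuousD; first exact: cst_continuous.
    by apply: continuousM; [exact: cst_continuous|by []].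
  have c2 : {for 0, continuous (fun c : R => (Num.sqrt (1 + 2 * c))^-1)}.
    apply: continuousV; first by rewrite mulr0 addr0 sqrtr1 oner_neq0.
    exact: (continuous_comp c1 (@sqrt_continuous R _)).
  exact: (continuous_comp c2 (@exprn_continuous R d _)).
move=> c c0.
have -> : L c = Num.sqrt ((1 + 2 * c) ^+ d)^-1.
  have c1 : 0 <= 1 + 2 * c by rewrite addr_ge0// mulr_ge0.
  have Lc0 : 0 <= L c by rewrite exprn_ge0// invr_ge0 sqrtr_ge0.
  rewrite -[LHS]ger0_norm// -sqrtr_sqr; congr Num.sqrt.
  by rewrite /L exprAC exprVn sqr_sqrtr// exprVn.
rewrite (_ : (fun k => _) = fun k => Num.sqrt (perm_mean (fun s => expR (- (c * T k s))) ^+ 2)).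
  by apply: continuous_cvg; [exact: sqrt_continuous|exact: Tcvg].
apply/funext => k; rewrite sqrtr_sqr ger0_norm// perm_mean_ge0//.
Qed.

(** Because [sigma] takes finitely many values, each on a measurable set, [g \o sigma] is measurable
    for every [g]. *)
Lemma integral_pushforward_perm {R : realType} {disp} {Omega : measurableType disp}
    (P : probability Omega R) (N : nat) (sigma : Omega -> 'S_N) (g : 'S_N -> R)
    (f : R -> R) (M : R) :
  (forall s, measurable (sigma @^-1` [set s])) -> measurable_fun setT f ->
  (forall t, `|f t| <= M) ->
  (\int[pushforward P (g \o sigma)]_t (f t)%:E = \int[P]_w (f (g (sigma w)))%:E)%E.
Proof.
move=> sigma_meas mf fM.
have mg : measurable_fun setT (g \o sigma).
  move=> _ A _; rewrite setTI.
  rewrite (_ : _ @^-1` A = \bigcup_(s in [set s | A (g s)]) sigma @^-1` [set s]).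
    by apply: fin_bigcup_measurable => //; exact: finite_finset.
  apply/seteqP; split=> [w Aw|w [s As ws]]; first by exists (sigma w).
  by rewrite /= ws.
rewrite integral_pushforward//.
  exact/measurable_EFinP.
rewrite preimage_setT.
apply: (@measurable_bounded_integrable _ _ _ P (fun w => f (g (sigma w)))) => //.
- by rewrite [X in (X < _)%E]probability_setT ltry.
- exact: measurableT_comp.
- by exists M; split; rewrite ?num_real// => K MK t _; exact: le_trans (fM _) (ltW MK).
Qed.

Theorem theorem3p1 (R : realType) (d : nat) (d_gt0 : (0 < d)%N)
  (mu1 mu2 nu : probability 'rV[R]_d R)
  (mu1_ac : abs_continuous mu1) (mu2_ac : abs_continuous mu2)
  (nu_ac : abs_continuous nu)
  (J : 'rV[R]_d -> 'rV[R]_d) (J_inj : injective J)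
  (J_cont : lebesgue_rV.-negligible [set z | ~ {for z, continuous J}])
  (rho : probability 'rV[R]_d R) (rhoE : is_image_measure J nu rho)
  (rho_cov : has_finite_covariance rho)
  (rho_posdef : posdefmx (covariance_mx rho))
  (h : forall N : nat, 'I_N -> 'rV[R]_d)
  (h_cvg : weak_cvg (fun N => empirical_measure (h N)) nu)
  (h_limsup :
    (limn_esup (fun N => (N%:R^-1 * \sum_(i < N) sqnorm (J (h N i)))%:E) <=
     \int[nu]_z (sqnorm (J z))%:E)%E)
  (m n : nat -> nat)
  (N_infty : (m k + n k)%N @[k --> \oo] --> \oo)
  (lambda : R) (lambda01 : 0 < lambda < 1)
  (m_lambda : (m k)%:R / (m k + n k)%:R @[k --> \oo] --> lambda)
  (disp : nat -> measure_display)
  (Omega : forall k, measurableType (disp k))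
  (P : forall k, probability (Omega k) R)
  (X : forall k, 'I_(m k) -> {RV (P k) >-> 'rV[R]_d})
  (Y : forall k, 'I_(n k) -> {RV (P k) >-> 'rV[R]_d})
  (X_iid : forall k, iid_sample (X k) mu1)
  (Y_iid : forall k, iid_sample (Y k) mu2)
  (XY_indep : forall k, independent_samples (X k) (Y k))
  (sigma : forall k, Omega k -> 'S_(m k + n k))
  (sigma_meas : forall k s, measurable (sigma k @^-1` [set s]))
  (sigma_opt : forall k w, optimal_assignment
    (pooled (fun i => X k i w) (fun j => Y k j w)) (h (m k + n k)%N)
    (sigma k w))
  (H0 : forall A, measurable A -> mu1 A = mu2 A) :
  weak_cvg
    (fun k => pushforward (P k) (fun w =>
       rank_hotelling (covariance_mx rho) J (h (m k + n k)%N) (sigma k w)))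
    (chi_square d).
Proof.
(* The analytic lemmas are stated in dimension [d.+1]; all data that depend on [d] are generalized
   before the case analysis. *)
case: d d_gt0 mu1 mu2 nu mu1_ac mu2_ac nu_ac J J_inj J_cont rho rhoE rho_cov rho_posdef
  h h_cvg h_limsup X Y X_iid Y_iid XY_indep sigma_opt H0 => [//|d] _ mu1 mu2 nu mu1_ac _ nu_ac
  J _ [D0 [mD0 D0_null J_cont]] rho rhoE rho_cov rho_posdef h h_cvg h_limsup
  X Y X_iid Y_iid XY_indep sigma_opt H0 f cf [M fM].
(* Absolute continuity of [nu] carries the almost everywhere continuity of [J] from Lebesgue measure
   to [nu]. *)
have nuD0 : nu D0 = 0%E by exact: nu_ac.
have JC z : ~ D0 z -> {for z, continuous J}.
  by move=> zD; apply: contrapT => /J_cont.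
have mean_gt (g : 'rV[R]_d.+1 -> R) c := @mean_score_gt _ _ _ _ _ _ mD0 nuD0 JC rhoE h g c h_cvg.
have mean_limsup := limsup_mean_sqnorm mD0 nuD0 JC rhoE
  (continuous_measurable_mx continuous_sqnorm) (@sqnorm_ge0 R d.+1) h_limsup.
have mcvg := @mean_cvg _ _ rho (fun N => J \o h N) rho_cov mean_gt mean_limsup.
have [t [t0 tcvg bt]] := centered_small rho_cov mcvg.
have ST := covariance_mxT rho.
pose T k (s : 'S_(m k + n k)) := rank_hotelling (covariance_mx rho) J (h (m k + n k)%N) s.
have T0 k s : 0 <= T k s by exact: rank_hotelling_ge0.
have Tcvg c : 0 <= c -> perm_mean (fun s => expR (- (c * T k s))) ^+ 2
     @[k --> \oo] --> ((1 + 2 * c) ^+ d.+1)^-1.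
  exact: (rank_hotelling_laplace_cvg N_infty lambda01 m_lambda ST rho_posdef
    (mean_centered_cvg rho_cov mcvg) t0 tcvg bt).
rewrite (_ : (fun k => _) = fun k => (perm_mean (fun s => f (T k s)))%:E); last first.
  apply/funext => k; rewrite (@integral_pushforward_perm _ _ _ (P k) _ (@sigma k) (T k) f M)//.
    (* The null hypothesis enters here, through the common law of the pooled sample. *)
    have Y_iid1 : iid_sample (Y k) mu1.
      by have [Yi Yd] := Y_iid k; split => // i A mA; rewrite Yd// H0.
    (* The statistic depends on the permutation only through the ranks [h (s i)], so repeated
       vectors in [h] do no harm. *)
    apply: (mean_ranks (X_iid k) Y_iid1 (XY_indep k) mu1_ac (sigma_meas k) (sigma_opt k)) => s u su.
    rewrite /T /rank_hotelling /score_difference.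
    by under eq_bigr do rewrite su; under [in X in _ - X]eq_bigr do rewrite su.
  exact: continuous_measurable_fun.
exact: perm_mean_chi_square_cvg T0 Tcvg cf fM.
Qed.
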